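(* Let $V$ be a unital JB-algebra. Then $\mathrm{Str}(V)$ is an algebraic subgroup of $GL(V)$. Hence $\mathrm{Str}(V)$ is an embedded Banach-Lie subgroup of $GL(V)$, and if $\mathcal B=\{X\in B(V):\|X\|<\frac{\pi}{3}\}$, then $$\exp(\mathcal B\cap \mathrm{Lie}(\mathrm{Str}(V)))=\exp(\mathcal B)\cap \mathrm{Str}(V).$$ Moreover $\mathrm{Lie}(\mathrm{Str}(V))=\mathrm{str}(V)$, where $$\mathrm{str}(V)=\{H\in B(V): \exists\,\overline H\in B(V)\text{ such that } 2U_{x,Hx}=HU_x-U_x\overline H\ \ \forall x\in V\}.$$
   Context: A (unital) JB-algebra is a real Jordan algebra $(V,\circ)$ with unit $1$ (the product is bilinear, commutative and $x^2\circ(x\circ y)=x\circ(x^2\circ y)$) with a complete norm such that $\|x\circ y\|\le\|x\|\|y\|$, $\|x^2\|=\|x\|^2$, $\|x^2\|\le\|x^2+y^2\|$; it may be infinite dimensional. $B(V)$ is the algebra of bounded linear operators on $V$ with the operator norm and $GL(V)$ its group of invertible elements, a Banach-Lie group with Lie algebra $B(V)$ and the usual exponential. $L_xy=x\circ y$, $U_x=2L_x^2-L_{x^2}$, $U_{x,y}=\frac12(U_{x+y}-U_x-U_y)=L_xL_y+L_yL_x-L_{x\circ y}$. The structure group $\mathrm{Str}(V)$ is the set of $g\in GL(V)$ for which there is $g^*\in GL(V)$ with $U_{gx}=gU_xg^*$ for all $x\in V$. A subgroup $G\subset GL(V)$ is algebraic if there is a family of (continuous) polynomial maps $P_i:B(V)\times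 B(V)\to B(V)$ such that $G=\{g\in GL(V): P_i(g,g^{-1})=0\ \forall i\}$. An embedded Banach-Lie subgroup of $GL(V)$ is a closed subgroup $G$ that is an embedded submanifold and a Banach-Lie group with the induced (norm) topology; its Lie algebra is $\mathrm{Lie}(G)=T_{\mathrm{Id}}G=\{H\in B(V): e^{tH}\in G\ \forall t\in\mathbb R\}$. *)

(* Defs.v *)
From HB Require Import structures.
From mathcomp Require Import all_boot all_order all_algebra.
From mathcomp Require Import all_classical all_reals all_analysis.

Set Implicit Arguments.
Unset Strict Implicit.
Unset Printing Implicit Defensive.

Import Order.TTheory GRing.Theory Num.Theory.
Import numFieldNormedType.Exports.

Local Open Scope classical_set_scope.
Local Open Scope ring_scope.


Definition bounded_linear (R : realType) (E F : normedModType R) (f : E -> F) :=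
  linear f /\ exists M : R, forall x, `|f x| <= M * `|x|.

Definition is_bop (R : realType) (E F : normedModType R) : {pred E -> F} :=
  fun f => `[< bounded_linear f >].

Record bop (R : realType) (E F : normedModType R) := Bop {
  bop_fun :> E -> F ;
  bop_subproof : is_bop bop_fun }.
Arguments Bop {R E F}.
Arguments bop_fun {R E F}.

Section bop_normed.
Context (R : realType) (E F : normedModType R).

HB.instance Definition _ := [isSub of bop E F for bop_fun].
HB.instance Definition _ := [Choice of bop E F by <:].

Lemma bopP (f : bop E F) : bounded_linear f.
Proof. exact/asboolP/(valP f). Qed.

Lemma is_bop_submod : submod_closed (@is_bop R E F).
Proof.
split.
  apply/asboolP; split; first by move=> a x y; rewrite /= scaler0 addr0.
  by exists 0 => x; rewrite normr0 mul0r.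
move=> a f g /asboolP[lf [M Mf]] /asboolP[lg [N Ng]]; apply/asboolP; split.
  move=> b x y; rewrite /= !fctE lf lg !scalerDr !scalerA addrACA (mulrC b).
  by [].
exists (`|a| * M + N) => x; rewrite !fctE mulrDl -mulrA.
by rewrite (le_trans (ler_normD _ _))// normrZ lerD// ler_wpM2l.
Qed.

HB.instance Definition _ := GRing.isSubmodClosed.Build R (E -> F)
  (@is_bop R E F) is_bop_submod.
HB.instance Definition _ := [SubChoice_isSubLmodule of bop E F by <:].

Lemma bopD (f g : bop E F) x : (f + g) x = f x + g x.
Proof. by []. Qed.

Lemma bopZ a (f : bop E F) x : (a *: f) x = a *: f x.
Proof. by []. Qed.

Lemma bop0 x : (0 : bop E F) x = 0.
Proof. by []. Qed.

Lemma bopN (f : bop E F) x : (- f) x = - f x.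
Proof. by []. Qed.

Definition opnorm (f : bop E F) : R := sup [set `|f x| | x in [set x | `|x| <= 1]].

Lemma opnorm_has_sup (f : bop E F) :
  has_sup [set `|f x| | x in [set x | `|x| <= 1]].
Proof.
split; first by exists `|f 0|, 0 => //=; rewrite normr0.
have [_ [M Mf]] := bopP f.
exists `|M| => _ [x /= x1 <-]; rewrite (le_trans (Mf x))//.
rewrite (le_trans (ler_wpM2r _ (ler_norm M)))//.
by rewrite -[leRHS]mulr1 ler_wpM2l.
Qed.

Lemma opnorm_ub (f : bop E F) x : `|x| <= 1 -> `|f x| <= opnorm f.
Proof. by move=> x1; apply: (sup_upper_bound (opnorm_has_sup f)); exists x. Qed.

Lemma opnorm_le (f : bop E F) (M : R) :
  (forall x, `|x| <= 1 -> `|f x| <= M) -> opnorm f <= M.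
Proof.
move=> Mf; apply: sup_le_ub; first by case: (opnorm_has_sup f).
by move=> _ [x /= x1 <-]; exact: Mf.
Qed.

Lemma bop_scale (f : bop E F) a x : f (a *: x) = a *: f x.
Proof.
have [lf _] := bopP f.
have f0 : f 0 = 0.
  by have := lf 1 0 0; rewrite scaler0 scale1r addr0 => /esym/eqP;
     rewrite -subr_eq0 addrK => /eqP.
by rewrite -[a *: x]addr0 lf f0 addr0.
Qed.

Lemma bop_zero (f : bop E F) : f 0 = 0.
Proof. by rewrite -(scale0r (0 : E)) bop_scale scale0r. Qed.

Lemma bop_add (f : bop E F) x y : f (x + y) = f x + f y.
Proof. by have [lf _] := bopP f; rewrite -[x]scale1r lf !scale1r. Qed.

Lemma opnormP (f : bop E F) x : `|f x| <= opnorm f * `|x|.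
Proof.
have [->|x0] := eqVneq x 0; first by rewrite bop_zero !normr0 mulr0.
have nx : 0 < `|x| by rewrite normr_gt0.
rewrite -ler_pdivrMr//.
have := @opnorm_ub f (`|x|^-1 *: x); rewrite bop_scale !normrZ normfV normr_id.
by rewrite mulVf ?gt_eqF// mulrC; apply.
Qed.

Lemma opnorm_ge0 (f : bop E F) : 0 <= opnorm f.
Proof. by rewrite (le_trans _ (@opnorm_ub f 0 _))// normr0. Qed.

Lemma opnormD (f g : bop E F) : opnorm (f + g) <= opnorm f + opnorm g.
Proof.
apply: opnorm_le => x x1; rewrite (le_trans (ler_normD _ _))//.
by rewrite lerD// opnorm_ub.
Qed.

Lemma opnormZ a (f : bop E F) : opnorm (a *: f) = `|a| * opnorm f.
Proof.
have le b (g : bop E F) : opnorm (b *: g) <= `|b| * opnorm g.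
  by apply: opnorm_le => x x1; rewrite normrZ ler_wpM2l// opnorm_ub.
apply/eqP; rewrite eq_le le /=.
have [->|a0] := eqVneq a 0; first by rewrite normr0 mul0r opnorm_ge0.
rewrite -ler_pdivlMl ?normr_gt0// -normfV.
by have := le a^-1 (a *: f); rewrite scalerA mulVf// scale1r.
Qed.

Lemma opnorm0_eq0 (f : bop E F) : opnorm f = 0 -> f = 0.
Proof.
move=> f0; apply/val_inj/funext => x; apply/eqP; rewrite -normr_le0.
by have := opnormP f x; rewrite f0 mul0r.
Qed.

HB.instance Definition _ := Lmodule_isNormed.Build R (bop E F)
  opnormD opnormZ opnorm0_eq0.

Lemma bop_normE (f : bop E F) : `|f| = opnorm f.
Proof. by []. Qed.

End bop_normed.

Section bop_complete.
Context (R : realType) (E : normedModType R) (F : completeNormedModType R).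

Lemma bop_cauchy_cvg (G : set_system (bop E F)) :
  ProperFilter G -> cauchy G -> cvg G.
Proof.
move=> GF /cauchy_ballP Gc.
have Gd e : 0 < e -> exists f0 : bop E F, G [set f : bop E F | `|f0 - f| < e].
  move=> e0; have [[A B] /= [GA GB] AB] := Gc e e0.
  have [f0 Af0] := filter_ex GA; exists f0.
  apply: filterS GB => f Bf /=.
  by have := AB (f0, f) (conj Af0 Bf); rewrite /= -ball_normE.
have ptw (f0 f : bop E F) x : `|f0 x - f x| <= `|f0 - f| * `|x|.
  exact: (opnormP (f0 - f) x).
have ev x : cvg ((fun f : bop E F => f x) @ G).
  apply: cauchy_cvg; apply/cauchy_ballP => e e0.
  have k0 : 0 < `|x| + 1 by rewrite ltr_wpDl.
  have [f0 Gf0] := Gd (e / 2 / (`|x| + 1)) (divr_gt0 (divr_gt0 e0 (ltr0n _ 2)) k0).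
  have Gb : G [set f : bop E F | ball (f0 x) (e / 2) (f x)].
    apply: filterS Gf0 => f /= ff0; rewrite -ball_normE /=.
    rewrite (le_lt_trans (ptw _ _ _))//.
    rewrite (le_lt_trans (y := `|f0 - f| * (`|x| + 1)))//.
      by rewrite ler_wpM2l// lerDl.
    by rewrite -ltr_pdivlMr.
  exists (ball (f0 x) (e / 2), ball (f0 x) (e / 2)) => //=.
  move=> [u v] /= [] /ball_sym fu fv.
  by rewrite /= [e]splitr; exact: ball_triangle fu fv.
pose g x := lim ((fun f : bop E F => f x) @ G).
have gE x : (fun f : bop E F => f x) @ G --> g x by exact: ev.
have glin : linear g.
  move=> a x y.
  have h1 := @cvgZl_tmp _ _ _ G _ a _ _ (gE x).
  have h2 := @cvgD _ _ _ G _ _ _ _ _ (h1 _) (gE y).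
  apply: (cvg_unique (@norm_hausdorff R F) (gE (a *: x + y))).
  have -> : (fun f : bop E F => f (a *: x + y)) =
      (fun f : bop E F => a *: f x + f y).
    by apply/funext => f; rewrite bop_add bop_scale.
  exact: h2.
have gb e (f0 : bop E F) : G [set f : bop E F | `|f0 - f| < e] ->
    forall x, `|f0 x - g x| <= e * `|x|.
  move=> Gf0 x.
  have c : (fun f : bop E F => `|f0 x - f x|) @ G --> `|f0 x - g x|.
    by apply: cvg_norm; apply: cvgB => //; exact: cvg_cst.
  apply: (cvgr_to_le c); apply: filterS Gf0 => f /= ff0.
  by rewrite (le_trans (ptw _ _ _))// ler_wpM2r// ltW.
have gB : bounded_linear g.
  split=> //; have [f0 Gf0] := Gd 1 ltr01.
  exists (`|f0| + 1) => x; rewrite -(subrK (f0 x) (g x)) addrC mulrDl.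
  by rewrite (le_trans (ler_normD _ _))// lerD ?opnormP// distrC gb.
pose gg : bop E F := Bop g (asboolT gB).
apply/cvg_ex; exists gg; apply/cvgrPdist_lt => e e0 /=.
have [f0 Gf0] := Gd (e / 2 / 2) (divr_gt0 (divr_gt0 e0 (ltr0n _ 2)) (ltr0n _ 2)).
have le0 : `|gg - f0| <= e / 2 / 2.
  apply: opnorm_le => x x1; rewrite bopD bopN distrC.
  rewrite (le_trans (gb _ _ Gf0 x))// -[leRHS]mulr1 ler_wpM2l//.
  by rewrite !divr_ge0// ltW.
apply: filterS Gf0 => f /= ff0.
rewrite -(subrK f0 gg) -addrA (le_lt_trans (ler_normD _ _))//.
rewrite (le_lt_trans (lerD le0 (ltW ff0)))// -splitr.
by rewrite ltr_pdivrMr// ltr_pMr// ltr1n.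
Qed.

HB.instance Definition _ := Uniform_isComplete.Build (bop E F) bop_cauchy_cvg.

End bop_complete.

Section bop_ring.
Context (R : realType) (V : normedModType R).

Lemma bop_one_subproof : `[< bounded_linear (@id V) >].
Proof. by apply/asboolP; split=> //; exists 1 => x; rewrite mul1r. Qed.

Lemma bop_mul_subproof (f g : bop V V) : `[< bounded_linear (f \o g) >].
Proof.
apply/asboolP; split; first by move=> a x y /=; rewrite !bop_add !bop_scale.
exists (opnorm f * opnorm g) => x /=; rewrite (le_trans (opnormP _ _))//.
by rewrite -mulrA ler_wpM2l ?opnorm_ge0 ?opnormP.
Qed.

Definition bop_one : bop V V := Bop id bop_one_subproof.
Definition bop_mul (f g : bop V V) : bop V V :=
  Bop (f \o g) (bop_mul_subproof f g).

Lemma bop_mulA : associative bop_mul.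
Proof. by move=> f g h; exact/val_inj. Qed.
Lemma bop_mul1 : left_id bop_one bop_mul.
Proof. by move=> f; exact/val_inj. Qed.
Lemma bop_1mul : right_id bop_one bop_mul.
Proof. by move=> f; exact/val_inj. Qed.
Lemma bop_mulDl : left_distributive bop_mul +%R.
Proof. by move=> f g h; exact/val_inj. Qed.
Lemma bop_mulDr : right_distributive bop_mul +%R.
Proof. by move=> f g h; apply/val_inj/funext => x /=; exact: bop_add. Qed.

HB.instance Definition _ := GRing.Zmodule_isPzRing.Build (bop V V)
  bop_mulA bop_mul1 bop_1mul bop_mulDl bop_mulDr.

Definition op_exp (H : bop V V) : bop V V :=
  lim (series (fun n => (n`!%:R^-1 : R) *: H ^+ n) @ \oo).

End bop_ring.


(* The differential is recorded as a map [df] into the normed space of bounded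
   operators, so that the recursion on [n] is the usual definition of C^n in
   the Fréchet sense. *)
Fixpoint Cn (R : realType) (E : normedModType R) (n : nat) :
    forall F : normedModType R, set E -> (E -> F) -> Prop :=
  match n with
  | 0 => fun F U f => forall x, U x -> {for x, continuous f}
  | n'.+1 => fun F U f => exists df : E -> bop E F,
      (forall x, U x -> is_diff x f (df x)) /\ Cn n' U df
  end.

Definition smooth_on (R : realType) (E F : normedModType R) (U : set E)
    (f : E -> F) : Prop :=
  open U /\ forall n, Cn n U f.

(* A chart of X that flattens M onto a closed subspace of X.  The closed
   subspace is presented as the range of a linear isometry from a Banach space;
   it is not required to be complemented in X. *)
Record submanifold_chart (R : realType) (X : normedModType R) (M : set X) :=
  SubmanifoldChart {
    model : completeNormedModType R ;
    incl : bop model X ;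
    dom : set X ;
    cod : set X ;
    fwd : X -> X ;
    bwd : X -> X ;
    incl_isometry : forall v, `|incl v| = `|v| ;
    fwd_smooth : smooth_on dom fwd ;
    bwd_smooth : smooth_on cod bwd ;
    fwd_cod : forall x, dom x -> cod (fwd x) ;
    bwd_dom : forall y, cod y -> dom (bwd y) ;
    fwdK : forall x, dom x -> bwd (fwd x) = x ;
    bwdK : forall y, cod y -> fwd (bwd y) = y ;
    fwd_flat : forall x, dom x -> (M x <-> range incl (fwd x)) }.

Definition embedded_submanifold (R : realType) (X : normedModType R)
    (M : set X) : Prop :=
  forall x, M x -> exists c : submanifold_chart M, dom c x.

(* The parametrization of [M `&` dom c] by the open subset [param_dom c] of the
   model space, i.e. the inverse of the induced chart of M. *)
Definition param_dom (R : realType) (X : normedModType R) (M : set X)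
    (c : submanifold_chart M) : set (model c) := [set v | cod c (incl c v)].

Definition param (R : realType) (X : normedModType R) (M : set X)
    (c : submanifold_chart M) (v : model c) : X := bwd c (incl c v).

(* Smoothness of f : U -> M for the manifold structure of M: in every induced
   chart of M the map is smooth; openness of the set on which the chart is
   defined (part of [smooth_on]) is the continuity of f. *)
Definition smooth_into (R : realType) (E X : normedModType R) (M : set X)
    (U : set E) (f : E -> X) : Prop :=
  (forall u, U u -> M (f u)) /\
  forall c : submanifold_chart M, exists m : E -> model c,
    smooth_on [set u | U u /\ dom c (f u)] m /\
    forall u, U u -> dom c (f u) -> fwd c (f u) = incl c (m u).

(* Velocities at x of the smooth curves of X that stay in M. *)
Definition tangent_space (R : realType) (X : normedModType R) (M : set X)
    (x : X) : set X :=
  [set v | exists (U : set R^o) (gamma : R^o -> X),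
    [/\ U 0, smooth_on U gamma, forall t, U t -> M (gamma t),
        gamma 0 = x & is_derive (0 : R^o) 1 gamma v]].


Definition bounded_multilinear (R : realType) (E F : normedModType R) (k : nat)
    (m : ('I_k -> E) -> F) : Prop :=
  (forall (i : 'I_k) (v : 'I_k -> E),
     linear (fun x : E => m (fun j => if j == i then x else v j))) /\
  exists C : R, forall v, `|m v| <= C * \prod_(i < k) `|v i|.

Definition homogeneous_polynomial (R : realType) (E F : normedModType R)
    (k : nat) (p : E -> F) : Prop :=
  exists m : ('I_k -> E) -> F,
    bounded_multilinear m /\ forall x, p x = m (fun=> x).

Definition polynomial_map (R : realType) (E F : normedModType R)
    (P : E -> F) : Prop :=
  exists (n : nat) (p : 'I_n -> E -> F),
    (forall k : 'I_n, homogeneous_polynomial k (p k)) /\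
    forall x, P x = \sum_(k < n) p k x.


Section linear_groups.
Context (R : realType) (V : completeNormedModType R).
Implicit Types (G : set (bop V V)) (g h : bop V V).

Definition op_inverse g h : Prop := g * h = 1 /\ h * g = 1.

Definition GL : set (bop V V) := [set g | exists h, op_inverse g h].

Definition GL_subgroup G : Prop :=
  [/\ G `<=` GL, G 1, forall g h, G g -> G h -> G (g * h) &
      forall g h, G g -> op_inverse g h -> G h].

Definition algebraic_subgroup G : Prop :=
  GL_subgroup G /\
  exists (I : Type) (P : I -> bop V V * bop V V -> bop V V),
    (forall i, polynomial_map (P i)) /\
    G = [set g | exists h, op_inverse g h /\ forall i, P i (g, h) = 0].

Definition Lie G : set (bop V V) := [set H | forall t : R, G (op_exp (t *: H))].

(* The unique inverse on GL(V), and 0 elsewhere *)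
Definition op_inv g : bop V V := xget 0 (op_inverse g).

Definition smooth_group_operations G : Prop :=
  (forall c1 c2 : submanifold_chart G,
     smooth_into G [set u : model c1 * model c2 |
                      param_dom u.1 /\ param_dom u.2]
       (fun u => param u.1 * param u.2)) /\
  (forall c : submanifold_chart G,
     smooth_into G (@param_dom _ _ _ c) (fun u => op_inv (param u))).

(* The topology of the submanifold structure is the induced one, as its charts
   are restrictions of charts of the ambient space. *)
Definition embedded_Banach_Lie_subgroup G : Prop :=
  [/\ GL_subgroup G,
      closure G `&` GL `<=` G,
      embedded_submanifold G,
      smooth_group_operations G &
      tangent_space G 1 = Lie G].

End linear_groups.
Arguments GL {R} V.


Record is_JB_algebra (R : realType) (V : completeNormedModType R)
    (jmul : V -> V -> V) (e : V) : Prop := IsJBAlgebra {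
  jb_linear : forall x, linear (jmul x) ;
  jb_comm : commutative jmul ;
  jb_unit : left_id e jmul ;
  jb_jordan : forall x y,
    jmul (jmul x x) (jmul x y) = jmul x (jmul (jmul x x) y) ;
  jb_norm_mul : forall x y, `|jmul x y| <= `|x| * `|y| ;
  jb_norm_sqr : forall x, `|jmul x x| = `|x| ^+ 2 ;
  jb_norm_sqrD : forall x y, `|jmul x x| <= `|jmul x x + jmul y y| }.

Section structure_group.
Context (R : realType) (V : completeNormedModType R) (jmul : V -> V -> V).

Definition Lop (x : V) : V -> V := jmul x.

Definition Uop (x : V) : V -> V :=
  (2 : R) *: (Lop x \o Lop x) - Lop (jmul x x).

Definition Uop2 (x y : V) : V -> V :=
  (2^-1 : R) *: (Uop (x + y) - Uop x - Uop y).

Definition Str : set (bop V V) :=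
  [set g | GL V g /\ exists gs : bop V V,
     GL V gs /\ forall x, Uop (g x) = g \o Uop x \o gs].

Definition str : set (bop V V) :=
  [set H | exists Hbar : bop V V,
     forall x, (2 : R) *: Uop2 x (H x) = (H \o Uop x) - (Uop x \o Hbar)].

End structure_group.

(* Main.v *)
Require Import Defs.
From HB Require Import structures.
From mathcomp Require Import all_boot all_order all_algebra.
From mathcomp Require Import all_classical all_reals all_analysis.
From mathcomp Require Import ring lra.

(* Since U_e = Id, taking x = e in U_{gx} = g U_x g^* gives
   g^* = g^{-1} U_{ge}, so, with h = g^{-1}, the group Str(V) is cut out by the cubic equations
   h U_{gx} = U_x h U_{ge} and g U_{hx} = U_x g U_{he}; conversely these two
   families force U_{ge} to be invertible.

   On bounded bilinear maps b : V x V -> B(V) put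
   (D b)(x, y) = b(Hx, y) + b(x, Hy) - H b(x, y), so that ||D|| <= 3 ||H|| and
   (exp D) b (x, y) = e^{-H} b(e^H x, e^H y).  If e^H is in Str(V), then exp D
   preserves the closed subspace N of those b with b(x, y) = U_{x,y} b(e, e).
   When ||D|| < pi, D lies in the closed algebra generated by exp D, hence D
   preserves N, and D U in N says that H is in str(V).  Conversely
   (D + right multiplication by Hbar) U = 0 exponentiates to e^H in Str(V).

   That D is in the closed algebra generated by w = exp D is proved with
   t = tanh(D/4): the doubling formulas of tanh and tan give
   ||t|| <= tan(||D||/4) < 1.  The inverses of 1 + s (w - 1), 0 <= s <= 1, are
   Poisson kernels 1 + 2 sum cos(n a) t^n times exp(-D/2), so they are bounded
   uniformly and belong to the algebra; averaging the angle a over the N-th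
   roots of unity and letting N tend to infinity gives exp(-D/2).  Iterating,
   the algebra contains exp((-1/2)^n D) for all n, and therefore D.

   Since str(V) is the kernel of a bounded operator and exp is a local
   diffeomorphism at 0, translates of log are submanifold charts of Str(V). *)

Set Implicit Arguments.
Unset Strict Implicit.
Unset Printing Implicit Defensive.

Import Order.TTheory GRing.Theory Num.Theory.
Import numFieldNormedType.Exports.

Local Open Scope classical_set_scope.
Local Open Scope ring_scope.

(** * Bounded operators *)

(** The logarithm step would classically use a holomorphic logarithm on the plane slit along the
    negative half-line. Over the reals, the condition that the spectrum of [w] avoids that half-line
    becomes invertibility of [1 + s (w - 1)] for all [s] in [0, 1], and a norm estimate provides it.
    The bound [pi] appears because [tan (pi / 4) = 1]; dividing by 3 accounts for the two arguments
    and the value of a bilinear map, each contributing [||H||] to [||D||].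

    Passing from the quadratic [U_x] to the bilinear [U_{x,y}] makes the condition defining [N]
    linear in [b]: [N] is the kernel of a bounded operator, and the operators preserving [N] form a
    closed algebra.

    A second obstacle is that str(V) may have no bounded projection from B(V) onto it. Chart
    coordinates therefore cannot be obtained by projecting; every derivative is factored through the
    isometric inclusion of the kernel. Each derivative also has a new target space, so the
    inductions on the order of smoothness quantify over all target spaces. *)

Section bounded_operators.
Context (R : realType).
Implicit Types E F G : normedModType R.

Lemma bop_ext E F (f g : bop E F) : (forall x, f x = g x) -> f = g.
Proof. by move=> fg; apply/val_inj/funext. Qed.

Lemma bop_sub E F (f : bop E F) x y : f (x - y) = f x - f y.
Proof. by rewrite bop_add -[- y]scaleN1r bop_scale scaleN1r. Qed.

Lemma bop_opp E F (f : bop E F) x : f (- x) = - f x.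
Proof. by rewrite -[- x]scaleN1r bop_scale scaleN1r. Qed.

Lemma bop_lin E F (f : bop E F) : linear f.
Proof. by case: (bopP f). Qed.

Lemma le_bop_norm E F (f : bop E F) x : `|f x| <= `|f| * `|x|.
Proof. exact: opnormP. Qed.

Lemma bop_norm_le E F (f : bop E F) (C : R) :
  0 <= C -> (forall x, `|f x| <= C * `|x|) -> `|f| <= C.
Proof.
move=> C0 hC; apply: opnorm_le => x x1; rewrite (le_trans (hC x))//.
by rewrite -[leRHS]mulr1 ler_wpM2l.
Qed.

Definition mkbop E F (f : E -> F) (lf : linear f) (C : R)
    (hC : forall x, `|f x| <= C * `|x|) : bop E F :=
  Bop f (asboolT (conj lf (ex_intro _ C hC))).

Lemma bop_comp_linear E F G (g : bop F G) (f : bop E F) : linear (g \o f).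
Proof. by move=> a x y /=; rewrite !bop_add !bop_scale. Qed.

Lemma bop_comp_bound E F G (g : bop F G) (f : bop E F) x :
  `|(g \o f) x| <= (`|g| * `|f|) * `|x|.
Proof.
by rewrite (le_trans (le_bop_norm _ _))// -mulrA ler_wpM2l// le_bop_norm.
Qed.

Definition bcomp E F G (g : bop F G) (f : bop E F) : bop E G :=
  mkbop (bop_comp_linear g f) (bop_comp_bound g f).

Lemma bcompE E F G (g : bop F G) (f : bop E F) x : bcomp g f x = g (f x).
Proof. by []. Qed.

Lemma bcomp_norm E F G (g : bop F G) (f : bop E F) :
  `|bcomp g f| <= `|g| * `|f|.
Proof. by apply: bop_norm_le => [|x]; [rewrite mulr_ge0|exact: bop_comp_bound]. Qed.

Section bilinear.
Context E F G (b : E -> F -> G) (C : R).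
Hypothesis lin1 : forall y, linear (b^~ y).
Hypothesis lin2 : forall x, linear (b x).
Hypothesis hC : forall x y, `|b x y| <= C * `|x| * `|y|.

Definition mkbil_at (x : E) : bop F G := mkbop (lin2 x) (hC x).

Lemma mkbil_linear : linear mkbil_at.
Proof. by move=> a x y; apply: bop_ext => z; exact: lin1. Qed.

Lemma mkbil_bound x : `|mkbil_at x| <= `|C| * `|x|.
Proof.
apply: bop_norm_le => [|y]; first by rewrite mulr_ge0.
by rewrite (le_trans (hC _ _))// -!mulrA ler_wpM2r ?mulr_ge0// ler_norm.
Qed.

Definition mkbil : bop E (bop F G) := mkbop mkbil_linear mkbil_bound.

End bilinear.

Lemma bcomp_linl E F G (f : bop E F) : linear (fun g : bop F G => bcomp g f).
Proof. by move=> a g g'; apply: bop_ext. Qed.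

Lemma bcomp_linr E F G (g : bop F G) : linear (fun f : bop E F => bcomp g f).
Proof. by move=> a f f'; apply: bop_ext => x /=; rewrite bop_add bop_scale. Qed.

Lemma bcomp_bound E F G (g : bop F G) (f : bop E F) :
  `|bcomp g f| <= 1 * `|g| * `|f|.
Proof. by rewrite mul1r bcomp_norm. Qed.

Lemma bcomp_bound' E F G (f : bop E F) (g : bop F G) :
  `|bcomp g f| <= 1 * `|f| * `|g|.
Proof. by rewrite mul1r mulrC bcomp_norm. Qed.

(** Composition is curried in both orders. Most multiplications, derivatives and actions below are
    composites of [postB], [preB] and [evB], so that their linearity and boundedness need no new
    estimate. *)
Definition postB E F G : bop (bop F G) (bop (bop E F) (bop E G)) :=
  mkbil (@bcomp_linl E F G) (@bcomp_linr E F G) (@bcomp_bound E F G).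

Definition preB E F G : bop (bop E F) (bop (bop F G) (bop E G)) :=
  mkbil (@bcomp_linr E F G) (@bcomp_linl E F G) (@bcomp_bound' E F G).

Lemma postBE E F G (g : bop F G) (f : bop E F) : @postB E F G g f = bcomp g f.
Proof. by []. Qed.

Lemma preBE E F G (f : bop E F) (g : bop F G) : @preB E F G f g = bcomp g f.
Proof. by []. Qed.

Lemma postB_norm E F G (g : bop F G) : `|@postB E F G g| <= `|g|.
Proof. by apply: bop_norm_le => // f; exact: bcomp_norm. Qed.

Lemma preB_norm E F G (f : bop E F) : `|@preB E F G f| <= `|f|.
Proof. by apply: bop_norm_le => // g; rewrite mulrC; exact: bcomp_norm. Qed.

Lemma evB_bound E F (x : E) (f : bop E F) : `|f x| <= 1 * `|x| * `|f|.
Proof. by rewrite mul1r mulrC le_bop_norm. Qed.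

Definition evB E F : bop E (bop (bop E F) F) :=
  mkbil (fun f => bop_lin f) (fun x a (f g : bop E F) => erefl) (@evB_bound E F).

Lemma evBE E F (x : E) (f : bop E F) : evB E F x f = f x.
Proof. by []. Qed.

Lemma scaleB_bound E (x : E) (t : R^o) : `|t *: x| <= `|x| * `|t|.
Proof. by rewrite normrZ mulrC. Qed.

Lemma scaleB_lin E (x : E) : linear (fun t : R^o => t *: x).
Proof. by move=> a s t; rewrite scalerDl scalerA. Qed.

Definition lineB E (x : E) : bop R^o E :=
  @mkbop R^o E _ (scaleB_lin x) `|x| (scaleB_bound x).

Lemma near_dist E (x : E) (e : R) : 0 < e -> \forall y \near x, `|x - y| < e.
Proof. by move=> e0; apply/nbhs_ballP; exists e => //= y; rewrite -ball_normE. Qed.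

Lemma cvg_bop E F (L : bop E F) (T : Type) (G : set_system T)
    {FG : Filter G} (u : T -> E) l :
  u @ G --> l -> (L \o u) @ G --> L l.
Proof.
move=> ul; apply/cvgrPdist_lt => e e0.
have k0 : 0 < `|L| + 1 by rewrite ltr_wpDl.
move/cvgrPdist_lt : ul => /(_ (e / (`|L| + 1)) (divr_gt0 e0 k0)).
apply: filterS => t ht /=; rewrite -bop_sub (le_lt_trans (le_bop_norm _ _))//.
rewrite (@le_lt_trans _ _ ((`|L| + 1) * `|l - u t|))//.
  by rewrite ler_wpM2r// lerDl.
by rewrite mulrC -ltr_pdivlMr.
Qed.

Section ring.
Context (V : normedModType R).
Implicit Types f g h : bop V V.

Lemma bopM f g x : (f * g) x = f (g x). Proof. by []. Qed.

Lemma bcompM f g : bcomp f g = f * g. Proof. exact: bop_ext. Qed.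

Lemma bop1 x : (1 : bop V V) x = x. Proof. by []. Qed.

Lemma bopMnorm f g : `|f * g| <= `|f| * `|g|.
Proof. exact: bcomp_norm. Qed.

Lemma bop1norm : `|1 : bop V V| <= 1.
Proof. by apply: bop_norm_le => // x; rewrite mul1r. Qed.

Lemma bopXnorm f n : `|f ^+ n| <= `|f| ^+ n.
Proof.
elim: n => [|n IH]; first by rewrite !expr0 bop1norm.
by rewrite !exprS (le_trans (bopMnorm _ _))// ler_wpM2l.
Qed.

Lemma bopAl a f g : a *: (f * g) = (a *: f) * g.
Proof. exact: bop_ext. Qed.

Lemma bopAr a f g : a *: (f * g) = f * (a *: g).
Proof. by apply: bop_ext => x; rewrite !bopM bopZ bop_scale. Qed.

Lemma bop_commZ a f g : GRing.comm f g -> GRing.comm f (a *: g).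
Proof. by rewrite /GRing.comm => fg; rewrite -bopAr -bopAl fg. Qed.

Lemma cvg_bopM (T : Type) (G : set_system T) {FG : Filter G}
    (u v : T -> bop V V) (l m : bop V V) :
  u @ G --> l -> v @ G --> m -> (fun t => u t * v t) @ G --> l * m.
Proof.
move=> ul vm.
have h1 : (fun t => u t * m) @ G --> l * m.
  have -> : (fun t => u t * m) = @preB V V V m \o u.
    by apply/funext => t; exact: bop_ext.
  have -> : l * m = @preB V V V m l by exact: bop_ext.
  exact: cvg_bop.
have h2 : (fun t => u t * v t - u t * m) @ G --> (0 : bop V V).
  apply/cvgrPdist_lt => e e0.
  have k0 : 0 < `|l| + 1 by rewrite ltr_wpDl.
  have c1 : \forall t \near G, `|u t| <= `|l| + 1.
    move/cvgrPdist_lt : ul => /(_ 1 ltr01); apply: filterS => t ht.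
    rewrite -lerBlDl (le_trans (lerB_dist _ _))// distrC; exact: ltW.
  move/cvgrPdist_lt : vm => /(_ (e / (`|l| + 1)) (divr_gt0 e0 k0)).
  apply: filterS2 c1 => t ht1 ht2.
  rewrite sub0r normrN -mulrBr (le_lt_trans (bopMnorm _ _))//.
  rewrite (@le_lt_trans _ _ ((`|l| + 1) * `|v t - m|))//.
    by rewrite ler_wpM2r.
  by rewrite mulrC -ltr_pdivlMr// distrC.
have -> : (fun t => u t * v t) = (fun t => (u t * v t - u t * m) + u t * m).
  by apply/funext => t; rewrite subrK.
by rewrite -[X in _ --> X]add0r; exact: cvgD.
Qed.

End ring.
End bounded_operators.

(** * The exponential of a bounded operator *)

Section series.
Context (R : realType).

Lemma normed_series_cvg (E : completeNormedModType R) (u : nat -> E)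
    (v : nat -> R) (M : R) :
  (forall n, `|u n| <= v n) -> (forall n, \sum_(0 <= k < n) v k <= M) ->
  cvgn (series u).
Proof.
move=> uv vM; apply: normed_cvg.
apply: (series_le_cvg (v_ := v)) => //= n; first exact: le_trans (uv n).
apply: nondecreasing_is_cvgn.
  apply: nondecreasing_series => k _ _; exact: le_trans (uv k).
by exists M => _ [k _ <-]; exact: vM.
Qed.

Lemma cvg_norm_le (E : normedModType R) (u : nat -> E) (l : E) (M : R) :
  u @ \oo --> l -> (forall n, `|u n| <= M) -> `|l| <= M.
Proof.
move=> ul uM; have h : (fun n => `|u n|) @ \oo --> `|l| by exact: cvg_norm.
by apply: (cvgr_to_le h); near=> n.
Unshelve. all: by end_near. Qed.

Lemma sub_cvg0 (E : normedModType R) (u : nat -> E) (l : E) (v : nat -> R) :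
  (forall n, `|u n - l| <= v n) -> v @ \oo --> (0 : R) -> u @ \oo --> l.
Proof.
move=> uv v0; apply/cvgrPdist_lt => e e0.
move/cvgrPdist_lt : v0 => /(_ e e0); apply: filterS => n /=.
rewrite sub0r normrN => vn; rewrite distrC (le_lt_trans (uv n))//.
exact: le_lt_trans (ler_norm _) vn.
Qed.

Lemma exp_partial_le (x : R) n : 0 <= x ->
  \sum_(0 <= k < n) exp_coeff x k <= expR x.
Proof.
move=> x0.
have h : nondecreasing_seq (series (exp_coeff x)).
  by apply: nondecreasing_series => k _ _; rewrite exp_coeff_ge0.
exact: (nondecreasing_cvgn_le h (is_cvg_series_exp_coeff x) n).
Qed.

End series.

Section banach_algebra.
Context (R : realType) (V : completeNormedModType R).
Implicit Types A B X Y : bop V V.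

Lemma geom_sum_le (x : R) n : 0 <= x -> x < 1 ->
  \sum_(0 <= k < n) x ^+ k <= (1 - x)^-1.
Proof.
move=> x0 x1; have x1' : 0 < 1 - x by rewrite subr_gt0.
rewrite -[leRHS]mul1r ler_pdivlMr// big_mkord mulrC -opprB mulNr -subrX1 opprB.
by rewrite gerBl exprn_ge0.
Qed.

Definition geom X : bop V V := limn (series (fun n => X ^+ n)).

Lemma cvg_geom X : `|X| < 1 -> series (fun n => X ^+ n) @ \oo --> geom X.
Proof.
move=> X1; apply: (normed_series_cvg (fun n => bopXnorm X n)) => n.
exact: geom_sum_le.
Qed.

Lemma cvg_expr0 X : `|X| < 1 -> (fun n => X ^+ n) @ \oo --> (0 : bop V V).
Proof.
move=> X1; apply: (@sub_cvg0 _ _ _ _ (fun n => `|X| ^+ n)) => [n|].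
  by rewrite subr0 bopXnorm.
by apply: cvg_expr; rewrite normr_id.
Qed.

Lemma geom_inv X : `|X| < 1 -> op_inverse (1 - X) (geom X).
Proof.
move=> X1; have g := cvg_geom X1.
have c1 : (1 : bop V V) - X ^+ n @[n --> \oo] --> (1 : bop V V).
  rewrite -[X in _ --> X]subr0; apply: cvgB; first exact: cvg_cst.
  exact: cvg_expr0.
have H n : (1 - X) * series (fun n => X ^+ n) n = 1 - X ^+ n.
  by rewrite /series /= big_mkord -opprB mulNr -subrX1 opprB.
have H' n : series (fun n => X ^+ n) n * (1 - X) = 1 - X ^+ n.
  rewrite -H; apply: commrB; first exact: commr1.
  rewrite /series /=; apply/commr_sym/commr_sum => i _.
  exact: commrX.
have h1 : (1 - X) * series (fun n => X ^+ n) n @[n --> \oo] --> (1 - X) * geom X.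
  by apply: cvg_bopM => //; exact: cvg_cst.
have h2 : series (fun n => X ^+ n) n * (1 - X) @[n --> \oo] --> geom X * (1 - X).
  by apply: cvg_bopM => //; exact: cvg_cst.
rewrite (funext H) in h1; rewrite (funext H') in h2.
by split; [exact: (cvg_unique _ h1 c1)|exact: (cvg_unique _ h2 c1)].
Qed.

Lemma geom_norm X : `|X| < 1 -> `|geom X| <= (1 - `|X|)^-1.
Proof.
move=> X1; apply: cvg_norm_le (cvg_geom X1) _ => n.
rewrite /series /= (le_trans (ler_norm_sum _ _ _))//.
by rewrite (le_trans _ (geom_sum_le n (normr_ge0 X) X1))// ler_sum// => i _; exact: bopXnorm.
Qed.

Lemma comm_lim A (u : nat -> bop V V) l :
  u @ \oo --> l -> (forall n, GRing.comm A (u n)) -> GRing.comm A l.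
Proof.
move=> ul Au; have h1 : A * u n @[n --> \oo] --> A * l.
  by apply: cvg_bopM => //; exact: cvg_cst.
rewrite (funext Au) in h1; apply: (cvg_unique _ h1) => //.
by apply: cvg_bopM => //; exact: cvg_cst.
Qed.

Lemma comm_geom A X : `|X| < 1 -> GRing.comm A X -> GRing.comm A (geom X).
Proof.
move=> X1 AX; apply: (comm_lim (cvg_geom X1)) => n.
by apply: commr_sum => i _; exact: commrX.
Qed.

Definition eterm A (n : nat) : bop V V := (n`!%:R^-1 : R) *: A ^+ n.

Lemma eterm_norm A n : `|eterm A n| <= exp_coeff `|A| n.
Proof.
rewrite normrZ ger0_norm ?invr_ge0// /exp_coeff mulrC.
by rewrite ler_wpM2r ?invr_ge0// bopXnorm.
Qed.

Lemma eterm0 A : eterm A 0 = 1.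
Proof. by rewrite /eterm -[0`!%N]/1%N invr1 scale1r expr0. Qed.

Lemma eterm1 A : eterm A 1 = A.
Proof. by rewrite /eterm -[1`!%N]/1%N invr1 scale1r expr1. Qed.

Lemma cvg_exp A : series (eterm A) @ \oo --> op_exp A.
Proof.
apply: (normed_series_cvg (eterm_norm A) (M := expR `|A|)) => n.
exact: exp_partial_le.
Qed.

Arguments cvg_exp : clear implicits.

Lemma sum_antidiag (M : nmodType) (F : nat -> nat -> M) n :
  \sum_(0 <= k < n) \sum_(0 <= i < k.+1) F i (k - i)%N =
  \sum_(0 <= i < n) \sum_(0 <= j < n - i) F i j.
Proof.
elim: n => [|n IH]; first by rewrite !big_nil.
rewrite big_nat_recr//= IH big_nat_recr//= [RHS]big_nat_recr//=.
rewrite subSnn big_nat1 subnn addrA -big_split/=; congr (_ + _).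
by apply: eq_big_nat => i /andP[_ ni]; rewrite subSn ?(ltnW ni)// big_nat_recr.
Qed.

(** The product of two partial sums exceeds the partial sum of the Cauchy product by the pairs
    [i, j < n] with [i + j >= n]. Keeping this remainder as an explicit double sum allows a termwise
    bound. *)
Lemma sum_square (M : zmodType) (F : nat -> nat -> M) n :
  \sum_(0 <= i < n) \sum_(0 <= j < n) F i j -
  \sum_(0 <= k < n) \sum_(0 <= i < k.+1) F i (k - i)%N =
  \sum_(0 <= i < n) \sum_(n - i <= j < n) F i j.
Proof.
rewrite sum_antidiag -sumrB; apply: eq_bigr => i _.
by rewrite (big_cat_nat (n := n - i)%N)//= ?leq_subr// addrAC subrr add0r.
Qed.

Lemma eterm_addE A B k : GRing.comm A B ->
  eterm (A + B) k = \sum_(0 <= i < k.+1) eterm A i * eterm B (k - i).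
Proof.
move=> AB; rewrite /eterm addrC exprDn_comm; last exact: commr_sym.
rewrite scaler_sumr big_mkord; apply: eq_bigr => i _.
have ik : (i <= k)%N by rewrite -ltnS.
rewrite -bopAl -bopAr scalerA -[_ *+ 'C(_, _)](@scaler_nat R) scalerA.
rewrite -(commrX i (commr_sym (commrX (k - i) AB))).
congr (_ *: _); rewrite -(bin_fact ik) !natrM !invfM.
by rewrite mulrAC mulVf ?mul1r// pnatr_eq0 -lt0n bin_gt0 ik.
Qed.

Lemma exp_coeff_addE (x y : R) k :
  exp_coeff (x + y) k =
  \sum_(0 <= i < k.+1) exp_coeff x i * exp_coeff y (k - i)%N.
Proof.
rewrite /exp_coeff /= addrC exprDn mulr_suml big_mkord; apply: eq_bigr => i _.
have ik : (i <= k)%N by rewrite -ltnS.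
rewrite -(bin_fact ik) -mulr_natr !natrM !invfM.
have c0 : ('C(k, i)%:R : R) != 0 by rewrite pnatr_eq0 -lt0n bin_gt0 ik.
have i0 : (i`!%:R : R) != 0 by rewrite pnatr_eq0 -lt0n fact_gt0.
have k0 : ((k - i)`!%:R : R) != 0 by rewrite pnatr_eq0 -lt0n fact_gt0.
by field; rewrite c0 i0 k0.
Qed.

(** Termwise, the remainder of the Cauchy product is dominated in norm by the remainder of the
    scalar series at the norms of [A] and [B], which tends to 0 by the functional equation of
    [expR]. *)
Lemma expD A B : GRing.comm A B -> op_exp (A + B) = op_exp A * op_exp B.
Proof.
move=> AB.
apply: (cvg_unique (@norm_hausdorff _ _) (cvg_exp (A + B))).
have h2 : (fun n => series (eterm A) n * series (eterm B) n) @ \oo -->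
    op_exp A * op_exp B by apply: cvg_bopM; exact: cvg_exp.
pose x := `|A|; pose y := `|B|.
pose d n := series (exp_coeff x) n * series (exp_coeff y) n -
            series (exp_coeff (x + y)) n.
have d0 : d @ \oo --> (0 : R).
  rewrite -(subrr (expR (x + y))) {1}expRD; apply: cvgB.
    by apply: cvgM; exact: is_cvg_series_exp_coeff.
  exact: is_cvg_series_exp_coeff.
have dE n : series (eterm A) n * series (eterm B) n - series (eterm (A + B)) n =
    \sum_(0 <= i < n) \sum_(n - i <= j < n) eterm A i * eterm B j.
  rewrite -sum_square /series /= mulr_suml; congr (_ - _).
    by apply: eq_bigr => i _; rewrite mulr_sumr.
  by apply: eq_bigr => i _; exact: eterm_addE.
have dR n : d n = \sum_(0 <= i < n) \sum_(n - i <= j < n) exp_coeff x i * exp_coeff y j.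
  rewrite -sum_square /d /series /= mulr_suml; congr (_ - _).
    by apply: eq_bigr => i _; rewrite mulr_sumr.
  by apply: eq_bigr => i _; exact: exp_coeff_addE.
have hd : (fun n => series (eterm A) n * series (eterm B) n -
                    series (eterm (A + B)) n) @ \oo --> (0 : bop V V).
  apply: (@sub_cvg0 _ _ _ _ d) d0 => n; rewrite subr0 dE dR.
  rewrite (le_trans (ler_norm_sum _ _ _))// ler_sum// => i _.
  rewrite (le_trans (ler_norm_sum _ _ _))// ler_sum// => j _.
  by rewrite (le_trans (bopMnorm _ _))// ler_pM// eterm_norm.
have -> : op_exp A * op_exp B = op_exp A * op_exp B - 0 by rewrite subr0.
have -> : series (eterm (A + B)) = (fun n => series (eterm A) n * series (eterm B) n -
   (series (eterm A) n * series (eterm B) n - series (eterm (A + B)) n)).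
  by apply/funext => n; rewrite subKr.
by apply: cvgB.
Qed.

Lemma exp0 : op_exp (0 : bop V V) = 1.
Proof.
apply: (cvg_unique (@norm_hausdorff _ _) (cvg_exp 0)).
apply/cvg_ballP => e e0; exists 1%N => // n /= n0.
rewrite /series /= -(prednK n0) big_nat_recl//= big1 ?addr0.
  by rewrite eterm0; exact: ballxx.
by move=> i _; rewrite /eterm expr0n /= scaler0.
Qed.

Lemma expNl A : op_exp (- A) * op_exp A = 1.
Proof. by rewrite -expD ?addNr ?exp0//; apply/commr_sym/commrN. Qed.

Lemma expNr A : op_exp A * op_exp (- A) = 1.
Proof. by rewrite -expD ?addrN ?exp0//; exact: commrN. Qed.

Lemma exp_inverse A : op_inverse (op_exp A) (op_exp (- A)).
Proof. by split; [exact: expNr|exact: expNl]. Qed.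

Lemma powB_le A B (r : R) n : `|A| <= r -> `|B| <= r ->
  `|A ^+ n.+1 - B ^+ n.+1| <= n.+1%:R * r ^+ n * `|A - B|.
Proof.
move=> Ar Br; have r0 : 0 <= r by apply: le_trans Ar.
elim: n => [|n IH]; first by rewrite !expr1 expr0 mulr1 mul1r.
have -> : A ^+ n.+2 - B ^+ n.+2 = (A - B) * A ^+ n.+1 + B * (A ^+ n.+1 - B ^+ n.+1).
  by rewrite mulrBl mulrBr -!exprS addrA subrK.
have -> : n.+2%:R * r ^+ n.+1 * `|A - B| =
    `|A - B| * r ^+ n.+1 + r * (n.+1%:R * r ^+ n * `|A - B|).
  by rewrite -[n.+2]addn1 natrD exprS; ring.
rewrite (le_trans (ler_normD _ _))// lerD//.
  rewrite (le_trans (bopMnorm _ _))// ler_wpM2l//.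
  by rewrite (le_trans (bopXnorm _ _))// lerXn2r ?nnegrE.
by rewrite (le_trans (bopMnorm _ _))// ler_pM.
Qed.

Lemma etermB_le A B (r : R) n : `|A| <= r -> `|B| <= r ->
  `|eterm A n.+1 - eterm B n.+1| <= exp_coeff r n * `|A - B|.
Proof.
move=> Ar Br; rewrite /eterm -scalerBr normrZ ger0_norm ?invr_ge0//.
rewrite ler_pdivrMl ?ltr0n ?fact_gt0// (le_trans (powB_le n Ar Br))//.
rewrite mulrA ler_wpM2r// /exp_coeff /= factS natrM -mulrA ler_wpM2l//.
by rewrite mulrCA mulfV ?mulr1// pnatr_eq0 -lt0n fact_gt0.
Qed.

(** The terms of order 0 and 1 cancel against [A - B], and the terms of order [n + 1] differ by at
    most [r ^ n / n!] times the norm of [A - B]; summing over [n >= 1] leaves [expR r - 1].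
    Continuity of the exponential, its first-order expansion and its local invertibility at 0 all
    rest on this. *)
Lemma expB_le A B (r : R) : `|A| <= r -> `|B| <= r ->
  `|op_exp A - op_exp B - (A - B)| <= (expR r - 1) * `|A - B|.
Proof.
move=> Ar Br; have r0 : 0 <= r by apply: le_trans Ar.
have h : (fun n => series (eterm A) n - series (eterm B) n - (A - B)) @ \oo -->
   op_exp A - op_exp B - (A - B).
  by apply: cvgB; [apply: cvgB; exact: cvg_exp|exact: cvg_cst].
rewrite -(cvg_shiftn 2) in h; apply: cvg_norm_le h _ => n.
rewrite /= addn2 /series /= -sumrB big_nat_recl//= big_nat_recl//=.
rewrite !eterm0 !eterm1 subrr add0r addrAC subrr add0r.
rewrite (le_trans (ler_norm_sum _ _ _))//.
rewrite (@le_trans _ _ (\sum_(0 <= k < n) exp_coeff r k.+1 * `|A - B|))//.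
  by apply: ler_sum => k _; exact: etermB_le.
rewrite -mulr_suml ler_wpM2r// lerBrDl.
have := exp_partial_le n.+1 r0; rewrite big_nat_recl//= {1}/exp_coeff /=.
by rewrite expr0 fact0 invr1 mulr1.
Qed.

Lemma expR_sub1_le (r : R) : 0 <= r -> r <= 2^-1 -> expR r - 1 <= 2 * r.
Proof.
move=> r0 r1; have h := expR_ge1Dx (- r).
have r2 : 0 < 1 - r by rewrite subr_gt0 (le_lt_trans r1)// invf_lt1// ltr1n.
have : expR r <= (1 - r)^-1.
  by rewrite -[leLHS]invrK -expRN lef_pV2 ?posrE// expR_gt0.
move=> h2; rewrite lerBlDl (le_trans h2)// -[leLHS]mul1r ler_pdivrMr//.
have : 0 <= r * (1 - 2 * r).
  by rewrite mulr_ge0// subr_ge0 -ler_pdivlMl// mulr1.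
lra.
Qed.

Lemma exp_sub1_le A : `|A| <= 2^-1 -> `|op_exp A - 1 - A| <= 2 * `|A| * `|A|.
Proof.
move=> A1; have := @expB_le A 0 `|A| (lexx _).
rewrite normr0 exp0 !subr0 => /(_ (normr_ge0 _)) h; apply: (le_trans h).
by rewrite ler_wpM2r// expR_sub1_le.
Qed.

Lemma exp_continuous : continuous (@op_exp R V).
Proof.
move=> A; apply: (iffRL (@cvgrPdist_le _ _ _ (nbhs A) _ (@op_exp R V) (op_exp A))) => e e0.
pose r := `|A| + 1; have k0 : 0 < expR r by exact: expR_gt0.
apply: filterS2 (near_dist A ltr01) (near_dist A (divr_gt0 e0 k0)) => B BA BA'.
have Br : `|B| <= r.
  rewrite /r -lerBlDl (le_trans (lerB_dist _ _))// distrC; exact: ltW.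
have Ar : `|A| <= r by rewrite lerDl.
rewrite -[X in `|X|](subrK (A - B)) (le_trans (ler_normD _ _))//.
rewrite (@le_trans _ _ (expR r * `|A - B|))//.
  by rewrite -lerBrDr (le_trans (expB_le Ar Br))// mulrBl mul1r.
by rewrite -ler_pdivlMl// mulrC ltW.
Qed.

End banach_algebra.
Arguments cvg_exp {R V} A.

Lemma exp_morph (R : realType) (V W : completeNormedModType R)
    (p : bop (bop V V) (bop W W)) (A : bop V V) :
  (forall n, p (A ^+ n) = p A ^+ n) -> p (op_exp A) = op_exp (p A).
Proof.
move=> pX; apply: (cvg_unique (@norm_hausdorff _ _) _ (cvg_exp (p A))).
have -> : series (eterm (p A)) = p \o series (eterm A).
  apply/funext => n; rewrite /series /=.
  elim: n => [|n IH]; first by rewrite !big_nil bop_zero.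
  by rewrite !big_nat_recr//= bop_add IH /eterm bop_scale pX.
by apply: cvg_bop; exact: cvg_exp.
Qed.

(** * Logarithms in closed subalgebras *)

Section closed_subalgebras.
Context (R : realType) (V : completeNormedModType R).
Implicit Types (A B X Y t : bop V V) (S : set (bop V V)).

Record closed_subalgebra S : Prop := ClosedSubalgebra {
  csub1 : S 1 ;
  csubD : forall A B, S A -> S B -> S (A + B) ;
  csubZ : forall a A, S A -> S (a *: A) ;
  csubM : forall A B, S A -> S B -> S (A * B) ;
  csub_lim : forall (u : nat -> bop V V) (A : bop V V),
    (forall n, S (u n)) -> u @ \oo --> A -> S A }.

Lemma csubB S A B : closed_subalgebra S -> S A -> S B -> S (A - B).
Proof. by move=> hS sA sB; rewrite -scaleN1r; apply: csubD => //; exact: csubZ. Qed.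

Lemma csub_sum S (u : nat -> bop V V) n : closed_subalgebra S ->
  (forall k, S (u k)) -> S (\sum_(0 <= k < n) u k).
Proof.
move=> hS su; elim: n => [|n IH]; last by rewrite big_nat_recr//=; apply: csubD.
by rewrite big_nil -(scale0r (1 : bop V V)); apply: csubZ => //; exact: csub1.
Qed.

Lemma csubX S A n : closed_subalgebra S -> S A -> S (A ^+ n).
Proof.
move=> hS sA; elim: n => [|n IH]; first by rewrite expr0; exact: csub1.
by rewrite exprS; exact: csubM.
Qed.

Lemma csub_geom S A : closed_subalgebra S -> S A -> `|A| < 1 -> S (geom A).
Proof.
move=> hS sA A1; apply: (csub_lim hS) (cvg_geom A1) => n.
by apply: csub_sum => // k; exact: csubX.
Qed.

Lemma op_inverse_uniq A B X : op_inverse A B -> op_inverse A X -> B = X.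
Proof. by move=> [AB BA] [AX XA]; rewrite -[B]mulr1 -AX mulrA BA mul1r. Qed.

Lemma op_inverseM A A' B B' :
  op_inverse A A' -> op_inverse B B' -> op_inverse (A * B) (B' * A').
Proof.
move=> [h1 h2] [h3 h4]; split.
  by rewrite mulrA -(mulrA A) h3 mulr1.
by rewrite mulrA -(mulrA B') h2 mulr1.
Qed.

(* Spectral permanence along a segment: the inverse is continued from [s = 0]
   in steps that are short compared to the uniform bound [M]. *)
Lemma csub_segment_inv S B (M : R) : closed_subalgebra S -> S B ->
  (forall s, 0 <= s <= 1 ->
     exists2 I : bop V V, op_inverse (1 + s *: B) I & `|I| <= M) ->
  forall s I, 0 <= s <= 1 -> op_inverse (1 + s *: B) I -> S I.
Proof.
move=> hS sB hM s I /andP[s0 s1] hI.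
have M0 : 0 <= M.
  have [|J _ JM] := hM 0; first by rewrite lexx ler01.
  exact: le_trans JM.
pose n := Num.bound (M * `|B|).
have nM : M * `|B| < n%:R.
  by have := archi_boundP (mulr_ge0 M0 (normr_ge0 B)).
have n0 : 0 < n%:R :> R by apply: le_lt_trans nM; rewrite mulr_ge0.
pose d := s / n%:R.
have d0 : 0 <= d by rewrite divr_ge0// ltW.
suff H k : (k <= n)%N -> forall J, op_inverse (1 + (k%:R * d) *: B) J -> S J.
  by apply: (H n) => //; rewrite /d mulrCA mulfV ?mulr1// gt_eqF.
elim: k => [_ J|k IH kn J hJ].
  rewrite mul0r scale0r addr0 => -[h _]; rewrite mul1r in h; rewrite h.
  exact: csub1.
have kd : 0 <= k%:R * d <= 1.
  rewrite mulr_ge0//= /d mulrCA mulr_ile1 ?divr_ge0 ?ler0n//.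
  by rewrite ler_pdivrMr// mul1r ler_nat ltnW.
have [K hK KM] := hM _ kd.
have sK := IH (ltnW kn) _ hK.
pose X := (- d) *: (K * B).
have X1 : `|X| < 1.
  rewrite normrZ normrN ger0_norm// (@le_lt_trans _ _ (d * (M * `|B|)))//.
    by rewrite ler_wpM2l// (le_trans (bopMnorm _ _))// ler_wpM2r.
  rewrite /d mulrAC ltr_pdivrMr// mul1r (le_lt_trans _ nM)//.
  by rewrite -[leRHS]mul1r ler_wpM2r// mulr_ge0.
have sX : S X by apply: csubZ => //; exact: csubM.
have E : 1 + (k.+1%:R * d) *: B = (1 + (k%:R * d) *: B) * (1 - X).
  rewrite /X mulrBr mulr1 -bopAr mulrA hK.1 mul1r scaleNr opprK -addrA.
  by rewrite -scalerDl -addn1 natrD [in LHS]mulrDl mul1r.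
rewrite E in hJ.
rewrite (op_inverse_uniq hJ (op_inverseM hK (geom_inv X1))).
by apply: csubM => //; exact: csub_geom.
Qed.

End closed_subalgebras.

(** * Poisson kernels of an operator of norm less than 1 *)

Section poisson.
Context (R : realType) (V : completeNormedModType R) (t : bop V V).
Hypothesis t1 : `|t| < 1.
Implicit Types (th : R) (n N : nat).

Definition poisson_coef th n : R :=
  if n is 0 then 1 else 2 * cos (n%:R * th).

Definition poisson_term th n : bop V V := poisson_coef th n *: t ^+ n.

Definition poisson th : bop V V := limn (series (poisson_term th)).

Lemma poisson_coef_le th n : `|poisson_coef th n| <= 2.
Proof.
case: n => [|n] /=; first by rewrite normr1 ler1n.
by rewrite normrM ger0_norm// -[leRHS]mulr1 ler_wpM2l// cos_max.
Qed.

Lemma poisson_term_le th n : `|poisson_term th n| <= 2 * `|t| ^+ n.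
Proof. by rewrite normrZ ler_pM// ?bopXnorm// poisson_coef_le. Qed.

Lemma sum_geom_le n : \sum_(0 <= k < n) 2 * `|t| ^+ k <= 2 / (1 - `|t|).
Proof. by rewrite -mulr_sumr ler_wpM2l// geom_sum_le. Qed.

Lemma cvg_poisson th : series (poisson_term th) @ \oo --> poisson th.
Proof. exact: (normed_series_cvg (poisson_term_le th) sum_geom_le). Qed.
Arguments cvg_poisson : clear implicits.

Lemma poisson_norm th : `|poisson th| <= 2 / (1 - `|t|).
Proof.
apply: cvg_norm_le (cvg_poisson th) _ => n.
rewrite (le_trans (ler_norm_sum _ _ _))//.
by rewrite (le_trans _ (sum_geom_le n))// ler_sum// => i _; exact: poisson_term_le.
Qed.

Lemma poisson_tail th N :
  `|poisson th - series (poisson_term th) N| <= 2 / (1 - `|t|) * `|t| ^+ N.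
Proof.
have h : (fun n => series (poisson_term th) n - series (poisson_term th) N) @ \oo -->
    poisson th - series (poisson_term th) N.
  by apply: cvgB; [exact: cvg_poisson|exact: cvg_cst].
rewrite -(cvg_shiftn N) in h; apply: cvg_norm_le h _ => n.
rewrite /series /= (big_cat_nat (n := N))//= ?leq_addl// addrAC subrr add0r.
rewrite (le_trans (ler_norm_sum _ _ _))//.
rewrite -{1}[N]add0n big_addn addnK.
rewrite (@le_trans _ _ (\sum_(0 <= k < n) 2 * `|t| ^+ k * `|t| ^+ N))//.
  by apply: ler_sum => k _; rewrite -mulrA -exprD poisson_term_le.
by rewrite -mulr_suml ler_wpM2r ?exprn_ge0// sum_geom_le.
Qed.

Lemma comm_poisson th A : GRing.comm A t -> GRing.comm A (poisson th).
Proof.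
move=> At; apply: (comm_lim (cvg_poisson th)) => n.
by apply: commr_sum => i _; apply: bop_commZ; exact: commrX.
Qed.

Definition poisson_den th : bop V V := 1 - (2 * cos th) *: t + t ^+ 2.

(** The recurrence [cos ((n+2) th) = 2 cos th cos ((n+1) th) - cos (n th)] cancels all intermediate
    coefficients; beside [1 - t ^ 2] only two boundary terms survive, and they vanish in the
    limit. *)
Lemma poisson_den_partial th n :
  poisson_den th * series (poisson_term th) n.+1 =
  1 - t ^+ 2 - (2 * cos (n.+1%:R * th)) *: t ^+ n.+1
             + (2 * cos (n%:R * th)) *: t ^+ n.+2.
Proof.
rewrite /series /=; elim: n => [|n IH].
  rewrite big_nat1 /poisson_term /= scale1r expr0 mulr1 mul0r cos0 mulr1 mul1r.
  rewrite /poisson_den expr1 (scaler_nat 2) mulr2n.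
  by rewrite mulr2n addrA (addrAC 1 (- t ^+ 2)) subrK.
have den : poisson_den th * t ^+ n.+1 = t ^+ n.+1 - (2 * cos th) *: t ^+ n.+2 + t ^+ n.+3.
  rewrite /poisson_den; move: (2 * cos th) => c.
  by rewrite mulrDl mulrBl mul1r -bopAl -exprS -exprD add2n.
rewrite big_nat_recr//= mulrDr {}IH /poisson_term /= -bopAr den.
set c1 := cos (n.+1%:R * th); set x := t ^+ n.+1; set y := t ^+ n.+2.
set z := t ^+ n.+3.
have -> : 2 * cos (n.+2%:R * th) = 2 * c1 * (2 * cos th) - 2 * cos (n%:R * th).
  rewrite /c1; have -> : n.+2%:R * th = n.+1%:R * th + th.
    by rewrite -[n.+2]addn1 natrD mulrDl mul1r.
  have -> : n%:R * th = n.+1%:R * th - th.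
    by rewrite -[n.+1]addn1 natrD mulrDl mul1r addrK.
  by rewrite cosB cosD; ring.
rewrite scalerDr scalerBr scalerA scalerBl !opprB !addrA.
rewrite -[_ - _ + _ + _ *: x]addrA [_ *: y + _ *: x]addrC addrA addrNK.
by rewrite addrAC.
Qed.

Lemma poisson_denE th : poisson_den th * poisson th = 1 - t ^+ 2.
Proof.
have h1 : (fun n => poisson_den th * series (poisson_term th) n.+1) @ \oo -->
    poisson_den th * poisson th.
  apply: cvg_bopM; first exact: cvg_cst.
  by rewrite (cvg_shiftS (series (poisson_term th))); exact: cvg_poisson.
apply: (cvg_unique (@norm_hausdorff _ _) h1).
apply: (@sub_cvg0 _ _ _ _ (fun n => 4 * `|t| ^+ n)) => [n|]; last first.
  have -> : (0 : R) = 4 * 0 by rewrite mulr0.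
  by apply: cvgMr; apply: cvg_expr; rewrite normr_id.
have tn x k m : (m <= k)%N -> `|(2 * cos x) *: t ^+ k| <= 2 * `|t| ^+ m.
  move=> mk; rewrite normrZ normrM ger0_norm// ler_pM ?mulr_ge0//.
    by rewrite -[leRHS]mulr1 ler_wpM2l// cos_max.
  rewrite (le_trans (bopXnorm _ _))// ler_wiXn2l//; exact: ltW.
rewrite poisson_den_partial; set c := 1 - t ^+ 2.
rewrite -[c - _ + _]addrA addrAC subrr add0r (le_trans (ler_normD _ _))// normrN.
have -> : (4 : R) = 2 + 2 by rewrite -natrD.
by rewrite [leRHS]mulrDl lerD// tn// leqW.
Qed.

(** Multiplied by [2 sin h] with [h = n pi / N], the sum telescopes to
    [sin (2 N h - h) - sin (- h)], which is 0 because [2 N h] is a multiple of [2 pi]. The bounds on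
    [n] make [sin h] nonzero. *)
Lemma sum_cos_eq0 N n : (0 < n)%N -> (n < N)%N ->
  \sum_(0 <= j < N) cos (n%:R * (j%:R * (pi *+ 2 / N%:R))) = 0 :> R.
Proof.
move=> n0 nN; have N0 : N%:R != 0 :> R.
  by rewrite pnatr_eq0 -lt0n (leq_ltn_trans _ nN).
pose h : R := n%:R * pi / N%:R.
have sh : sin h != 0.
  rewrite gt_eqF// sin_gt0_pi// /h divr_gt0 ?mulr_gt0 ?pi_gt0 ?ltr0n//=.
    by rewrite ltr_pdivrMr ?ltr0n 1?(leq_ltn_trans _ nN)// mulrC ltr_pM2l ?pi_gt0// ltr_nat.
  exact: leq_ltn_trans nN.
pose f (j : nat) : R := sin (j%:R * (h *+ 2) - h).
apply: (mulfI sh); rewrite mulr0; apply: (mulfI (_ : 2 != 0)); first by rewrite pnatr_eq0.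
rewrite mulr0 !mulr_sumr.
rewrite (eq_bigr (fun j => f j.+1 - f j)) => [|j _]; last first.
  have -> : n%:R * (j%:R * (pi *+ 2 / N%:R)) = j%:R * (h *+ 2) by rewrite /h; ring.
  rewrite /f; have -> : j.+1%:R * (h *+ 2) - h = j%:R * (h *+ 2) + h.
    by rewrite -addn1 natrD; ring.
  by rewrite sinB sinD; ring.
rewrite telescope_sumr// /f mul0r add0r.
have -> : N%:R * (h *+ 2) - h = - h + (pi *+ 2) *+ n by rewrite /h; field.
by rewrite (periodicn (@sinD2pi R)) subrr.
Qed.

Definition node N (j : nat) : R := j%:R * (pi *+ 2 / N%:R).

(** Averaging over [N] equally spaced angles kills the harmonics of order [0 < n < N]. Truncated at
    [N] terms, the series thus averages to 1, and the error is a tail. *)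
Lemma poisson_avg N : (0 < N)%N ->
  `|N%:R^-1 *: (\sum_(0 <= j < N) poisson (node N j)) - 1|
    <= 2 / (1 - `|t|) * `|t| ^+ N.
Proof.
move=> N0; have N0' : (0 : R) < N%:R by rewrite ltr0n.
have E : \sum_(0 <= j < N) series (poisson_term (node N j)) N = N%:R *: (1 : bop V V).
  rewrite /series /= exchange_big /= -(prednK N0) big_nat_recl//=.
  rewrite [X in _ + X]big1_seq ?addr0 => [|k /andP[_]].
    rewrite /poisson_term /= expr0 scale1r sumr_const_nat subn0 prednK//.
    by rewrite [RHS](@scaler_nat R).
  rewrite mem_index_iota => /andP[_ kN].
  rewrite -scaler_suml /poisson_coef -mulr_sumr (prednK N0) sum_cos_eq0//.
    by rewrite mulr0 scale0r.
  by rewrite -(prednK N0) ltnS.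
have -> : (1 : bop V V) = (N%:R^-1 : R) *: ((N%:R : R) *: (1 : bop V V)).
  by rewrite scalerA mulVf ?scale1r// gt_eqF.
rewrite -scalerBr -E -sumrB normrZ ger0_norm ?invr_ge0 ?ler0n//.
rewrite ler_pdivrMl// (le_trans (ler_norm_sum _ _ _))//.
rewrite (le_trans (ler_sum _ (fun j _ => poisson_tail (node N j) N)))//.
by rewrite sumr_const_nat subn0 [leRHS]mulr_natl.
Qed.

End poisson.

(** * Inverse square roots as averages of inverses along a segment *)

Section half_power.
Context (R : realType) (V : completeNormedModType R).
Implicit Types (A B X Y D E t : bop V V) (S : set (bop V V)).

Lemma comm_inverse E y t : op_inverse E y -> GRing.comm E t -> GRing.comm y t.
Proof.
move=> [Ey yE] Et; rewrite /GRing.comm.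
by rewrite -[y * t]mulr1 -Ey mulrA -(mulrA y t) -Et (mulrA y E) yE mul1r.
Qed.

Lemma sqr_sub1 t : (1 - t) * (1 - t) = 1 + t ^+ 2 - t *+ 2.
Proof.
rewrite mulrBl !mulrBr !mul1r mulr1 -expr2 opprB addrA mulr2n opprD addrA.
by rewrite (addrAC 1).
Qed.

Lemma sqr_add1 t : (1 + t) * (1 + t) = 1 + t ^+ 2 + t *+ 2.
Proof.
rewrite mulrDl !mulrDr !mul1r mulr1 -expr2 addrA mulr2n addrA.
by rewrite addrAC (addrAC 1) (addrAC _ t t).
Qed.

Lemma mul_add_sub1 t : (1 + t) * (1 - t) = 1 - t ^+ 2.
Proof. by rewrite mulrBr mulr1 mulrDl mul1r -expr2 opprD addrA addrK. Qed.

Lemma mul_sub_add1 t : (1 - t) * (1 + t) = 1 - t ^+ 2.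
Proof. by rewrite mulrBl mul1r mulrDr mulr1 -expr2 opprD addrA addrK. Qed.

Lemma sqr_norm_lt1 t : `|t| < 1 -> `|t ^+ 2| < 1.
Proof.
by move=> t1; rewrite (le_lt_trans (bopXnorm _ _))// expr_lt1.
Qed.

Lemma scaler_mean (s : R) X t :
  (1 - s) *: (X - t) + s *: (X + t) = X + (2 * s - 1) *: t.
Proof.
rewrite scalerBr scalerDr addrACA -scalerDl subrK scale1r -scaleNr -scalerDl.
by congr (_ + _ *: _); ring.
Qed.

(** The relation makes [E] the Cayley transform [(1 + t) / (1 - t)]. One has
    [1 + s (E^2 - 1) = E ((1 - s) y + s E)], and the second factor times [1 - t^2] is
    [(1 - s) (1 - t)^2 + s (1 + t)^2]. For [s = (1 - cos th) / 2] this is the denominator of the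
    Poisson kernel. *)
Lemma half_power_inv E y t th : op_inverse E y -> `|t| < 1 -> GRing.comm E t ->
  E * (1 - t) = 1 + t ->
  op_inverse (1 + ((1 - cos th) / 2) *: (E * E - 1)) (y * poisson t th).
Proof.
move=> Ey t1 Et rel; have yt := comm_inverse Ey Et.
set s := (1 - cos th) / 2.
pose Z := (1 - s) *: y + s *: E.
have y1 : y * (1 - t ^+ 2) = 1 + t ^+ 2 - t *+ 2.
  by rewrite -mul_add_sub1 -rel -sqr_sub1 !mulrA Ey.2 mul1r.
have E1 : E * (1 - t ^+ 2) = 1 + t ^+ 2 + t *+ 2.
  by rewrite -mul_sub_add1 -sqr_add1 !mulrA rel.
have Zq : Z * (1 - t ^+ 2) = poisson_den t th.
  rewrite /Z mulrDl -!bopAl y1 E1 scaler_mean /poisson_den addrAC.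
  congr (_ + _ + _); rewrite -[t *+ 2](@scaler_nat R) scalerA -scaleNr.
  by congr (_ *: _); rewrite /s; field.
have tP : GRing.comm (poisson t th) (1 - t ^+ 2).
  apply: commrB; first exact: commr1.
  by apply/commrX/commr_sym/comm_poisson.
have tZ : GRing.comm t Z.
  by apply: commrD; apply: bop_commZ; exact: commr_sym.
have G := geom_inv (sqr_norm_lt1 t1).
have ZP : Z * poisson t th = 1.
  rewrite -[LHS]mulr1 -G.1 mulrA -(mulrA Z) tP (mulrA Z) Zq.
  by rewrite poisson_denE.
have PZ : poisson t th * Z = 1.
  rewrite -ZP; apply/commr_sym/comm_poisson => //; exact: commr_sym.
have yP : GRing.comm y (poisson t th) by apply: comm_poisson.
have W1 : (1 + s *: (E * E - 1)) * y = Z.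
  rewrite mulrDl mul1r -bopAl mulrBl mul1r -mulrA Ey.1 mulr1 scalerBr.
  by rewrite /Z scalerBl scale1r -addrA [- _ + _]addrC.
have W2 : y * (1 + s *: (E * E - 1)) = Z.
  rewrite mulrDr mulr1 -bopAr mulrBr mulr1 mulrA Ey.2 mul1r scalerBr.
  by rewrite /Z scalerBl scale1r -addrA [- _ + _]addrC.
split; first by rewrite mulrA W1.
by rewrite yP -mulrA W2.
Qed.

Lemma csub_half_power S E y t : closed_subalgebra S -> op_inverse E y ->
  `|t| < 1 -> GRing.comm E t -> E * (1 - t) = 1 + t -> S (E * E) -> S y.
Proof.
move=> hS Ey t1 Et rel sE.
have cos_itv (x : R) : 0 <= (1 - cos x) / 2 <= 1.
  have := cos_geN1 x; have := cos_le1 x; lra.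
have sP th : S (y * poisson t th).
  have sB : S (E * E - 1) by apply: csubB => //; exact: csub1.
  apply: (csub_segment_inv (M := `|y| * (2 / (1 - `|t|))) hS sB _ (cos_itv th)).
    move=> s /andP[s0 s1]; have sitv : -1 <= 1 - 2 * s <= 1 by lra.
    (* The angle [acos (1 - 2 s)] reaches every [s] in [0, 1], and the bound on the Poisson kernel
       does not depend on the angle: this is the uniform bound along the segment. *)
    have := half_power_inv (acos (1 - 2 * s)) Ey t1 Et rel.
    have -> : (1 - cos (acos (1 - 2 * s))) / 2 = s.
      by rewrite acosK ?in_itv//=; field.
    move=> h; exists (y * poisson t (acos (1 - 2 * s))) => //.
    by rewrite (le_trans (bopMnorm _ _))// ler_wpM2l// poisson_norm.
  exact: half_power_inv.
(* Averages of [y] times Poisson kernels tend to [y], since the kernels average to 1 in the limit.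
   The index [N.+1] ensures at least one node. *)
pose u N := N.+1%:R^-1 *: \sum_(0 <= j < N.+1) y * poisson t (node R N.+1 j).
apply: (csub_lim hS (u := u)) => [N|].
  by apply: csubZ => //; apply: csub_sum.
apply: (@sub_cvg0 _ _ _ _ (fun N => `|y| * (2 / (1 - `|t|)) * `|t| ^+ N.+1)) => [N|].
  rewrite /u -mulr_sumr bopAr -{2}[y]mulr1 -mulrBr (le_trans (bopMnorm _ _))//.
  by rewrite -mulrA ler_wpM2l// poisson_avg.
rewrite -(mulr0 (`|y| * (2 / (1 - `|t|)))); apply: cvgMr.
rewrite (cvg_shiftS (fun n => `|t| ^+ n)); apply: cvg_expr; by rewrite normr_id.
Qed.

End half_power.

(** * Hyperbolic tangents of operators, with norm bounds *)

Section tanh.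
Context (R : realType) (V : completeNormedModType R).
Implicit Types (X Y t : bop V V).

Lemma atan_le (x : R) : 0 <= x -> atan x <= x.
Proof.
move=> x0.
have [|c _] := @MVT_segment R atan (fun z => (1 + z ^+ 2)^-1) 0 x x0.
  by apply: continuous_subspaceT => z; exact: continuous_atan.
rewrite atan0 !subr0 => ->; rewrite -[leRHS]mul1r ler_wpM2r// invf_le1.
  by rewrite lerDl sqr_ge0.
by rewrite ltr_wpDr// sqr_ge0.
Qed.

Lemma le_tan (x : R) : 0 <= x -> x < pi / 2 -> x <= tan x.
Proof.
move=> x0 x1; have x1' : - (pi / 2) < x.
  by rewrite (lt_le_trans _ x0)// oppr_lt0 divr_gt0// pi_gt0.
rewrite -{1}[x]tanK ?in_itv/= ?x1' ?x1// atan_le//.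
rewrite /tan divr_ge0 ?sin_ge0_pi ?cos_ge0_pihalf ?(ltW x1) ?(ltW x1')//.
rewrite x0/= (le_trans (ltW x1))// ler_pdivrMr// ler_peMr ?ler1n// pi_ge0//.
Qed.

Lemma tan_lt1 (x : R) : 0 <= x -> x < pi / 4 -> tan x < 1.
Proof.
move=> x0 x1; have p0 := pi_gt0 R.
by rewrite -tan_piquarter ltr_tan ?in_itv/=//; lra.
Qed.

(* This relation expresses [t = tanh X]. *)
Definition half_tanh X t : Prop :=
  GRing.comm (op_exp ((2 : R) *: X)) t /\ op_exp ((2 : R) *: X) * (1 - t) = 1 + t.

Lemma exp_double X : op_exp ((2 : R) *: X) = op_exp X * op_exp X.
Proof. by rewrite -expD// (scaler_nat 2) mulr2n. Qed.

(* The doubling formula [tanh 2X = 2 tanh X / (1 + tanh^2 X)] is dominated by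
   [tan 2a = 2 tan a / (1 - tan^2 a)]. *)
Lemma half_tanh_double X t (a : R) : half_tanh X t -> 0 <= a -> a < pi / 4 ->
  `|t| <= tan a ->
  exists2 t', half_tanh ((2 : R) *: X) t' & `|t'| <= tan (2 * a).
Proof.
move=> [Et rel] a0 a1 ta; have T1 := tan_lt1 a0 a1.
have t1 : `|t| < 1 by exact: le_lt_trans ta T1.
have nt2 : `|- t ^+ 2| < 1 by rewrite normrN sqr_norm_lt1.
have I := geom_inv nt2; rewrite opprK in I.
set i := geom (- t ^+ 2) in I.
set E := op_exp ((2 : R) *: X) in Et rel.
have ti : GRing.comm t i by apply: comm_geom => //; apply/commrN/commrX.
exists ((2 : R) *: (t * i)); last first.
  have p0 := pi_gt0 R.
  have ca : cos a != 0 by rewrite gt_eqF// cos_gt0_pihalf//; lra.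
  have -> : 2 * a = a *+ 2 by rewrite mulr2n; ring.
  rewrite tan_mulr2n// normrZ ger0_norm// -[tan a *+ 2]mulr_natl -[leRHS]mulrA ler_wpM2l//.
  rewrite (le_trans (bopMnorm _ _))// ler_pM// (le_trans (geom_norm nt2))//.
  have T0 : 0 <= tan a by exact: le_trans ta.
  have T2 : 0 < 1 - tan a ^+ 2 by rewrite subr_gt0 expr_lt1.
  have tT : `|- t ^+ 2| <= tan a ^+ 2.
    by rewrite normrN (le_trans (bopXnorm _ _))// lerXn2r ?nnegrE.
  rewrite lef_pV2 ?posrE// ?lerD2l ?lerN2//.
  by rewrite (lt_le_trans T2)// lerD2l lerN2.
have Ei : GRing.comm E i by apply: comm_geom => //; apply/commrN/commrX.
rewrite /half_tanh exp_double -/E; split.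
  apply: bop_commZ; apply/commr_sym/commrM; apply/commr_sym; exact: commrM.
have h1 : (1 - (2 : R) *: (t * i)) * (1 + t ^+ 2) = (1 - t) * (1 - t).
  by rewrite mulrBl mul1r -bopAl -mulrA I.2 mulr1 sqr_sub1 (scaler_nat 2).
have h2 : (1 + (2 : R) *: (t * i)) * (1 + t ^+ 2) = (1 + t) * (1 + t).
  by rewrite mulrDl mul1r -bopAl -mulrA I.2 mulr1 sqr_add1 (scaler_nat 2).
have cancel A B : A * (1 + t ^+ 2) = B * (1 + t ^+ 2) -> A = B.
  by move=> h; rewrite -[A]mulr1 -[B]mulr1 -I.1 !mulrA h.
apply: cancel; rewrite h2 -mulrA h1 -!mulrA (mulrA E (1 - t)) rel.
by rewrite mul_add_sub1 -mul_sub_add1 mulrA rel.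
Qed.

Lemma half_tanh_iter n X t (a : R) : half_tanh X t -> 0 <= a ->
  2 ^+ n * a < pi / 4 -> `|t| <= tan a ->
  exists2 t', half_tanh ((2 ^+ n : R) *: X) t' & `|t'| <= tan (2 ^+ n * a).
Proof.
elim: n X t a => [|n IH] X t a ht a0 an ta.
  by exists t; rewrite ?expr0 ?scale1r ?mul1r.
have a1 : a < pi / 4.
  by rewrite (le_lt_trans _ an)// ler_peMl// exprn_ege1// ler1n.
have [t1 ht1 ta1] := half_tanh_double ht a0 a1 ta.
rewrite exprSr -mulrA in an *; rewrite -scalerA.
by apply: IH ht1 _ an ta1; rewrite mulr_ge0.
Qed.

(** With [Z = (1 - E) / 2], the quotient [(E - 1) / (E + 1)] is [- Z (1 - Z)^-1]. Since the norm of
    [Z] is at most [x + 4 x^2] for [x] the norm of [X], the loss over [x] is a factor close to 1,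
    and the last hypothesis says that [k] absorbs it. *)
Lemma half_tanh_small X (k : R) : 1 < k -> `|X| <= 8^-1 ->
  `|X| * (4 + 2 * k) <= k - 1 ->
  exists2 t, half_tanh X t & `|t| <= k * `|X|.
Proof.
move=> k1 x8 xk; set E := op_exp ((2 : R) *: X); set x := `|X| in x8 xk *.
have x0 : 0 <= x by exact: normr_ge0.
pose Z := (2^-1 : R) *: (1 - E).
have zx : `|Z| <= x + 4 * x ^+ 2.
  rewrite normrZ ger0_norm// ler_pdivrMl//.
  have n2 : `|(2 : R) *: X| = 2 * x by rewrite normrZ ger0_norm.
  have := @exp_sub1_le _ _ ((2 : R) *: X); rewrite n2 -/E.
  have -> : (1 - E) = - ((E - 1 - (2 : R) *: X) + (2 : R) *: X) by rewrite subrK opprB.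
  rewrite normrN => h; rewrite (le_trans (ler_normD _ _))// n2.
  have h2 : 2 * x <= 2^-1 by lra.
  by have := h h2; nra.
have z1 : `|Z| < 1 by rewrite (le_lt_trans zx)//; nra.
have G := geom_inv z1; set g := geom Z in G.
have EZ : GRing.comm E Z by apply: bop_commZ; apply: commrB => //; exact: commr1.
have Eg : GRing.comm E g by exact: comm_geom.
have E2 : E = 1 - Z - Z.
  rewrite -addrA -opprD -mulr2n -[Z *+ 2](@scaler_nat R) scalerA mulfV// scale1r.
  by rewrite opprB addrC subrK.
exists (- (Z * g)).
  split; first by apply: commrN; exact: commrM.
  have gE : g = 1 + Z * g by rewrite -{1}G.1 mulrBl mul1r subrK.
  by rewrite opprK -gE -/E {1}E2 mulrBl G.1.
rewrite normrN (le_trans (bopMnorm _ _))//.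
rewrite (le_trans (ler_wpM2l _ (geom_norm z1)))// ler_pdivrMr ?subr_gt0//.
have h1 : 1 + 4 * x + k * x + 4 * k * x ^+ 2 <= k by nra.
have h2 : x + 4 * x ^+ 2 <= k * x * (1 - (x + 4 * x ^+ 2)) by nra.
rewrite (le_trans zx)// (le_trans h2)// ler_wpM2l ?lerD2l ?lerN2//.
by rewrite mulr_ge0// ltW// (lt_trans _ k1).
Qed.

(** [X] is halved [n] times until the estimate for small operators applies, with a loss factor [k].
    As [a <= tan a], that estimate starts the doubling, and [n] doublings end at the bound
    [tan (k x)] with [x] the norm of [X]; it is below 1 as soon as [k x < pi / 4]. *)
Lemma half_tanh_exists X : `|X| < pi / 4 -> exists2 t, half_tanh X t & `|t| < 1.
Proof.
move=> Xpi; set x := `|X| in Xpi.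
have x0 : 0 <= x by exact: normr_ge0.
(* This [k] makes [k x] exceed [x] by less than half of the gap to [pi / 4]; the summand 1 in the
   denominator covers [x = 0]. *)
pose k : R := 1 + (pi / 4 - x) / (2 * (x + 1)).
have k1 : 1 < k.
  by rewrite ltrDl divr_gt0 ?subr_gt0// mulr_gt0// ltr_wpDl.
have kx : k * x < pi / 4.
  have -> : k * x = x + (pi / 4 - x) * (x / (2 * (x + 1))).
    by rewrite /k; field; rewrite gt_eqF// ltr_wpDl.
  rewrite -ltrBrDl -[ltRHS]mulr1 ltr_pM2l ?subr_gt0//.
  rewrite ltr_pdivrMr ?mulr_gt0 ?ltr_wpDl// mul1r; lra.
clearbody k; have k0 : 0 <= k by rewrite ltW// (lt_trans ltr01).
have [m m0 /andP[m8 mk]] : exists2 m : R, 0 < m &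
    (m <= 8^-1) && (m <= (k - 1) / (4 + 2 * k)).
  exists (Num.min 8^-1 ((k - 1) / (4 + 2 * k))); last by rewrite !ge_min !lexx orbT.
  by rewrite lt_min invr_gt0 ltr0n/= divr_gt0 ?subr_gt0//; lra.
have [n nx] : exists n : nat, x / 2 ^+ n <= m.
  exists (Num.bound (x / m)).
  rewrite ler_pdivrMr ?exprn_gt0// mulrC -ler_pdivrMr//.
  rewrite (le_trans (ltW (archi_boundP _)))//; first by rewrite divr_ge0// ltW.
  by rewrite -natrX ler_nat ltnW// ltn_expl.
have nX : `|(2 ^- n : R) *: X| = x / 2 ^+ n.
  by rewrite normrZ ger0_norm ?invr_ge0 ?exprn_ge0// mulrC.
have [| | |t ht tk] := @half_tanh_small ((2 ^- n : R) *: X) k.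
- by [].
- by rewrite nX (le_trans nx).
- rewrite nX -ler_pdivlMr; last by lra.
  by rewrite (le_trans nx).
rewrite nX in tk.
have p2 : (2 ^+ n : R) != 0 by rewrite expf_neq0.
have a0 : 0 <= k * (x / 2 ^+ n).
  by apply: mulr_ge0 => //; apply: divr_ge0 => //; exact: exprn_ge0.
have E : 2 ^+ n * (k * (x / 2 ^+ n)) = k * x.
  by field.
have ap : k * (x / 2 ^+ n) < pi / 4.
  by rewrite (le_lt_trans _ kx)// -E ler_peMl// exprn_ege1// ler1n.
have [| |t' ht' tt'] := half_tanh_iter (n := n) ht a0 _ _.
- by rewrite E.
- by rewrite (le_trans tk)// le_tan// (lt_trans ap)// ltr_pM2l ?pi_gt0// ltf_pV2 ?posrE// ltr_nat.
exists t'.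
  by move: ht'; rewrite scalerA mulfV ?expf_neq0// scale1r.
by rewrite (le_lt_trans tt')// E tan_lt1// mulr_ge0// ltW// (lt_trans _ k1).
Qed.

End tanh.

Section logarithm_in_closed_subalgebra.
Context (R : realType) (V : completeNormedModType R) (S : set (bop V V)).
Hypothesis hS : closed_subalgebra S.
Implicit Types D : bop V V.

Lemma csub_exp_neg_half D : `|D| < pi -> S (op_exp D) ->
  S (op_exp ((- 2^-1 : R) *: D)).
Proof.
move=> Dpi sD.
(* At [X = D / 4] the relation [half_tanh] involves [op_exp (2 X) = exp (D / 2)], a square root of
   [exp D], and the bound [pi] on [D] becomes the bound [pi / 4] on [X]. *)
have [|t [Et rel] t1] := @half_tanh_exists _ _ ((4^-1 : R) *: D).
  by rewrite normrZ ger0_norm// mulrC ltr_pM2r.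
rewrite scalerA in Et rel.
have h : (2 * 4^-1 : R) = 2^-1 by field.
rewrite h in Et rel.
apply: (csub_half_power hS _ t1 Et rel); first by rewrite scaleNr; exact: exp_inverse.
by rewrite -exp_double scalerA mulfV// scale1r.
Qed.

(* [csub_exp_neg_half] iterates, since it shrinks the norm, and
   [(exp (s D) - 1) / s] tends to [D] along [s = (-1/2)^n]. *)
Lemma csub_log D : `|D| < pi -> S (op_exp D) -> S D.
Proof.
move=> Dpi sD.
pose s n : R := (- 2^-1) ^+ n.
have ns n : `|s n| = 2^-1 ^+ n by rewrite normrX normrN ger0_norm.
have ns1 n : `|s n| <= 1 by rewrite ns exprn_ile1// invf_le1// ler1n.
have s0 n : s n != 0 by rewrite expf_neq0// oppr_eq0 invr_eq0 pnatr_eq0.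
have sS n : S (op_exp (s n *: D)).
  elim: n => [|n IH]; first by rewrite /s expr0 scale1r.
  rewrite /s exprS -scalerA; apply: csub_exp_neg_half => //.
  rewrite (le_lt_trans _ Dpi)// normrZ -[leRHS]mul1r ler_wpM2r//; exact: ns1.
(* The norm of [D] is at most 4, so three initial halvings bring [s n.+3 *: D] into the ball of
   radius 1/2 where [exp_sub1_le] applies. *)
pose u n := (s n.+3)^-1 *: (op_exp (s n.+3 *: D) - 1).
apply: (csub_lim hS (u := u)) => [n|].
  by apply: csubZ => //; apply: csubB => //; exact: csub1.
apply: (@sub_cvg0 _ _ _ _ (fun n => 2 * `|D| ^+ 2 * 2^-1 ^+ n)) => [n|]; last first.
  rewrite -(mulr0 (2 * `|D| ^+ 2)); apply: cvgMr; apply: cvg_expr.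
  by rewrite ger0_norm// invf_lt1// ltr1n.
have sD2 : `|s n.+3 *: D| <= 2^-1.
  rewrite normrZ ns -addn3 exprD (@le_trans _ _ (2^-1 ^+ 3 * 4))//; last by lra.
  have p4 : `|D| <= 4.
    by have := pihalf_lt2 R; move: Dpi; lra.
  rewrite ler_pM// ?mulr_ge0 ?exprn_ge0// -[leRHS]mul1r ler_wpM2r ?exprn_ge0//.
  by rewrite exprn_ile1// invf_le1// ler1n.
have -> : u n - D = (s n.+3)^-1 *: (op_exp (s n.+3 *: D) - 1 - s n.+3 *: D).
  by rewrite scalerBr scalerA mulVf// scale1r.
rewrite normrZ normfV ler_pdivrMl ?normr_gt0// (le_trans (exp_sub1_le sD2))//.
rewrite normrZ; set r := `|s n.+3|.
have -> : 2 * (r * `|D|) * (r * `|D|) = r * (2 * `|D| ^+ 2 * r) by ring.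
rewrite ler_wpM2l ?normr_ge0// ler_wpM2l ?mulr_ge0 ?sqr_ge0// /r ns.
by rewrite ler_wiXn2l// ?invf_le1// ?ler1n// -addn3 leq_addr.
Qed.

End logarithm_in_closed_subalgebra.

(** * Calculus of continuously differentiable maps *)

(** Uniqueness of the differential, used in [diff_eps], is stated for linear maps; this structure
    makes bounded operators eligible. *)
HB.instance Definition _ (R : realType) (E F : normedModType R) (f : bop E F) :=
  GRing.isLinear.Build R E F *:%R (bop_fun f) (bop_lin f).

(** * Epsilon-delta forms of continuity and differentiability; the product rule *)

Section epsilon_delta.
Context (R : realType).
Implicit Types E F G : normedModType R.

Lemma open_eps E (U : set E) :
  open U <-> forall x, U x -> exists2 d : R, 0 < d & forall y, `|x - y| < d -> U y.
Proof.
rewrite openE; split=> [oU x /oU|h x /h [d d0 hd]].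
  by move=> /nbhs_ballP[d /= d0 hd]; exists d => // y xy; apply: hd; rewrite -ball_normE.
by apply/nbhs_ballP; exists d => // y; rewrite -ball_normE => /hd.
Qed.

Lemma cont_eps E F (f : E -> F) x : {for x, continuous f} <->
  forall e : R, 0 < e ->
    exists2 d : R, 0 < d & forall y, `|x - y| < d -> `|f x - f y| < e.
Proof.
split=> [fx e e0|h].
  have := iffLR (@cvgrPdist_lt _ _ _ (nbhs x) (nbhs_filter x) f (f x)) fx e e0.
  move=> /nbhs_ballP[d /= d0 hd]; exists d => // y xy; apply: hd.
  by rewrite -ball_normE.
apply: (iffRL (@cvgrPdist_lt _ _ _ (nbhs x) _ f (f x))) => e e0.
have [d d0 hd] := h e e0.
by apply/nbhs_ballP; exists d => // y; rewrite -ball_normE => /hd.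
Qed.

Lemma bop_continuous E F (L : bop E F) : continuous L.
Proof.
move=> x; apply/cont_eps => e e0.
have k0 : 0 < `|L| + 1 by rewrite ltr_wpDl.
exists (e / (`|L| + 1)); first by rewrite divr_gt0.
move=> y xy; rewrite -bop_sub (le_lt_trans (le_bop_norm _ _))//.
rewrite (@le_lt_trans _ _ ((`|L| + 1) * `|x - y|))//.
  by rewrite ler_wpM2r// lerDl.
by rewrite mulrC -ltr_pdivlMr.
Qed.

Lemma diff_eps E F (f : E -> F) x (L : bop E F) : is_diff x f L <->
  forall e : R, 0 < e -> exists2 d : R, 0 < d &
    forall h, `|h| < d -> `|f (x + h) - f x - L h| <= e * `|h|.
Proof.
split=> [[dfx dL] e e0|H].
  have [_ /eqaddoP/(_ e e0)] := iffLR (diff_locallyP x f) dfx; rewrite dL.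
  move=> /nbhs_ballP[d /= d0 hd]; exists d => // h hh.
  have := hd h; rewrite -ball_normE /= sub0r normrN => /(_ hh).
  by rewrite !fctE /= /cst /= opprD addrA (addrC h).
have lo : f \o shift x = cst (f x) + (L : E -> F) +o_ 0 id.
  apply/eqaddoP => e e0; have [d d0 hd] := H e e0.
  apply/nbhs_ballP; exists d => // h; rewrite -ball_normE /= sub0r normrN => /hd.
  by rewrite !fctE /= /cst /= opprD addrA (addrC h).
have dE := diff_unique (@bop_continuous _ _ L) lo.
split => //; apply/diff_locallyP; split; last by rewrite dE.
by rewrite dE; exact: bop_continuous.
Qed.

Lemma diff_cont E F (f : E -> F) x (L : bop E F) :
  is_diff x f L -> {for x, continuous f}.
Proof. by move=> [dfx _]; exact: differentiable_continuous. Qed.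

Lemma diff_lip E F (f : E -> F) x (L : bop E F) : is_diff x f L ->
  exists2 d : R, 0 < d & forall h, `|h| < d -> `|f (x + h) - f x| <= (`|L| + 1) * `|h|.
Proof.
move=> /diff_eps /(_ 1 ltr01)[d d0 hd]; exists d => // h /hd; rewrite mul1r => hh.
rewrite -[X in `|X|](subrK (L h)) (le_trans (ler_normD _ _))// mulrDl mul1r addrC.
by rewrite lerD// le_bop_norm.
Qed.

Lemma diff_affine E F (c : F) (L : bop E F) x : is_diff x (fun y => c + L y) L.
Proof.
apply/diff_eps => e e0; exists 1 => // h _.
rewrite bop_add opprD addrACA subrr add0r (addrC (L x)) addrK subrr normr0.
by rewrite mulr_ge0// ltW.
Qed.

Lemma diff_add E F (f g : E -> F) x (L M : bop E F) :
  is_diff x f L -> is_diff x g M -> is_diff x (fun y => f y + g y) (L + M).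
Proof.
move=> /diff_eps fL /diff_eps gM; apply/diff_eps => e e0.
have e2 : 0 < e / 2 by rewrite divr_gt0.
have [d1 d10 h1] := fL _ e2; have [d2 d20 h2] := gM _ e2.
exists (Num.min d1 d2) => [|h]; first by rewrite lt_min d10.
rewrite lt_min => /andP[/h1 k1 /h2 k2]; rewrite bopD.
have -> : f (x + h) + g (x + h) - (f x + g x) - (L h + M h) =
    (f (x + h) - f x - L h) + (g (x + h) - g x - M h).
  by rewrite addrACA -opprD (addrACA (f _)) -opprD.
rewrite (le_trans (ler_normD _ _))//.
by rewrite [e]splitr mulrDl lerD.
Qed.

Definition flipB E F G : bop (bop E (bop F G)) (bop F (bop E G)) :=
  bcomp (preB F (bop (bop F G) G) (bop E G) (evB F G)) (preB E (bop F G) G).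

(** The two halves [h -> B (L h) v] and [h -> B u (M h)] of the product rule are encoded as bounded
    bilinear maps of [(L, v)] and [(u, M)]. The derivative of a bilinear expression is then a sum of
    bilinear expressions, on which the induction of [cn_bil] runs. *)
Definition bil_left E F G H (B : bop F (bop G H)) :
    bop (bop E F) (bop G (bop E H)) :=
  bcomp (flipB E G H) (postB E F (bop G H) B).

Definition bil_right E F G H (B : bop F (bop G H)) :
    bop F (bop (bop E G) (bop E H)) := bcomp (postB E G H) B.

Lemma bil_norm F G H (B : bop F (bop G H)) u v :
  `|B u v| <= `|B| * `|u| * `|v|.
Proof. by rewrite (le_trans (le_bop_norm _ _))// ler_wpM2r// le_bop_norm. Qed.

Lemma zmod_bil_expand (Z : zmodType) (p q r s w z : Z) :
  p - q - (z + w) = (r - q - z) + (s - q - w) + (p - s - (r - q)).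
Proof.
rewrite [(r - q - z) + _]addrACA -opprD [RHS]addrAC; congr (_ - _).
by rewrite [(r - q) + _]addrC addrACA subrr addr0 [RHS]addrC addrA subrK.
Qed.

Lemma diff_bil E F G H (B : bop F (bop G H)) (f : E -> F) (g : E -> G) x
    (L : bop E F) (M : bop E G) :
  is_diff x f L -> is_diff x g M ->
  is_diff x (fun y => B (f y) (g y))
    (bil_left E B L (g x) + bil_right E B (f x) M).
Proof.
move=> fL gM; have [d1 d10 h1] := diff_lip fL; have [d2 d20 h2] := diff_lip gM.
move: fL gM => /diff_eps fL /diff_eps gM; apply/diff_eps => e e0.
pose K := `|B| + 1; have K0 : 0 < K by rewrite ltr_wpDl.
pose a := `|f x| + 1; have a0 : 0 < a by rewrite ltr_wpDl.
pose b := `|g x| + 1; have b0 : 0 < b by rewrite ltr_wpDl.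
pose l := `|L| + 1; have l0 : 0 < l by rewrite ltr_wpDl.
pose m := `|M| + 1; have m0 : 0 < m by rewrite ltr_wpDl.
have e3 : 0 < e / 3 by rewrite divr_gt0.
have [d3 d30 h3] := fL (e / 3 / (K * b)) (divr_gt0 e3 (mulr_gt0 K0 b0)).
have [d4 d40 h4] := gM (e / 3 / (K * a)) (divr_gt0 e3 (mulr_gt0 K0 a0)).
pose d5 := e / 3 / (K * l * m).
have d50 : 0 < d5 by rewrite divr_gt0// !mulr_gt0.
exists (Num.min d5 (Num.min (Num.min d1 d2) (Num.min d3 d4))) => [|h].
  by rewrite !lt_min d50 d10 d20 d30 d40.
rewrite !lt_min => /and3P[k5 /andP[/h1 k1 /h2 k2] /andP[/h3 k3 /h4 k4]].
have -> : B (f (x + h)) (g (x + h)) - B (f x) (g x) -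
   (bil_left E B L (g x) + bil_right E B (f x) M) h =
   B (f (x + h) - f x - L h) (g x) + B (f x) (g (x + h) - g x - M h) +
   B (f (x + h) - f x) (g (x + h) - g x).
  rewrite bopD !bop_sub !(bopD, bopN) -[bil_left _ _ _ _ _]/(B (L h) (g x)).
  by rewrite -[bil_right _ _ _ _ _]/(B (f x) (M h)); exact: zmod_bil_expand.
have h0 := normr_ge0 h; have B0 := normr_ge0 B.
have BK : `|B| <= K by rewrite lerDl.
have t1 : `|B (f (x + h) - f x - L h) (g x)| <= e / 3 * `|h|.
  rewrite (le_trans (bil_norm _ _ _))//.
  rewrite (@le_trans _ _ (K * (e / 3 / (K * b) * `|h|) * b))//.
    by rewrite !ler_pM ?mulr_ge0// lerDl.
  have -> // : K * (e / 3 / (K * b) * `|h|) * b = e / 3 * `|h|.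
  by field; rewrite !gt_eqF.
have t2 : `|B (f x) (g (x + h) - g x - M h)| <= e / 3 * `|h|.
  rewrite (le_trans (bil_norm _ _ _))//.
  rewrite (@le_trans _ _ (K * a * (e / 3 / (K * a) * `|h|)))//.
    by rewrite !ler_pM ?mulr_ge0// lerDl.
  have -> // : K * a * (e / 3 / (K * a) * `|h|) = e / 3 * `|h|.
  by field; rewrite !gt_eqF.
have t3 : `|B (f (x + h) - f x) (g (x + h) - g x)| <= e / 3 * `|h|.
  rewrite (le_trans (bil_norm _ _ _))//.
  rewrite (@le_trans _ _ (K * (l * `|h|) * (m * `|h|)))//.
    by rewrite !ler_pM ?mulr_ge0.
  have -> : K * (l * `|h|) * (m * `|h|) = (K * l * m * `|h|) * `|h| by ring.
  by rewrite ler_wpM2r// -ler_pdivlMl ?mulr_gt0// mulrC ltW.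
rewrite (le_trans (ler_normD _ _))// (le_trans (lerD (ler_normD _ _) t3))//.
by rewrite (le_trans (lerD (lerD t1 t2) (lexx _)))//; lra.
Qed.

Lemma diff_comp_bop E F G (f : E -> F) (g : F -> G) x (L : bop E F) (M : bop F G) :
  is_diff x f L -> is_diff (f x) g M -> is_diff x (g \o f) (bcomp M L).
Proof. by move=> fL gM; exact: is_diff_comp. Qed.

End epsilon_delta.

(** * Stability of the classes [Cn] *)

Section continuously_differentiable.
Context (R : realType).
Implicit Types E F G H : normedModType R.

Lemma cn_sub n E F (U U' : set E) (f : E -> F) : U' `<=` U -> Cn n U f -> Cn n U' f.
Proof.
elim: n F f => [|n IH] F f UU /=; first by move=> fc x /UU; exact: fc.
by move=> [df [fd cd]]; exists df; split; [move=> x /UU; exact: fd|exact: IH].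
Qed.

Lemma cn_cont n E F (U : set E) (f : E -> F) :
  Cn n U f -> forall x, U x -> {for x, continuous f}.
Proof.
case: n => [//|n] /= [df [fd _]] x Ux; exact: diff_cont (fd x Ux).
Qed.

Lemma cnW n E F (U : set E) (f : E -> F) : Cn n.+1 U f -> Cn n U f.
Proof.
elim: n F f => [|n IH] F f h; first exact: (cn_cont h).
by case: h => df [fd cd]; exists df; split => //; exact: IH.
Qed.

Lemma cn_cst n E F (U : set E) (c : F) : Cn n U (fun=> c).
Proof.
elim: n F c => [|n IH] F c /=; first by move=> x _; exact: cvg_cst.
exists (fun=> 0); split=> // x _.
have := diff_affine c (0 : bop E F) x.
by have -> : (fun y : E => c + (0 : bop E F) y) = (fun=> c)
  by apply/funext => y; rewrite addr0.
Qed.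

Lemma cn_affine n E F (U : set E) (c : F) (L : bop E F) :
  Cn n U (fun x => c + L x).
Proof.
case: n => [|n] /=.
  by move=> x _; apply: diff_cont; exact: diff_affine.
by exists (fun=> L); split=> [x _|]; [exact: diff_affine|exact: cn_cst].
Qed.

Lemma cn_bop n E F (U : set E) (L : bop E F) : Cn n U L.
Proof.
have -> : (L : E -> F) = (fun x => 0 + L x) by apply/funext => x; rewrite add0r.
exact: cn_affine.
Qed.

Lemma cn_add n E F (U : set E) (f g : E -> F) :
  Cn n U f -> Cn n U g -> Cn n U (fun x => f x + g x).
Proof.
elim: n F f g => [|n IH] F f g /=.
  by move=> fc gc x Ux; apply: cvgD; [exact: fc|exact: gc].
move=> [df [fd cdf]] [dg [gd cdg]]; exists (fun x => df x + dg x).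
by split=> [x Ux|]; [apply: diff_add; [exact: fd|exact: gd]|exact: IH].
Qed.

Lemma cn_bil n E F G H (B : bop F (bop G H)) (U : set E) (f : E -> F) (g : E -> G) :
  Cn n U f -> Cn n U g -> Cn n U (fun x => B (f x) (g x)).
Proof.
elim: n F G H B f g => [|n IH] F G H B f g.
  move=> /= fc gc x Ux.
  move/cont_eps: (fc x Ux) => hf; move/cont_eps: (gc x Ux) => hg.
  apply/cont_eps => e e0.
  pose K := `|B| + 1; have K0 : 0 < K by rewrite ltr_wpDl.
  pose a := `|f x| + 1; have a0 : 0 < a by rewrite ltr_wpDl.
  pose b := `|g x| + 1; have b0 : 0 < b by rewrite ltr_wpDl.
  have e2 : 0 < e / 2 by rewrite divr_gt0.
  have [d1 d10 h1] := hf (e / 2 / (K * b)) (divr_gt0 e2 (mulr_gt0 K0 b0)).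
  have [d2 d20 h2] := hg (e / 2 / (K * a)) (divr_gt0 e2 (mulr_gt0 K0 a0)).
  have [d3 d30 h3] := hg 1 ltr01.
  exists (Num.min d1 (Num.min d2 d3)) => [|y]; first by rewrite !lt_min d10 d20.
  rewrite !lt_min => /and3P[/h1 k1 /h2 k2 /h3 k3].
  have gb : `|g y| <= b.
    by rewrite /b -lerBlDl (le_trans (lerB_dist _ _))// distrC ltW.
  have -> : B (f x) (g x) - B (f y) (g y) = B (f x - f y) (g y) + B (f x) (g x - g y).
    by rewrite !bop_sub bopD bopN [RHS]addrC addrA subrK.
  rewrite (le_lt_trans (ler_normD _ _))// [e]splitr.
  have BK : `|B| <= K by rewrite lerDl.
  have fa : `|f x| <= a by rewrite lerDl.
  apply: ler_ltD.
    rewrite (le_trans (bil_norm _ _ _))//.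
    rewrite (@le_trans _ _ (K * (e / 2 / (K * b)) * b))//.
      by rewrite !ler_pM ?mulr_ge0// ltW.
    have -> // : K * (e / 2 / (K * b)) * b = e / 2.
    by field; rewrite !gt_eqF.
  rewrite (le_lt_trans (bil_norm _ _ _))//.
  rewrite (@le_lt_trans _ _ (K * a * `|g x - g y|))//.
    by rewrite ler_wpM2r// ler_pM.
  by rewrite -ltr_pdivlMl ?mulr_gt0// mulrC.
move=> cf cg; have cf' := cnW cf; have cg' := cnW cg.
case: cf cg => [df [fd cdf]] [dg [gd cdg]].
exists (fun x => bil_left E B (df x) (g x) + bil_right E B (f x) (dg x)).
split=> [x Ux|]; first by apply: diff_bil; [exact: fd|exact: gd].
by apply: cn_add; exact: IH.
Qed.

(** By the chain rule the derivative is composition, a bounded bilinear map, applied to [dg \o f]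
    and [df]. The induction hypothesis is used for [dg \o f], whose values lie in another space. *)
Lemma cn_comp n E F G (U : set E) (V : set F) (f : E -> F) (g : F -> G) :
  (forall x, U x -> V (f x)) -> Cn n U f -> Cn n V g -> Cn n U (g \o f).
Proof.
move=> UV; elim: n G g => [|n IH] G g cf cg.
  move=> x Ux; apply: continuous_comp; first exact: cf.
  by apply: cg; exact: UV.
have cf' := cnW cf; case: cf cg => [df [fd cdf]] [dg [gd cdg]].
exists (fun x => postB E F G (dg (f x)) (df x)); split=> [x Ux|].
  by apply: diff_comp_bop; [exact: fd|apply: gd; exact: UV].
by apply: cn_bil => //; exact: (IH _ dg cf' cdg).
Qed.

Lemma cn_bop_comp n E F G (U : set E) (f : E -> F) (L : bop F G) :
  Cn n U f -> Cn n U (fun x => L (f x)).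
Proof. by move=> cf; apply: (@cn_comp n E F G U setT f L) => //; exact: cn_bop. Qed.

Lemma open_preimage E F (U : set E) (V : set F) (f : E -> F) :
  open U -> open V -> (forall x, U x -> {for x, continuous f}) ->
  open [set x | U x /\ V (f x)].
Proof.
move=> /open_eps oU /open_eps oV fc; apply/open_eps => x [Ux Vx].
have [d1 d10 h1] := oU x Ux; have [d2 d20 h2] := oV _ Vx.
move/cont_eps : (fc x Ux) => /(_ d2 d20)[d3 d30 h3].
exists (Num.min d1 d3) => [|y]; first by rewrite lt_min d10.
by rewrite lt_min => /andP[/h1 Uy /h3 /h2 Vy].
Qed.

Lemma smooth_comp E F G (U : set E) (V : set F) (f : E -> F) (g : F -> G) :
  smooth_on U f -> smooth_on V g ->
  smooth_on [set x | U x /\ V (f x)] (g \o f).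
Proof.
move=> [oU cf] [oV cg]; split.
  by apply: open_preimage => //; exact: (cn_cont (cf 0%N)).
move=> n; apply: (cn_comp (V := V)) => [x []//||//].
by apply: cn_sub (cf n) => x [].
Qed.

Lemma smooth_sub E F (U U' : set E) (f : E -> F) :
  open U' -> U' `<=` U -> smooth_on U f -> smooth_on U' f.
Proof. by move=> oU UU [_ cf]; split => // n; exact: cn_sub (cf n). Qed.

End continuously_differentiable.

(** * Smooth maps with values in a closed subspace *)

Section isometric_inclusion.
Context (R : realType).

Lemma isometry_closed_range (M : completeNormedModType R) (X : normedModType R)
    (i : bop M X) (y : X) : (forall v, `|i v| = `|v|) ->
  (forall e : R, 0 < e -> exists v, `|y - i v| <= e) -> exists v, y = i v.
Proof.
move=> iso hy.
have /choice[v hv] : forall n, exists v, `|y - i v| <= n.+1%:R^-1.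
  by move=> n; apply: hy; rewrite invr_gt0.
have h0 : (fun n : nat => n.+1%:R^-1) @ \oo --> (0 : R) by exact: cvg_harmonic.
have iv : (fun n => i (v n)) @ \oo --> y.
  by apply: (sub_cvg0 _ h0) => n; rewrite distrC.
have vc : cvgn v.
  apply: cauchy_cvg; apply/cauchy_ballP => e e0.
  have e2 : 0 < e / 2 by rewrite divr_gt0.
  move/cvgrPdist_lt : iv => /(_ _ e2) near_y.
  exists (v @` [set n | `|y - i (v n)| < e / 2], v @` [set n | `|y - i (v n)| < e / 2]) => /=.
    by split; apply: filterS near_y => n hn; exists n.
  move=> [_ _] /= [[n hn <-] [m hm <-]]; rewrite -ball_normE /= -iso bop_sub.
  rewrite -(subrK y (i (v n))) -addrA (le_lt_trans (ler_normD _ _))// distrC.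
  by rewrite [e]splitr ltrD.
exists (limn v); apply: (cvg_unique (@norm_hausdorff _ _) iv).
exact: (@cvg_bop _ _ _ i _ _ _ v).
Qed.

Lemma bop_inj_isometry (M X : normedModType R) (i : bop M X) :
  (forall v, `|i v| = `|v|) -> injective i.
Proof.
move=> iso u v uv; apply/eqP; rewrite -subr_eq0 -normr_eq0 -iso bop_sub uv.
by rewrite subrr normr0.
Qed.

Lemma bop_factor (E M X : normedModType R) (i : bop M X) (D : bop E X) :
  (forall v, `|i v| = `|v|) -> (forall h, exists v, D h = i v) ->
  exists d : bop E M, D = bcomp i d.
Proof.
move=> iso /choice[d hd]; have inj := bop_inj_isometry iso.
have dl : linear d.
  by move=> a x y; apply: inj; rewrite bop_add bop_scale -!hd bop_add bop_scale.
have db h : `|d h| <= `|D| * `|h| by rewrite -iso -hd le_bop_norm.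
exists (mkbop dl db).
by apply: bop_ext => h; exact: hd.
Qed.

(** Difference quotients of [f] lie in the range of [i], which is closed because [i] is isometric on
    a complete space; hence so do the values of the derivative. *)
Lemma diff_range (E X : normedModType R) (M : completeNormedModType R)
    (i : bop M X) (m : E -> M) (f : E -> X) (U : set E) x (D : bop E X) :
  (forall v, `|i v| = `|v|) -> open U -> U x -> (forall y, U y -> f y = i (m y)) ->
  is_diff x f D -> exists d : bop E M, D = bcomp i d /\ is_diff x m d.
Proof.
move=> iso /open_eps oU Ux fm fD; have /diff_eps fD' := fD.
have [r r0 hr] := oU x Ux.
have Dr h : exists v, D h = i v.
  apply: isometry_closed_range => // e e0.
  pose k := `|h| + 1; have k0 : 0 < k by rewrite ltr_wpDl.
  have [d d0 hd] := fD' (e / k) (divr_gt0 e0 k0).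
  pose s := Num.min r d / 2 / k.
  have m0 : 0 < Num.min r d by rewrite lt_min r0.
  have s0 : 0 < s by rewrite !divr_gt0.
  have sh : `|s *: h| < Num.min r d.
    rewrite normrZ gtr0_norm// /s mulrAC -mulrA.
    rewrite (@le_lt_trans _ _ (Num.min r d / 2))//.
      rewrite -[leRHS]mulr1 ler_pM2l ?divr_gt0//.
      by rewrite ler_pdivrMr// mul1r lerDl.
    by rewrite ltr_pdivrMr// ltr_pMr// ltr1n.
  move: sh; rewrite lt_min => /andP[sr sd].
  exists (s^-1 *: (m (x + s *: h) - m x)).
  rewrite bop_scale bop_sub -!fm//; last first.
    by apply: hr; rewrite opprD addrA subrr add0r normrN.
  have -> : D h - s^-1 *: (f (x + s *: h) - f x) =
     - (s^-1 *: (f (x + s *: h) - f x - D (s *: h))).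
    by rewrite bop_scale (scalerBr _ (f _ - f x)) scalerA mulVf ?gt_eqF// scale1r opprB.
  rewrite normrN normrZ gtr0_norm ?invr_gt0// ler_pdivrMl// (le_trans (hd _ sd))//.
  rewrite normrZ gtr0_norm// mulrCA; apply: ler_wpM2l; first exact: ltW.
  by rewrite mulrAC ler_pdivrMr// ler_pM2l// lerDl.
have [d dE] := bop_factor iso Dr; exists d; split => //.
apply/diff_eps => e e0; have [d1 d10 h1] := fD' e e0.
exists (Num.min d1 r) => [|h]; first by rewrite lt_min d10.
rewrite lt_min => /andP[/h1 k1 hr1]; move: k1.
rewrite !fm//; last by apply: hr; rewrite opprD addrA subrr add0r normrN.
by rewrite dE /= -!bop_sub iso.
Qed.

(** In the absence of a projection onto the range of [i], the map [m] is not a linear image of [f].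
    Instead the derivative of [f] factors through [i], and [postB i] is again an isometry, so the
    induction applies to the derivatives. *)
Lemma cn_factor n (E X : normedModType R) (M : completeNormedModType R)
    (i : bop M X) (m : E -> M) (f : E -> X) (U : set E) :
  (forall v, `|i v| = `|v|) -> open U -> (forall y, U y -> f y = i (m y)) ->
  Cn n U f -> Cn n U m.
Proof.
elim: n X M i m f => [|n IH] X M i m f iso oU fm.
  move=> fc x Ux; move/cont_eps: (fc x Ux) => h; apply/cont_eps => e /h[d d0 hd].
  move/open_eps: oU => /(_ x Ux)[r r0 hr].
  exists (Num.min d r) => [|y]; first by rewrite lt_min d0.
  by rewrite lt_min => /andP[/hd k /hr Uy]; rewrite -iso bop_sub -!fm.
move=> [df [fd cd]].
have /choice[dm hdm] : forall x, exists d : bop E M,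
    U x -> df x = bcomp i d /\ is_diff x m d.
  move=> x; have [Ux|nUx] := pselect (U x); last by exists 0.
  by have [d hd] := diff_range iso oU Ux fm (fd x Ux); exists d.
exists dm; split=> [x Ux|]; first by have [] := hdm x Ux.
apply: (IH _ _ (postB E M X i) dm df) => // [u|y Uy]; last by have [] := hdm y Uy.
apply/eqP; rewrite eq_le; apply/andP; split.
  by apply: bop_norm_le => // h; rewrite /= iso le_bop_norm.
by apply: bop_norm_le => // h; rewrite -iso; exact: (le_bop_norm (bcomp i u)).
Qed.

End isometric_inclusion.

(** * Smoothness of inversion, exponential and logarithm *)

Section prod_complete.
Context (R : realType) (E F : completeNormedModType R).
Let EF : normedModType R := (E * F)%type.

(** The derivative of the exponential will be read off from exponentials of operators on a product
    space, whose series converge by completeness. *)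
Lemma prod_cauchy_cvg (G : set_system EF) :
  ProperFilter G -> cauchy G -> cvg G.
Proof.
move=> GF /cauchy_ballP Gc.
have c1 : cvg (fst @ G).
  apply: cauchy_cvg; apply/cauchy_ballP => e e0.
  have [[A B] /= [GA GB] AB] := Gc e e0.
  exists (fst @` A, fst @` B) => /=.
    by split; [apply: filterS GA|apply: filterS GB] => z hz; exists z.
  by move=> [_ _] /= [[a Aa <-] [b Bb <-]]; have [] := AB (a, b) (conj Aa Bb).
have c2 : cvg (snd @ G).
  apply: cauchy_cvg; apply/cauchy_ballP => e e0.
  have [[A B] /= [GA GB] AB] := Gc e e0.
  exists (snd @` A, snd @` B) => /=.
    by split; [apply: filterS GA|apply: filterS GB] => z hz; exists z.
  by move=> [_ _] /= [[a Aa <-] [b Bb <-]]; have [] := AB (a, b) (conj Aa Bb).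
apply/cvg_ex; exists (lim (fst @ G), lim (snd @ G)).
apply/cvgrPdist_lt => e e0.
move/cvgrPdist_lt : c1 => /(_ e e0) h1; move/cvgrPdist_lt : c2 => /(_ e e0) h2.
apply: filterS2 h1 h2 => z z1 z2.
by rewrite prod_normE /= gt_max z1.
Qed.

HB.instance Definition _ :=
  Uniform_isComplete.Build (E * F)%type prod_cauchy_cvg.

End prod_complete.

Section projections.
Context (R : realType) (E F : normedModType R).

Lemma fst_bound (u : E * F) : `|u.1| <= 1 * `|u|.
Proof. by rewrite mul1r prod_normE le_max lexx. Qed.

Lemma snd_bound (u : E * F) : `|u.2| <= 1 * `|u|.
Proof. by rewrite mul1r prod_normE le_max lexx orbT. Qed.

Definition fstB : bop (E * F)%type E :=
  @mkbop R (E * F)%type E fst (fun a u v => erefl) 1 fst_bound.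

Definition sndB : bop (E * F)%type F :=
  @mkbop R (E * F)%type F snd (fun a u v => erefl) 1 snd_bound.

End projections.
Arguments fstB {R} E F.
Arguments sndB {R} E F.

(** * Kernels of bounded operators as Banach spaces *)

Section bounded_kernel.
Context (R : realType) (X : completeNormedModType R) (Z : normedModType R).
Variable L : bop X Z.

Definition is_bker : {pred X} := fun x => L x == 0.

Record bker := BKer { bker_val :> X ; bker_subproof : is_bker bker_val }.

HB.instance Definition _ := [isSub of bker for bker_val].
HB.instance Definition _ := [Choice of bker by <:].

Lemma is_bker_submod : submod_closed is_bker.
Proof.
split; first by rewrite unfold_in /is_bker bop_zero.
move=> a x y; rewrite !unfold_in /is_bker => /eqP x0 /eqP y0.
by rewrite bop_add bop_scale x0 y0 scaler0 addr0.
Qed.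

HB.instance Definition _ := GRing.isSubmodClosed.Build R X is_bker is_bker_submod.
HB.instance Definition _ := [SubChoice_isSubLmodule of bker by <:].

Definition bker_norm (x : bker) : R := `|bker_val x|.

Lemma bker_normD x y : bker_norm (x + y) <= bker_norm x + bker_norm y.
Proof. exact: ler_normD. Qed.

Lemma bker_normZ a x : bker_norm (a *: x) = `|a| * bker_norm x.
Proof. exact: normrZ. Qed.

Lemma bker_norm0_eq0 x : bker_norm x = 0 -> x = 0.
Proof. by move=> /normr0_eq0 x0; exact/val_inj. Qed.

HB.instance Definition _ := Lmodule_isNormed.Build R bker
  bker_normD bker_normZ bker_norm0_eq0.

Lemma bker_cauchy_cvg (G : set_system bker) : ProperFilter G -> cauchy G -> cvg G.
Proof.
move=> GF /cauchy_ballP Gc.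
have c : cvg (bker_val @ G).
  apply: cauchy_cvg; apply/cauchy_ballP => e e0.
  have [[A B] /= [GA GB] AB] := Gc e e0.
  exists (bker_val @` A, bker_val @` B) => /=.
    by split; [apply: filterS GA|apply: filterS GB] => z hz; exists z.
  move=> [_ _] /= [[a Aa <-] [b Bb <-]].
  by have := AB (a, b) (conj Aa Bb); rewrite -!ball_normE.
pose l := lim (bker_val @ G).
have cl : bker_val @ G --> l by [].
have l0 : is_bker l.
  apply/eqP; have h : (L \o bker_val) @ G --> L l by exact: cvg_bop.
  apply: (cvg_unique (@norm_hausdorff _ _) h).
  have -> : L \o bker_val = fun=> 0.
    by apply/funext => x /=; exact/eqP/(bker_subproof x).
  exact: cvg_cst.
apply/cvg_ex; exists (BKer l0); apply/cvgrPdist_lt => e e0.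
by move/cvgrPdist_lt : cl => /(_ e e0).
Qed.

HB.instance Definition _ := Uniform_isComplete.Build bker bker_cauchy_cvg.

Lemma bker_val_linear : linear bker_val.
Proof. by []. Qed.

Lemma bker_val_bound x : `|bker_val x| <= 1 * `|x|.
Proof. by rewrite mul1r. Qed.

Definition bker_incl : bop bker X := mkbop bker_val_linear bker_val_bound.

Lemma bker_incl_isometry v : `|bker_incl v| = `|v|.
Proof. by []. Qed.

Lemma range_bker_incl x : range bker_incl x <-> L x = 0.
Proof.
split=> [[v _ <-]|Lx]; first exact/eqP/(bker_subproof v).
have k : is_bker x by apply/eqP.
by exists (BKer k).
Qed.

End bounded_kernel.

(** * Smoothness of inversion *)

Section inversion.
Context (R : realType) (V : completeNormedModType R).
Implicit Types g h k a b : bop V V.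

Lemma op_invP g : GL V g -> op_inverse g (op_inv g).
Proof. by move=> [h gh]; rewrite /op_inv; exact: (xgetPex 0 (ex_intro _ h gh)). Qed.

Lemma GL_near g a k : op_inverse g a -> `|a| * `|k| < 1 -> GL V (g + k).
Proof.
move=> ga ak; have n1 : `|- (a * k)| < 1.
  by rewrite normrN (le_lt_trans (bopMnorm _ _)).
exists (geom (- (a * k)) * a).
have -> : g + k = g * (1 - - (a * k)) by rewrite opprK mulrDr mulr1 mulrA ga.1 mul1r.
exact: op_inverseM ga (geom_inv n1).
Qed.

Lemma GL_open : open (GL V).
Proof.
apply/open_eps => g [a ga]; have a1 : 0 < `|a| + 1 by rewrite ltr_wpDl.
exists (`|a| + 1)^-1 => [|y gy]; first by rewrite invr_gt0.
rewrite -(subrK g y) addrC; apply: (GL_near ga).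
rewrite distrC (@le_lt_trans _ _ ((`|a| + 1) * `|g - y|))//.
  by rewrite ler_wpM2r// lerDl.
by rewrite -ltr_pdivlMl// mulr1.
Qed.

Lemma op_inv_sub g a k b : op_inverse g a -> op_inverse (g + k) b ->
  b - a = - (b * k * a).
Proof.
move=> [ga ag] [hb bh].
have e1 : b + b * k * a = a.
  by rewrite -{2}[a]mul1r -bh mulrDr mulrDl -(mulrA b g) ga mulr1.
by rewrite -[in LHS]e1 opprD addrA subrr add0r.
Qed.

Lemma op_inv_near g a k b : op_inverse g a -> op_inverse (g + k) b ->
  `|a| * `|k| <= 2^-1 -> `|b| <= 2 * `|a|.
Proof.
move=> ga gb ak; have h : `|b| <= `|a| + `|b| * (`|a| * `|k|).
  have bE : b = a - b * k * a by rewrite -(op_inv_sub ga gb) addrC subrK.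
  rewrite {1}bE (le_trans (ler_normB _ _))// lerD2l -(mulrA b k).
  rewrite (le_trans (bopMnorm _ _))// ler_wpM2l// [leRHS]mulrC; exact: bopMnorm.
have := ler_wpM2l (normr_ge0 b) ak; lra.
Qed.

Definition dinv a : bop (bop V V) (bop V V) :=
  - bcomp (postB V V V a) (preB V V V a).

(** Using the resolvent identity [b - a = - b k a] twice, the error of the first-order expansion is
    [b k a k a]: it is quadratic in [k], because [b] stays within twice the norm of [a]. *)
Lemma op_inv_diff g : GL V g -> is_diff g (@op_inv R V) (dinv (op_inv g)).
Proof.
move=> Gg; have ga := op_invP Gg; set a := op_inv g in ga *.
apply/diff_eps => e e0.
pose K := `|a| + 1; have K0 : 0 < K by rewrite ltr_wpDl.
have aK : `|a| <= K by rewrite lerDl.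
pose d := Num.min (2^-1 / K) (e / (2 * K ^+ 3)).
exists d => [|k].
  by rewrite lt_min !divr_gt0// mulr_gt0// exprn_gt0.
rewrite lt_min => /andP[k1 k2].
have ak : `|a| * `|k| <= 2^-1.
  rewrite (@le_trans _ _ (K * `|k|)) ?ler_wpM2r//.
  by rewrite -ler_pdivlMl// mulrC ltW.
have gk : GL V (g + k).
  by apply: (GL_near ga); rewrite (le_lt_trans ak)// invf_lt1// ltr1n.
have gb := op_invP gk; set b := op_inv (g + k) in gb *.
have bK : `|b| <= 2 * K by rewrite (le_trans (op_inv_near ga gb ak))// ler_wpM2l.
have -> : b - a - dinv a k = b * k * a * (k * a).
  rewrite (op_inv_sub ga gb) /dinv bopN opprK.
  have -> : bcomp (postB V V V a) (preB V V V a) k = a * (k * a) by exact: bop_ext.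
  have {2}-> : a = b + b * k * a.
    by rewrite -[b * k * a]opprK -(op_inv_sub ga gb) opprB addrC subrK.
  by rewrite mulrDl (mulrA b k a) addrA addNr add0r.
have -> : b * k * a * (k * a) = b * (k * (a * (k * a))) by rewrite !mulrA.
have h1 : `|k * a| <= `|k| * K.
  by rewrite (le_trans (bopMnorm _ _))// ler_wpM2l.
have h2 : `|a * (k * a)| <= K * (`|k| * K).
  by rewrite (le_trans (bopMnorm _ _))// ler_pM.
have h3 : `|k * (a * (k * a))| <= `|k| * (K * (`|k| * K)).
  by rewrite (le_trans (bopMnorm _ _))// ler_wpM2l.
have h4 : `|b * (k * (a * (k * a)))| <= 2 * K * (`|k| * (K * (`|k| * K))).
  by rewrite (le_trans (bopMnorm _ _))// ler_pM.
rewrite (le_trans h4)//.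
have -> : 2 * K * (`|k| * (K * (`|k| * K))) = 2 * K ^+ 3 * `|k| * `|k| by ring.
rewrite ler_wpM2r// -ler_pdivlMl ?mulr_gt0 ?exprn_gt0// mulrC; exact: ltW.
Qed.

(** The derivative [k -> - a k a] at [a = g^-1] is bilinear in [a], hence as regular as inversion
    itself, and each order yields the next. *)
Lemma op_inv_cn n : Cn n (GL V) (@op_inv R V).
Proof.
elim: n => [|n IH].
  by move=> g Gg; exact: diff_cont (op_inv_diff Gg).
exists (fun g => dinv (op_inv g)); split; first exact: op_inv_diff.
have -> : (fun g => dinv (op_inv g)) = fun g =>
    (-1 : bop (bop (bop V V) (bop V V)) (bop (bop V V) (bop V V)))
      (postB _ _ _ (postB V V V (op_inv g)) (preB V V V (op_inv g))).
  apply/funext => g; rewrite bopN; congr (- _); exact: bop_ext.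
apply: cn_bop_comp; apply: (cn_bil (postB (bop V V) (bop V V) (bop V V))).
  exact: cn_bop_comp.
exact: cn_bop_comp.
Qed.

Lemma op_inv_smooth : smooth_on (GL V) (@op_inv R V).
Proof. by split; [exact: GL_open|exact: op_inv_cn]. Qed.

End inversion.

(** * Inverse functions *)

Section smooth_inverse.
Context (R : realType) (X : completeNormedModType R).

(** The Lipschitz bound turns the first-order error of [f] at [g y] into one of [g] at [y], so the
    derivative of [g] is [op_inv (df (g y))]. This is a composite of smooth maps with [g], which
    gains one order of regularity at each step. *)
Lemma cn_inverse (U D : set X) (f g : X -> X) (df : X -> bop X X) (C : R) :
  open D -> (forall y, D y -> U (g y)) -> (forall y, D y -> f (g y) = y) ->
  (forall y y', D y -> D y' -> `|g y - g y'| <= C * `|y - y'|) ->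
  (forall x, U x -> is_diff x f (df x)) -> (forall x, U x -> GL X (df x)) ->
  (forall n, Cn n U df) -> forall n, Cn n D g.
Proof.
move=> oD DU fg lip fd dG cdf; elim=> [|n IH].
  move=> y Dy; apply/cont_eps => e e0.
  have k0 : 0 < `|C| + 1 by rewrite ltr_wpDl.
  move/open_eps: oD => /(_ y Dy)[d d0 hd].
  exists (Num.min d (e / (`|C| + 1))) => [|z]; first by rewrite lt_min d0 divr_gt0.
  rewrite lt_min => /andP[/hd Dz yz]; rewrite (le_lt_trans (lip _ _ Dy Dz))//.
  rewrite (@le_lt_trans _ _ ((`|C| + 1) * `|y - z|))//.
    by rewrite ler_wpM2r// (le_trans (ler_norm C))// lerDl.
  by rewrite mulrC -ltr_pdivlMr.
exists (fun y => op_inv (df (g y))); split; last first.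
  apply: (cn_comp (V := GL X) (f := fun y => df (g y)) (g := @op_inv R X)) => //.
  - by move=> y /DU /dG.
  - exact: (cn_comp (V := U) (f := g) (g := df)).
  - exact: op_inv_cn.
move=> y Dy; set x := g y; have Ux : U x by exact: DU.
have [A1 A2] := op_invP (dG x Ux); set A := op_inv (df x) in A1 A2 *.
apply/diff_eps => e e0.
pose K := `|A| + 1; have K0 : 0 < K by rewrite ltr_wpDl.
pose c := `|C| + 1; have c0 : 0 < c by rewrite ltr_wpDl.
move: (fd x Ux) => /diff_eps/(_ (e / (K * c)) (divr_gt0 e0 (mulr_gt0 K0 c0)))[d1 d10 h1].
have fx : f x = y by exact: fg.
move/open_eps: oD => /(_ y Dy)[d2 d20 h2].
exists (Num.min d2 (d1 / c)) => [|k]; first by rewrite lt_min d20 divr_gt0.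
rewrite lt_min => /andP[k2 k1].
have Dk : D (y + k) by apply: h2; rewrite opprD addrA subrr add0r normrN.
have gk : `|g (y + k) - x| <= c * `|k|.
  rewrite (le_trans (lip _ _ Dk Dy))// addrC addKr ler_wpM2r//.
  by rewrite (le_trans (ler_norm C))// lerDl.
have := h1 (g (y + k) - x); rewrite (addrC x) subrK (fg _ Dk) fx [y + k - y]addrAC subrr add0r.
rewrite (le_lt_trans gk); last by rewrite mulrC -ltr_pdivlMr.
move=> /(_ isT) hk.
have -> : g (y + k) - x - A k = - A (k - df x (g (y + k) - x)).
  by rewrite -[in LHS](bop1 (g (y + k) - x)) -A2 bopM -bop_sub -bop_opp opprB.
rewrite normrN (le_trans (le_bop_norm _ _))//.
rewrite (@le_trans _ _ (K * (e / (K * c) * (c * `|k|))))//.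
  rewrite ler_pM// ?lerDl// (le_trans hk)// ler_wpM2l// ltW// divr_gt0//.
  exact: mulr_gt0.
have -> // : K * (e / (K * c) * (c * `|k|)) = e * `|k|.
by field; rewrite !gt_eqF.
Qed.

End smooth_inverse.

Section local_inverse.
Context (R : realType) (X : completeNormedModType R) (f : X -> X) (r : R).
Hypothesis fB : forall x y, `|x| < r -> `|y| < r ->
  `|f x - f y - (x - y)| <= 2^-1 * `|x - y|.

Definition local_inv (z : X) : X := xget 0 [set x | `|x| < r /\ f x = z].

Lemma local_expand x y : `|x| < r -> `|y| < r -> `|x - y| <= 2 * `|f x - f y|.
Proof.
move=> xr yr; have := fB xr yr.
have : `|x - y| <= `|f x - f y| + `|f x - f y - (x - y)|.
  rewrite -{1}(subKr (f x - f y) (x - y)); exact: ler_normB.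
lra.
Qed.

Lemma local_invP z : [set f x | x in [set x | `|x| < r]] z ->
  `|local_inv z| < r /\ f (local_inv z) = z.
Proof.
move=> [x xr <-].
exact: (@xgetPex _ 0 [set y | `|y| < r /\ f y = f x] (ex_intro _ x (conj xr erefl))).
Qed.

Lemma local_invK x : `|x| < r -> local_inv (f x) = x.
Proof.
move=> xr; have fx : [set f x | x in [set x | `|x| < r]] (f x) by exists x.
have [h1 h2] := local_invP fx.
apply/eqP; rewrite -subr_eq0 -normr_le0 (le_trans (local_expand h1 xr))//.
by rewrite h2 subrr normr0 mulr0.
Qed.

Lemma zmod_sub4 (Z : zmodType) (a b c d : Z) : (a - c) - (b - d) = (a - b) - (c - d).
Proof. by rewrite !opprD !opprK addrACA. Qed.

(** Banach's fixed point argument: for [z] near [f x0], the map [x - (f x - z)] is a contraction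
    with ratio 1/2 of a closed ball around [x0], and its fixed point is a preimage of [z]. *)
Lemma local_image_open : open [set f x | x in [set x | `|x| < r]].
Proof.
apply/open_eps => _ [x0 /= x0r <-].
(* The closed ball of radius [e] stays inside the open ball of radius [r]; moving [z] by at most
   [e / 2] leaves the other [e / 2] for the contraction. *)
pose e := (r - `|x0|) / 2; have e0 : 0 < e by rewrite divr_gt0// subr_gt0.
exists (e / 2) => [|z hz]; first by rewrite divr_gt0.
pose F x := x - (f x - z).
have in_r x : `|x0 - x| <= e -> `|x| < r.
  move=> xe; have := lerB_dist x x0; rewrite distrC => h.
  have e1 : e = (r - `|x0|) / 2 by []. 
  by move: xe h x0r; rewrite e1; lra.
pose U := [set x | `|x0 - x| <= e].
have x0e : `|x0 - x0| <= e by rewrite subrr normr0 ltW.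
have FU : forall x, U x -> U (F x).
  move=> x Ux; rewrite /U /=.
  have -> : x0 - F x = (f x - f x0 - (x - x0)) + (f x0 - z).
    rewrite /F opprB [- (x - x0)]opprB [RHS]addrAC (addrA (f x - f x0)) subrK.
    by rewrite addrCA.
  rewrite (le_trans (ler_normD _ _))// [e]splitr lerD// ?(ltW hz)//.
  rewrite (le_trans (fB (in_r _ Ux) x0r))// mulrC ler_wpM2r// distrC; exact: Ux.
have FC x y : U x -> U y -> `|F x - F y| <= 2^-1 * `|x - y|.
  move=> /in_r xr /in_r yr.
  have -> : F x - F y = (x - y) - (f x - f y).
    by rewrite /F zmod_sub4 (zmod_sub4 (f x)) subrr subr0.
  by rewrite distrC; exact: fB.
pose u n := iter n F x0.
have Uu n : U (u n) by elim: n => [//|n IH]; exact: FU.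
have du n : `|u n.+1 - u n| <= e * 2^-1 ^+ n.
  elim: n => [|n IH].
    rewrite expr0 mulr1 /u /= distrC; exact: (FU x0 x0e).
  rewrite (le_trans (FC _ _ (Uu n.+1) (Uu n)))// exprS mulrCA ler_wpM2l//.
have su : cvgn (series (fun n => u n.+1 - u n)).
  apply: (normed_series_cvg du (M := e * 2)) => n.
  rewrite -mulr_sumr; apply: ler_wpM2l; first exact: ltW.
  apply: (le_trans (geom_sum_le n _ _)) => //.
  - by rewrite invf_lt1// ltr1n.
  - by have -> : (1 - 2^-1 : R)^-1 = 2 by field.
have cu : cvgn u.
  have -> : u = fun n => x0 + series (fun n => u n.+1 - u n) n.
    apply/funext => n; rewrite /series /= telescope_sumr// addrC subrK//.
  by apply: is_cvgD; first exact: is_cvg_cst.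
have ul : u @ \oo --> limn u by [].
have Ul : U (limn u).
  have h : (fun n => x0 - u n) @ \oo --> x0 - limn u.
    by apply: cvgB => //; exact: cvg_cst.
  exact: (cvg_norm_le h).
exists (limn u); first exact: in_r.
have h1 : (fun n => f (u n)) @ \oo --> f (limn u).
  have h : (fun n => 2 * `|u n - limn u|) @ \oo --> (0 : R).
    rewrite -[0 in X in _ --> X](mulr0 2); apply: cvgMr.
    have <- : `|limn u - limn u| = 0 by rewrite subrr normr0.
    by apply: cvg_norm; apply: cvgB => //; exact: cvg_cst.
  apply: (sub_cvg0 _ h) => n.
  have := fB (in_r _ (Uu n)) (in_r _ Ul).
  have := ler_normD (f (u n) - f (limn u) - (u n - limn u)) (u n - limn u).
  rewrite subrK; have := normr_ge0 (u n - limn u); lra.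
have h2 : (fun n => f (u n)) @ \oo --> z.
  apply: (sub_cvg0 (v := fun n => e * 2^-1 ^+ n)) => [n|].
    have -> : f (u n) - z = - (u n.+1 - u n).
      by rewrite /u /= -/(u n) /F opprB subKr.
    by rewrite normrN.
  rewrite -[0 in X in _ --> X](mulr0 e); apply: cvgMr; apply: cvg_expr.
  by rewrite ger0_norm// invf_lt1// ltr1n.
exact: (cvg_unique (@norm_hausdorff _ _) h1 h2).
Qed.

Lemma local_inv_lip z z' : [set f x | x in [set x | `|x| < r]] z ->
  [set f x | x in [set x | `|x| < r]] z' ->
  `|local_inv z - local_inv z'| <= 2 * `|z - z'|.
Proof.
move=> /local_invP[z1 z2] /local_invP[z1' z2'].
by rewrite -{2}z2 -{2}z2'; exact: local_expand.
Qed.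

(** For small [h], [D h] differs from [h] by at most [1/2 + 1/4] of the norm of [h]: the first share
    is [fB], the second the error of differentiation. Homogeneity extends this to all [h], and the
    Neumann series inverts [D]. *)
Lemma local_diff_GL x (D : bop X X) : `|x| < r -> is_diff x f D -> GL X D.
Proof.
move=> xr /diff_eps fD; have [d d0 hd] := fD 4^-1 (ltac:(by rewrite invr_gt0)).
have small h : `|h| < Num.min d (r - `|x|) -> `|D h - h| <= 3 / 4 * `|h|.
  rewrite lt_min => /andP[/hd h1 h2].
  have h3 : `|x + h| < r by rewrite (le_lt_trans (ler_normD _ _))// -ltrBrDl.
  have := fB h3 xr; rewrite (addrC x h) addrK => h4.
  have -> : D h - h = (f (h + x) - f x - h) - (f (h + x) - f x - D h).
    by rewrite opprB [RHS]addrC [RHS]addrA subrK.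
  rewrite (addrC x) in h1; rewrite (le_trans (ler_normB _ _))//.
  by rewrite (le_trans (lerD h4 h1))//; lra.
have m0 : 0 < Num.min d (r - `|x|) by rewrite lt_min d0 subr_gt0.
have K : `|1 - D| <= 3 / 4.
  apply: bop_norm_le => // h.
  pose s := Num.min d (r - `|x|) / 2 / (`|h| + 1).
  have k0 : 0 < `|h| + 1 by rewrite ltr_wpDl.
  have s0 : 0 < s by rewrite !divr_gt0.
  have sh : `|s *: h| < Num.min d (r - `|x|).
    rewrite normrZ gtr0_norm// /s mulrAC -mulrA.
    rewrite (@le_lt_trans _ _ (Num.min d (r - `|x|) / 2))//.
      rewrite -[leRHS]mulr1 ler_pM2l ?divr_gt0//.
      by rewrite ler_pdivrMr// mul1r lerDl.
    by rewrite ltr_pdivrMr// ltr_pMr// ltr1n.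
  move: (small _ sh); clear sh; clearbody s.
  rewrite bop_scale -scalerBr !normrZ gtr0_norm// mulrCA ler_pM2l//.
  by have -> : (1 - D) h = - (D h - h); rewrite ?normrN// bopD bopN bop1 opprB.
have K1 : `|1 - D| < 1 by rewrite (le_lt_trans K)//; lra.
by exists (geom (1 - D)); have := geom_inv K1; rewrite subKr.
Qed.

End local_inverse.

(** * Smoothness of the exponential and of its local inverse *)

Section exp_smooth.
Context (R : realType).

Section blocks.
Context (W : completeNormedModType R).
Let A := bop W W.
Let P := (A * A)%type.

Lemma inl_bound (x : A) : `|((x, 0) : P)| <= 1 * `|x|.
Proof. by rewrite mul1r prod_normE /= normr0 max_l. Qed.

Lemma inr_bound (x : A) : `|((0, x) : P)| <= 1 * `|x|.
Proof. by rewrite mul1r prod_normE /= normr0 max_r. Qed.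

Lemma inl_linear : linear (fun x : A => (x, 0) : P).
Proof. by move=> a x y; apply/pair_equal_spec; split; rewrite /= ?scaler0 ?addr0. Qed.

Lemma inr_linear : linear (fun x : A => (0, x) : P).
Proof. by move=> a x y; apply/pair_equal_spec; split; rewrite /= ?scaler0 ?addr0. Qed.

Definition block_inl : bop A P := mkbop inl_linear inl_bound.
Definition block_inr : bop A P := mkbop inr_linear inr_bound.

(* The operator matrix [[L_X, 1], [0, R_Y]] on [A * A] *)
Definition block (X Y : A) : bop P P :=
  bcomp block_inl (sndB A A) +
  (bcomp block_inl (bcomp (postB W W W X) (fstB A A)) +
   bcomp block_inr (bcomp (preB W W W Y) (sndB A A))).

Lemma blockE X Y (u : P) : block X Y u = (X * u.1 + u.2, u.2 * Y).
Proof.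
rewrite /block !bopD /=; apply/pair_equal_spec; split=> /=.
  by rewrite addr0 addrC; congr (_ + _); exact: bop_ext.
by rewrite !add0r; exact: bop_ext.
Qed.

Definition corner : bop (bop P P) (bop A A) :=
  bcomp (preB _ _ _ block_inr) (postB _ _ _ (fstB A A)).

(** Powers of the block matrix send [(0, X - Y)] to a pair with first entry [X ^ n - Y ^ n]. The
    corner of its exponential is thus a divided difference of the exponential, and at [X = Y] it is
    the derivative. *)
Lemma block_exp_corner X Y :
  corner (op_exp (block X Y)) (X - Y) = op_exp X - op_exp Y.
Proof.
have pw n : (block X Y ^+ n) (0, X - Y) = (X ^+ n - Y ^+ n, (X - Y) * Y ^+ n) :> P.
  elim: n => [|n IH]; first by rewrite !expr0 subrr mulr1.
  rewrite exprS bopM IH blockE /= -mulrA -exprSr; congr pair.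
  by rewrite mulrBr mulrBl -!exprS addrA subrK.
have h1 : (evB A A (X - Y) \o (corner \o series (eterm (block X Y)))) @ \oo -->
    evB A A (X - Y) (corner (op_exp (block X Y))).
  by apply: cvg_bop; apply: cvg_bop; exact: cvg_exp.
apply: (cvg_unique (@norm_hausdorff _ _) h1).
have -> : evB A A (X - Y) \o (corner \o series (eterm (block X Y))) =
    fun n => series (eterm X) n - series (eterm Y) n.
  apply/funext => n /=; rewrite /series /= -sumrB.
  elim: n => [|n IH]; first by rewrite !big_nil.
  by rewrite big_nat_recr// bopD [RHS]big_nat_recr// -IH /eterm bopZ pw -scalerBr.
by apply: cvgB; exact: cvg_exp.
Qed.

Definition block_lin : bop A (bop P P) :=
  bcomp (postB _ _ _ block_inl) (bcomp (preB _ _ _ (fstB A A)) (postB W W W)) +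
  bcomp (postB _ _ _ block_inr) (bcomp (preB _ _ _ (sndB A A)) (preB W W W)).

Definition dexp (X : A) : bop A A := corner (op_exp (block X X)).

End blocks.

(** The increment is exactly the corner of [op_exp (block (X + h) X)] applied to [h], so
    differentiability reduces to continuity of the exponential on the larger space. *)
Lemma exp_diff (W : completeNormedModType R) (X : bop W W) :
  is_diff X (@op_exp R W) (dexp X).
Proof.
apply/diff_eps => e e0.
pose L := bcomp (postB _ _ _ (block_inl W)) (bcomp (preB _ _ _ (fstB (bop W W) (bop W W))) (postB W W W)).
have blockD h : block (X + h) X = block X X + L h.
  apply: bop_ext => u; rewrite bopD !blockE /=; apply/pair_equal_spec; split => /=.
    by rewrite mulrDl addrAC; congr (_ + _); exact: bop_ext.
  by rewrite addr0.
have c : {for 0, continuous (fun h => corner W (op_exp (block X X + L h)))}.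
  apply: (@continuous_comp _ _ _ (fun h => block X X + L h) (fun T => corner W (op_exp T))).
    exact: diff_cont (diff_affine _ _ _).
  apply: continuous_comp; first exact: exp_continuous.
  exact: bop_continuous.
move/cont_eps: c => /(_ e e0)[d d0 hd]; exists d => // h hh.
have := hd h; rewrite sub0r normrN => /(_ hh); rewrite bop_zero addr0 => k.
have -> : op_exp (X + h) - op_exp X = corner W (op_exp (block (X + h) X)) h.
  by rewrite -block_exp_corner (addrC X) addrK.
rewrite blockD; move: k; rewrite -/(dexp X).
move: (dexp X) (corner W (op_exp (block X X + L h))) => T0 T1 k.
have -> : T1 h - T0 h = (T1 - T0) h by rewrite bopD bopN.
by rewrite (le_trans (le_bop_norm _ _))// ler_wpM2r// distrC ltW.
Qed.

(* The derivative of the exponential of [bop W W] is a corner of an exponential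
   over a larger space, so the induction on [n] runs over all spaces at once. *)
Lemma exp_cn n (W : completeNormedModType R) : Cn n setT (@op_exp R W).
Proof.
elim: n W => [|n IH] W; first by move=> X _; exact: exp_continuous.
exists (@dexp W); split=> [X _|]; first exact: exp_diff.
apply: (@cn_bop_comp _ _ _ _ _ _ _ (corner W)).
apply: (cn_comp (V := setT) (f := fun X => block X X)) => //.
  exact: (@cn_affine R n _ _ setT (bcomp (block_inl W) (sndB (bop W W) (bop W W))) (block_lin W)).
exact: IH.
Qed.

Lemma dexp_cn n (W : completeNormedModType R) (U : set (bop W W)) :
  Cn n U (@dexp W).
Proof.
apply: (cn_sub (U := setT)) => //.
apply: (@cn_bop_comp _ _ _ _ _ _ _ (corner W)).
apply: (cn_comp (V := setT) (f := fun X => block X X)) => //.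
  exact: (@cn_affine R n _ _ setT (bcomp (block_inl W) (sndB (bop W W) (bop W W))) (block_lin W)).
exact: exp_cn.
Qed.

Lemma exp_smooth (W : completeNormedModType R) : smooth_on setT (@op_exp R W).
Proof. by split; [exact: openT|move=> n; exact: exp_cn]. Qed.

Context (V : completeNormedModType R).

(** The radius 1/4 comes from [expR r - 1 <= 2 r]: it makes [op_exp] minus the identity Lipschitz
    with constant 1/2, as the local inverse requires. *)
Definition small_ball : set (bop V V) := [set X | `|X| < 4^-1].

Definition op_log : bop V V -> bop V V := local_inv (@op_exp R V) 4^-1.

Lemma exp_near_id (X Y : bop V V) : `|X| < 4^-1 -> `|Y| < 4^-1 ->
  `|op_exp X - op_exp Y - (X - Y)| <= 2^-1 * `|X - Y|.
Proof.
move=> X1 Y1; rewrite (le_trans (expB_le (ltW X1) (ltW Y1)))// ler_wpM2r//.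
rewrite (le_trans (@expR_sub1_le R 4^-1 _ _))//; lra.
Qed.

Definition exp_ball : set (bop V V) := [set op_exp X | X in small_ball].

Lemma op_logK X : small_ball X -> op_log (op_exp X) = X.
Proof. exact: (local_invK exp_near_id). Qed.

Lemma op_logP Z : exp_ball Z -> small_ball (op_log Z) /\ op_exp (op_log Z) = Z.
Proof. exact: local_invP. Qed.

Lemma op_log_smooth : smooth_on exp_ball op_log.
Proof.
have oB : open exp_ball by exact: local_image_open exp_near_id.
split=> //; apply: (cn_inverse (U := small_ball) (f := @op_exp R V)
    (df := @dexp V) (C := 2)) => //.
- by move=> y /op_logP[].
- by move=> y /op_logP[].
- by move=> y y'; exact: (local_inv_lip exp_near_id).
- by move=> X _; exact: exp_diff.
- by move=> X Xb; exact: (local_diff_GL exp_near_id Xb (exp_diff X)).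
- by move=> n; exact: dexp_cn.
Qed.

End exp_smooth.

(** * The structure group and its Lie algebra *)

(* The Banach space of bounded bilinear maps [V * V -> bop V V], known only
   through the evaluations [bm_ev x y] and the four actions of [bop V V] on it:
   hiding [bop V (bop V (bop V V))] keeps conversion problems small. *)
Record bilinear_model (R : realType) (V : completeNormedModType R) := BilinearModel {
  bm_space :> completeNormedModType R ;
  bm_ev : V -> V -> bop bm_space (bop V V) ;
  bm_left : bop (bop V V) (bop bm_space bm_space) ;
  bm_right : bop (bop V V) (bop bm_space bm_space) ;
  bm_arg1 : bop (bop V V) (bop bm_space bm_space) ;
  bm_arg2 : bop (bop V V) (bop bm_space bm_space) ;
  bm_ext : forall b c : bm_space, (forall x y, bm_ev x y b = bm_ev x y c) -> b = c ;
  bm_addl : forall x x' y b, bm_ev (x + x') y b = bm_ev x y b + bm_ev x' y b ;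
  bm_addr : forall x y y' b, bm_ev x (y + y') b = bm_ev x y b + bm_ev x y' b ;
  bm_leftE : forall S b x y, bm_ev x y (bm_left S b) = S * bm_ev x y b ;
  bm_rightE : forall S b x y, bm_ev x y (bm_right S b) = bm_ev x y b * S ;
  bm_arg1E : forall S b x y, bm_ev x y (bm_arg1 S b) = bm_ev (S x) y b ;
  bm_arg2E : forall S b x y, bm_ev x y (bm_arg2 S b) = bm_ev x (S y) b ;
  bm_left_norm : forall S, `|bm_left S| <= `|S| ;
  bm_arg1_norm : forall S, `|bm_arg1 S| <= `|S| ;
  bm_arg2_norm : forall S, `|bm_arg2 S| <= `|S| }.

Lemma bilinear_model_exists (R : realType) (V : completeNormedModType R) :
  exists M : bilinear_model V, forall u : bop V (bop V (bop V V)),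
    exists b : M, forall x y, bm_ev M x y b = u x y.
Proof.
pose A := bop V V.
pose W : completeNormedModType R := bop V (bop V (bop V V)).
pose lmB : bop A (bop W W) :=
  bcomp (postB V (bop V A) (bop V A)) (bcomp (postB V A A) (postB V V V)).
pose rmB : bop A (bop W W) :=
  bcomp (postB V (bop V A) (bop V A)) (bcomp (postB V A A) (preB V V V)).
pose arg1B : bop A (bop W W) := preB V V (bop V A).
pose arg2B : bop A (bop W W) :=
  bcomp (postB V (bop V A) (bop V A)) (preB V V A).
pose ev x y : bop W A := bcomp (evB V A y) (evB V (bop V A) x).
unshelve eexists (@BilinearModel R V W ev lmB rmB arg1B arg2B _ _ _ _ _ _ _ _ _ _).
- by move=> b c bc; apply: bop_ext => x; apply: bop_ext => y; exact: bc.
- by move=> x x' y b; exact: (congr1 (fun u : bop V A => u y) (bop_add b x x')).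
- by move=> x y y' b; exact: (bop_add (b x) y y').
- by move=> S b x y; exact: bop_ext.
- by move=> S b x y; exact: bop_ext.
- by [].
- by [].
- move=> S; rewrite /lmB /=.
  exact: le_trans (postB_norm _ _) (le_trans (postB_norm _ _) (postB_norm _ _)).
- by move=> S; exact: preB_norm.
- by move=> S; exact: le_trans (postB_norm _ _) (preB_norm _ _).
- by move=> u; exists u.
Qed.

Lemma scaler2 (R : realType) (E : lmodType R) (p : E) : (2 : R) *: p = p + p.
Proof. by rewrite (scaler_nat 2) mulr2n. Qed.

Lemma double_inj (R : realType) (E : lmodType R) (p q : E) : p + p = q + q -> p = q.
Proof.
rewrite -!(@scaler2 R) => /(congr1 (fun z => (2^-1 : R) *: z)).
by rewrite !scalerA mulVf ?pnatr_eq0// !scale1r.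
Qed.

Lemma exp_morph_mul (R : realType) (V W : completeNormedModType R)
    (p : bop (bop V V) (bop W W)) : p 1 = 1 ->
  (forall S T, p (S * T) = p S * p T) -> forall S, p (op_exp S) = op_exp (p S).
Proof.
move=> p1 pM S; apply: exp_morph; elim=> [|n IH]; first by rewrite !expr0.
by rewrite !exprS -IH pM.
Qed.

Lemma exp_morph_antimul (R : realType) (V W : completeNormedModType R)
    (p : bop (bop V V) (bop W W)) : p 1 = 1 ->
  (forall S T, p (S * T) = p T * p S) -> forall S, p (op_exp S) = op_exp (p S).
Proof.
move=> p1 pM S; apply: exp_morph; elim=> [|n IH]; first by rewrite !expr0.
by rewrite exprSr exprS -IH pM.
Qed.

Lemma exp_fix (R : realType) (W : completeNormedModType R) (P : bop W W) (b : W) :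
  P b = 0 -> op_exp P b = b.
Proof.
move=> Pb; have E n : (\sum_(0 <= k < n.+1) eterm P k) b = b.
  elim: n => [|n IH]; first by rewrite big_nat1 eterm0.
  by rewrite big_nat_recr// bopD IH /eterm bopZ exprSr bopM Pb bop_zero scaler0 addr0.
have h : (evB W W b \o series (eterm P)) @ \oo --> evB W W b (op_exp P).
  by apply: cvg_bop; exact: cvg_exp.
rewrite -(cvg_shiftS) in h; apply: (cvg_unique (@norm_hausdorff _ _) h).
have -> : (fun n => (evB W W b \o series (eterm P)) n.+1) = fun=> b.
  by apply/funext => n; exact: E.
exact: cvg_cst.
Qed.

(** This is the closed algebra to which [csub_log] is applied, with a [P] whose kernel is the space
    [N]. *)
Lemma csub_stabilizer (R : realType) (W : completeNormedModType R) (P : bop W W) :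
  closed_subalgebra [set T : bop W W | forall b, P b = 0 -> P (T b) = 0].
Proof.
split=> /=.
- by [].
- move=> S T hS hT b b0; rewrite -[X in P X]/(S b + T b).
  by rewrite bop_add hS// hT// addr0.
- move=> a T hT b b0; rewrite -[X in P X]/(a *: T b).
  by rewrite bop_scale hT// scaler0.
- by move=> S T hS hT b b0; apply: hS; exact: hT.
move=> u T hu uT b b0.
have h : (P \o (evB W W b \o u)) @ \oo --> P (evB W W b T).
  by apply: cvg_bop; apply: cvg_bop.
apply: (cvg_unique (@norm_hausdorff _ _) h).
have -> : P \o (evB W W b \o u) = fun=> 0.
  by apply/funext => n /=; exact: hu.
exact: cvg_cst.
Qed.

(** * The action of bounded operators on bilinear maps *)

Section operators_on_bilinear_maps.
Context (R : realType) (V : completeNormedModType R) (M : bilinear_model V).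
Implicit Types (S T H : bop V V) (b : M).

Lemma bm_op_ext (P Q : bop M M) :
  (forall b x y, bm_ev M x y (P b) = bm_ev M x y (Q b)) -> P = Q.
Proof. by move=> PQ; apply: bop_ext => b; apply: bm_ext. Qed.

Lemma bm_left_exp S : bm_left M (op_exp S) = op_exp (bm_left M S).
Proof.
apply: exp_morph_mul => [|S' T]; apply: bm_op_ext => b x y.
  by rewrite bm_leftE mul1r.
by rewrite bopM !bm_leftE mulrA.
Qed.

Lemma bm_right_exp S : bm_right M (op_exp S) = op_exp (bm_right M S).
Proof.
apply: exp_morph_antimul => [|S' T]; apply: bm_op_ext => b x y.
  by rewrite bm_rightE mulr1.
by rewrite bopM !bm_rightE mulrA.
Qed.

Lemma bm_arg1_exp S : bm_arg1 M (op_exp S) = op_exp (bm_arg1 M S).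
Proof.
apply: exp_morph_antimul => [|S' T]; apply: bm_op_ext => b x y.
  by rewrite bm_arg1E.
by rewrite bopM !bm_arg1E.
Qed.

Lemma bm_arg2_exp S : bm_arg2 M (op_exp S) = op_exp (bm_arg2 M S).
Proof.
apply: exp_morph_antimul => [|S' T]; apply: bm_op_ext => b x y.
  by rewrite bm_arg2E.
by rewrite bopM !bm_arg2E.
Qed.

Definition actB : bop (bop V V) (bop M M) := bm_arg1 M + bm_arg2 M - bm_left M.

Lemma actBE H b x y : bm_ev M x y (actB H b) =
  bm_ev M (H x) y b + bm_ev M x (H y) b - H * bm_ev M x y b.
Proof.
by rewrite /actB !(bopD, bopN) bop_sub bop_add bm_arg1E bm_arg2E bm_leftE.
Qed.

Lemma actB_norm H : `|actB H| <= 3 * `|H|.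
Proof.
have -> : 3 * `|H| = `|H| + `|H| + `|H| by ring.
rewrite /actB !(bopD, bopN) (le_trans (ler_normB _ _))// lerD ?bm_left_norm//.
by rewrite (le_trans (ler_normD _ _))// lerD ?bm_arg1_norm ?bm_arg2_norm.
Qed.

(** The three summands of [actB H] act on different slots of a bilinear map, hence commute, and the
    exponential factors. *)
Lemma actB_exp H b x y : bm_ev M x y (op_exp (actB H) b) =
  op_exp (- H) * bm_ev M (op_exp H x) (op_exp H y) b.
Proof.
have c12 : GRing.comm (bm_arg1 M H) (bm_arg2 M H).
  by apply: bm_op_ext => c u v; rewrite !bopM !(bm_arg1E, bm_arg2E).
have c3 : GRing.comm (bm_arg1 M H + bm_arg2 M H) (bm_left M (- H)).
  apply/commr_sym/commrD; apply: bm_op_ext => c u v.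
    by rewrite !bopM !(bm_leftE, bm_arg1E).
  by rewrite !bopM !(bm_leftE, bm_arg2E).
have -> : actB H = bm_arg1 M H + bm_arg2 M H + bm_left M (- H) by rewrite bop_opp.
rewrite expD// expD// -bm_arg1_exp -bm_arg2_exp -bm_left_exp !bopM.
by rewrite bm_arg1E bm_arg2E bm_leftE.
Qed.

(** [Str] and [str] constrain only the diagonal [U_x]; by symmetry this is enough to control
    [U_{x,y}], on which the linear action is available. *)
Lemma polarization b c :
  (forall x y, bm_ev M x y b = bm_ev M y x b) ->
  (forall x y, bm_ev M x y c = bm_ev M y x c) ->
  (forall x, bm_ev M x x b = bm_ev M x x c) -> b = c.
Proof.
move=> bs cs bc; apply: bm_ext => x y.
have := bc (x + y); rewrite !(bm_addl, bm_addr) !bc (bs y x) (cs y x).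
rewrite -!addrA => /addrI; rewrite !addrA => /addIr.
exact: double_inj.
Qed.

End operators_on_bilinear_maps.

(** * The U-operators of a unital algebra and their symmetries *)

Section structure_group_of_unital_algebra.
Context (R : realType) (V : completeNormedModType R).
Context (jmul : V -> V -> V) (e : V).
Hypothesis jlin : forall x, linear (jmul x).
Hypothesis jcomm : commutative jmul.
Hypothesis junit : left_id e jmul.
Hypothesis jnorm : forall x y, `|jmul x y| <= `|x| * `|y|.
Let A := bop V V.
Implicit Types (g h k H : bop V V).

Lemma jmul_linl y : linear (jmul^~ y).
Proof. by move=> a x z /=; rewrite !(jcomm _ y); exact: jlin. Qed.

Lemma jmul_bound x y : `|jmul x y| <= 1 * `|x| * `|y|.
Proof. by rewrite mul1r. Qed.

Definition LB : bop V A := mkbil jmul_linl jlin jmul_bound.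

Definition UB_curried : bop V (bop V A) :=
  bcomp (preB V A A LB) (bcomp (postB V V V) LB) +
  bcomp (preB V A A LB) (bcomp (preB V V V) LB) -
  bcomp (postB V V A LB) LB.

Lemma UB_curriedE x y :
  UB_curried x y = LB x * LB y + LB y * LB x - LB (jmul x y).
Proof. exact: bop_ext. Qed.

Context (M : bilinear_model V) (UB : M).
Hypothesis UB_spec : forall x y, bm_ev M x y UB = UB_curried x y.
Notation U x y := (bm_ev M x y UB).

Lemma UBE x y : U x y = LB x * LB y + LB y * LB x - LB (jmul x y).
Proof. by rewrite UB_spec UB_curriedE. Qed.

Lemma UB_sym x y : U x y = U y x.
Proof. by rewrite !UBE (jcomm x) (addrC (LB x * _)). Qed.

Lemma UB_unit : U e e = 1.
Proof.
have e1 : LB e = 1 by apply: bop_ext => x; exact: junit.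
by rewrite UBE junit e1 mulr1 addrK.
Qed.

Lemma Uop_UB x : Uop jmul x = U x x.
Proof.
apply/funext => z; rewrite UBE /Uop /Lop bopD bopN !fctE /=.
by rewrite scaler2.
Qed.

Lemma Uop2_UB x y : Uop2 jmul x y = U x y.
Proof.
have h : U (x + y) (x + y) - U x x - U y y = (2 : R) *: U x y.
  rewrite !(bm_addl, bm_addr) (UB_sym y x) -addrA -opprD scaler2.
  rewrite addrACA opprD addrACA [X in X + _ = _]addrAC subrr add0r.
  by rewrite addrK.
rewrite /Uop2 !Uop_UB.
have -> : (U (x + y) (x + y) : V -> V) - U x x - U y y =
    ((U (x + y) (x + y) - U x x - U y y : A) : V -> V) by [].
rewrite h; apply/funext => z; rewrite !fctE bopZ scalerA mulVf ?scale1r//.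
Qed.

(** A bounded operator whose kernel is the space [N]: it compares [b] with the only candidate
    [U_{x,y} b(e, e)]. *)
Definition defectB : bop M M := 1 - bcomp (evB M M UB) (bcomp (bm_right M) (bm_ev M e e)).

Lemma defectBE b x y :
  bm_ev M x y (defectB b) = bm_ev M x y b - U x y * bm_ev M e e b.
Proof. by rewrite /defectB bopD bopN bop_sub bop1 2!bcompE evBE bm_rightE. Qed.

Lemma defectB0 b : defectB b = 0 <->
  forall x y, bm_ev M x y b = U x y * bm_ev M e e b.
Proof.
split=> [h x y|h]; first by apply/eqP; rewrite -subr_eq0 -defectBE h bop_zero.
by apply: bm_ext => x y; rewrite defectBE -h subrr bop_zero.
Qed.

Definition strB : bop A M := bcomp defectB (bcomp (evB M M UB) (actB M)).

Lemma strBE H : strB H = defectB (actB M H UB).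
Proof. by rewrite /strB 2!bcompE evBE. Qed.

Lemma actB_UB_diag H x :
  bm_ev M x x (actB M H UB) = (2 : R) *: U x (H x) - H * U x x.
Proof. by rewrite actBE (UB_sym (H x)) scaler2. Qed.

Lemma str_eqP H (K : bop V V) : (forall x, (2 : R) *: Uop2 jmul x (H x) =
      (H \o Uop jmul x) - (Uop jmul x \o K)) <->
  actB M H UB = bm_right M (- K) UB.
Proof.
split=> [h|h x].
  apply: polarization => [x y|x y|x].
  - by rewrite !actBE (UB_sym (H x)) (UB_sym x (H y)) (UB_sym x y) (addrC (U y _)).
  - by rewrite !bm_rightE UB_sym.
  rewrite actB_UB_diag bm_rightE; apply/eqP; rewrite subr_eq mulrN addrC; apply/eqP.
  apply: bop_ext => z; have := congr1 (fun f => f z) (h x).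
  by rewrite Uop2_UB Uop_UB.
have := congr1 (bm_ev M x x) h; rewrite actB_UB_diag bm_rightE => /eqP.
rewrite subr_eq mulrN addrC => /eqP k; apply/funext => z.
have := congr1 (fun f : A => f z) k.
by rewrite Uop2_UB Uop_UB.
Qed.

(** Evaluating at [(e, e)], where [U] is 1, determines [Hbar] as minus the value of [actB H UB]
    there. The existential in [str] disappears and [str] is the kernel of a bounded operator. *)
Lemma str_strB H : str jmul H <-> strB H = 0.
Proof.
rewrite strBE defectB0; split=> [[K /str_eqP h] x y|h].
  by rewrite h !bm_rightE UB_unit mul1r.
exists (- bm_ev M e e (actB M H UB)); apply/str_eqP; apply: bm_ext => x y.
by rewrite bm_rightE opprK.
Qed.

Lemma StrP g : Str jmul g <-> GL V g /\ exists2 gs : A, GL V gs &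
  forall x y, U (g x) (g y) = g * U x y * gs.
Proof.
split=> [[Gg [gs [Ggs h]]]|[Gg [gs Ggs h]]]; split=> //; exists gs => //.
  have : bm_arg2 M g (bm_arg1 M g UB) = bm_right M gs (bm_left M g UB).
    apply: polarization => [x y|x y|x].
    - by rewrite !(bm_arg1E, bm_arg2E) UB_sym.
    - by rewrite !(bm_rightE, bm_leftE) UB_sym.
    rewrite !(bm_arg1E, bm_arg2E, bm_rightE, bm_leftE); apply: bop_ext => z.
    by have := congr1 (fun f => f z) (h x); rewrite !Uop_UB.
  by move=> k x y; have := congr1 (bm_ev M x y) k; rewrite !(bm_arg1E, bm_arg2E, bm_rightE, bm_leftE).
split=> // x; rewrite !Uop_UB h; exact/funext.
Qed.

Lemma Str_GL g : Str jmul g -> GL V g.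
Proof. by case. Qed.

Lemma op_inverse_sym g h : op_inverse g h -> op_inverse h g.
Proof. by case. Qed.

Lemma Str1 : Str jmul 1.
Proof.
have G1 : GL V 1 by exists 1; split; rewrite mulr1.
apply/StrP; split => //; exists 1 => // x y; by rewrite mul1r mulr1.
Qed.

Lemma StrM g h : Str jmul g -> Str jmul h -> Str jmul (g * h).
Proof.
move=> /StrP[[g' gg] [gs [gs' ggs] hg]] /StrP[[h' hh] [hs [hs' hhs] hh2]].
apply/StrP; split; first by exists (h' * g'); exact: op_inverseM.
exists (hs * gs); first by exists (gs' * hs'); exact: op_inverseM.
by move=> x y; rewrite !bopM hg hh2 !mulrA.
Qed.

Lemma StrV g h : Str jmul g -> op_inverse g h -> Str jmul h.
Proof.
move=> /StrP[_ [gs [gs' ggs] hg]] gh; apply/StrP.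
split; first by exists g; exact: op_inverse_sym.
exists gs'; first by exists gs; exact: op_inverse_sym.
move=> x y; have := hg (h x) (h y); rewrite -!bopM gh.1 !bop1 => ->.
by rewrite !mulrA gh.2 mul1r -mulrA ggs.1 mulr1.
Qed.

Lemma Str_subgroup : GL_subgroup (Str jmul).
Proof.
split; [exact: Str_GL|exact: Str1|exact: StrM|exact: StrV].
Qed.

Lemma Str_eqn g h x : Str jmul g -> op_inverse g h ->
  h * U (g x) (g x) = U x x * h * U (g e) (g e).
Proof.
move=> /StrP[_ [gs _ hg]] gh; rewrite !hg UB_unit mulr1 !mulrA gh.2 mul1r.
by rewrite -(mulrA (U x x)) gh.2 mulr1.
Qed.

Lemma Str_of_eqns g h : op_inverse g h ->
  (forall x, h * U (g x) (g x) = U x x * h * U (g e) (g e)) ->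
  (forall x, g * U (h x) (h x) = U x x * g * U (h e) (h e)) ->
  Str jmul g.
Proof.
move=> gh e1 e2; split; first by exists h.
exists (h * U (g e) (g e)); split; last first.
  move=> x; rewrite !Uop_UB; apply/funext => z.
  have := congr1 (fun f : A => g (f z)) (e1 x).
  by rewrite -!bopM !mulrA gh.1 mul1r => ->.
(* The equations at [x = h e] and [x = g e] give [h = U_{he} h U_{ge}] and [g = U_{ge} g U_{he}], so
   [g U_{he}] is a two-sided inverse of [h U_{ge}]. *)
have k1 : h = U (h e) (h e) * h * U (g e) (g e).
  by have := e1 (h e); rewrite -!bopM gh.1 bop1 UB_unit mulr1.
have k2 : g = U (g e) (g e) * g * U (h e) (h e).
  by have := e2 (g e); rewrite -!bopM gh.2 bop1 UB_unit mulr1.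
exists (g * U (h e) (h e)); split.
  by rewrite mulrA -(mulrA h) -(mulrA h) -k2 gh.2.
by rewrite -mulrA (mulrA (U (h e) (h e))) -k1 gh.1.
Qed.

Lemma strB_of_exp H : `|H| < pi / 3 -> Str jmul (op_exp H) -> strB H = 0.
Proof.
move=> Hpi /StrP[_ [gs _ hg]].
have nH : `|actB M H| < pi.
  rewrite (le_lt_trans (actB_norm M H))// mulrC -ltr_pdivlMr//.
(* Once [actB H] is known to preserve [N], it is applied to [UB], which lies in [N] because
   [U_{e,e} = 1]. *)
rewrite strBE; apply: (csub_log (csub_stabilizer defectB) nH); last first.
  by apply/defectB0 => x y; rewrite UB_unit mulr1.
move=> b /defectB0 hb; apply/defectB0 => x y.
rewrite !actB_exp hb hg -!mulrA (mulrA (op_exp (- H))) expNl mul1r.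
by rewrite (hb (op_exp H e)) hg UB_unit mulr1 -!mulrA (mulrA (op_exp (- H)))
  expNl mul1r.
Qed.

Lemma exp_of_strB H : strB H = 0 -> Str jmul (op_exp H).
Proof.
rewrite strBE => /defectB0; set C := bm_ev M e e (actB M H UB) => hC.
apply/StrP; split; first by exists (op_exp (- H)); exact: exp_inverse.
(* Here [C] is [- Hbar]. Since [actB H] and right multiplication by [- C] commute and their sum
   kills [UB], the exponentials fix [UB]; this reads [e^{-H} U(e^H x, e^H y) e^{-C} = U(x, y)]. *)
exists (op_exp C); first by exists (op_exp (- C)); exact: exp_inverse.
have z : (actB M H + bm_right M (- C)) UB = 0.
  by apply: bm_ext => x y; rewrite bopD bop_add bm_rightE hC mulrN subrr bop_zero.
have cm : GRing.comm (actB M H) (bm_right M (- C)).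
  apply: bm_op_ext => b x y; rewrite !bopM !(actBE, bm_rightE).
  by rewrite mulrBl mulrDl mulrA.
have hP : op_exp (actB M H) (bm_right M (op_exp (- C)) UB) = UB.
  by rewrite -bopM bm_right_exp -expD// exp_fix.
move=> x y; have := congr1 (bm_ev M x y) hP; rewrite actB_exp bm_rightE => <-.
by rewrite !mulrA expNr mul1r -mulrA expNl mulr1.
Qed.

Lemma Lie_Str : Lie (Str jmul) = str jmul.
Proof.
apply/seteqP; split=> H /=.
  move=> h; apply/str_strB.
  have k0 : 0 < `|H| + 1 by rewrite ltr_wpDl.
  (* One nonzero [t] with [t *: H] inside the ball of radius [pi / 3] suffices, [strB] being
     linear. *)
  pose t : R := 2^-1 / (`|H| + 1).
  have t0 : 0 < t by rewrite divr_gt0.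
  have : strB (t *: H) = 0.
    apply: strB_of_exp (h t); rewrite normrZ gtr0_norm// /t mulrAC.
    rewrite ltr_pdivrMr//; have := pi_ge2 R; have := normr_ge0 H; nra.
  rewrite bop_scale => /eqP; rewrite scaler_eq0 gt_eqF//= => /eqP //.
move=> /str_strB h t; apply: exp_of_strB; by rewrite bop_scale h scaler0.
Qed.

Lemma exp_ball_Lie_Str (B := [set X : A | `|X| < pi / 3]) :
  [set op_exp X | X in B `&` Lie (Str jmul)] =
  [set op_exp X | X in B] `&` Str jmul.
Proof.
apply/seteqP; split=> g /=.
  move=> [X [BX LX] <-]; split; first by exists X.
  by have := LX 1; rewrite scale1r.
move=> [[X BX <-] Sg]; exists X => //; split => //.
by rewrite Lie_Str; apply/str_strB; exact: strB_of_exp.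
Qed.

End structure_group_of_unital_algebra.
(** * Polynomial equations and charts *)

Section polynomials.
Context (R : realType) (E A B : normedModType R).

Lemma cn_app n (G H : normedModType R) (U : set E) (f : E -> bop G H) (g : E -> G) :
  Cn n U f -> Cn n U g -> Cn n U (fun x => f x (g x)).
Proof. exact: (cn_bil (1 : bop (bop G H) (bop G H))). Qed.

Lemma zero_homogeneous k : @homogeneous_polynomial R E B k (fun=> 0).
Proof.
exists (fun=> 0); split=> //; split=> [i v a x y|]; first by rewrite scaler0 addr0.
by exists 0 => v; rewrite normr0 mul0r.
Qed.

Lemma cubic_polynomial (T : bop A (bop A (bop A B))) (p q : bop E A) :
  polynomial_map (fun u => T (p u) (q u) (q u)).
Proof.
pose P u := T (p u) (q u) (q u).
(* The degrees in [polynomial_map] run below the bound, so degree 3 needs the bound 4. *)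
exists 4%N, (fun k : 'I_4 => if val k == 3 then P else fun=> 0); split; last first.
  by move=> u; rewrite !big_ord_recl big_ord0 /= !add0r addr0.
case=> [[|[|[|[|//]]]] k3] /=; try exact: zero_homogeneous.
pose i0 : 'I_3 := Ordinal (isT : (0 < 3)%N).
pose i1 : 'I_3 := Ordinal (isT : (1 < 3)%N).
pose i2 : 'I_3 := Ordinal (isT : (2 < 3)%N).
exists (fun v => T (p (v i0)) (q (v i1)) (q (v i2))); split=> //; split.
  case=> [[|[|[|//]]] k] v a x y; rewrite /eq_op /=.
  - by rewrite !(bop_add, bop_scale).
  - by rewrite !(bop_add, bop_scale).
  - by rewrite !(bop_add, bop_scale).
exists (`|T| * `|p| * `|q| * `|q|) => v.
have -> : \prod_(i < 3) `|v i| = `|v i0| * `|v i1| * `|v i2|.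
  rewrite !big_ord_recl big_ord0 mulr1 mulrA.
  by congr (`|v _| * `|v _| * `|v _|); exact/val_inj.
rewrite (le_trans (bil_norm _ _ _))//.
have h0 := le_bop_norm p (v i0); have h1 := le_bop_norm q (v i1).
have h2 := le_bop_norm q (v i2).
rewrite (@le_trans _ _ (`|T| * (`|p| * `|v i0|) * (`|q| * `|v i1|) * (`|q| * `|v i2|)))//.
  rewrite !ler_pM// ?mulr_ge0// (le_trans (le_bop_norm _ _))// ler_wpM2l//.
by rewrite le_eqVlt; apply/orP; left; apply/eqP; ring.
Qed.

End polynomials.

(** * Smooth maps into an embedded submanifold *)

Section manifold_maps.
Context (R : realType) (X : normedModType R) (M : set X).

(** In a chart the map takes values in the range of the inclusion; pointwise chosen coordinates (0
    where the chart is undefined) are smooth by [cn_factor]. *)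
Lemma smooth_into_of_smooth (E : normedModType R) (U : set E) (f : E -> X) :
  smooth_on U f -> (forall u, U u -> M (f u)) -> smooth_into M U f.
Proof.
move=> sf UM; split=> // c.
have /choice[m hm] : forall u, exists v, U u /\ dom c (f u) -> fwd c (f u) = Defs.incl c v.
  move=> u; have [[Uu du]|n] := pselect (U u /\ dom c (f u)); last by exists 0.
  by have /(fwd_flat du)[v _ vE] := UM u Uu; exists v => _.
exists m; split=> [|u Uu du]; last exact: hm.
have [oU' cF] := smooth_comp sf (fwd_smooth c).
split=> // n; apply: (@cn_factor R n E X (model c) (Defs.incl c) m (fwd c \o f) _
  (@incl_isometry _ _ _ c) oU' _ (cF n)).
by move=> u hu; exact: hm.
Qed.

Lemma param_in (c : submanifold_chart M) v : param_dom v -> M (@param _ _ _ c v).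
Proof.
move=> cv; have dv := bwd_dom cv.
by apply/(fwd_flat dv); rewrite bwdK//; exists v.
Qed.

Lemma param_smooth (c : submanifold_chart M) (E : normedModType R) (p : bop E (model c)) :
  smooth_on [set u | param_dom (p u)] (fun u => @param _ _ _ c (p u)).
Proof.
have s1 : smooth_on setT (bcomp (Defs.incl c) p).
  by split; [exact: openT|move=> n; exact: cn_bop].
have [oU cU] := smooth_comp s1 (bwd_smooth c).
have E1 : [set u | param_dom (p u)] = [set x | setT x /\ cod c (bcomp (Defs.incl c) p x)].
  by apply/seteqP; split=> u //= [].
by rewrite E1; split.
Qed.

End manifold_maps.

(** * Groups given near 1 by a linear equation on the logarithm *)

Section embedded_subgroup.
Context (R : realType) (V : completeNormedModType R) (G : set (bop V V)).
Context (Z : normedModType R) (L : bop (bop V V) Z).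
Hypothesis Ggrp : GL_subgroup G.
Hypothesis GL_exp : forall X : bop V V, `|X| < 4^-1 -> (G (op_exp X) <-> L X = 0).
Implicit Types (g h x H X : bop V V).

Lemma smooth_mull h : smooth_on setT (fun x => h * x).
Proof.
split; [exact: openT|move=> n].
have -> : (fun x => h * x) = postB V V V h by apply/funext => x; exact: bop_ext.
exact: cn_bop.
Qed.

Lemma chart_at g : G g -> exists c : submanifold_chart G, dom c g.
Proof.
move=> Gg; have [GsubGL G1 GM GV] := Ggrp.
have [h gh] := GsubGL g Gg; have Gh := GV g h Gg gh.
pose D : set (bop V V) := [set x | @exp_ball R V (h * x)].
pose F x := op_log (h * x).
pose K X := g * op_exp X.
have hK X : h * K X = op_exp X by rewrite /K mulrA gh.2 mul1r.
have sD : smooth_on D F.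
  have [oU cU] := smooth_comp (smooth_mull h) (@op_log_smooth R V).
  have E1 : D = [set x | setT x /\ @exp_ball R V (h * x)].
    by apply/seteqP; split=> u //= [].
  by rewrite E1; split.
have sC : smooth_on (@small_ball R V) K.
  have [oU cU] := smooth_comp (@exp_smooth R V) (smooth_mull g).
  apply: (smooth_sub (U := [set x | setT x /\ setT (op_exp x)])) => //.
  apply/open_eps => x xb; exists (4^-1 - `|x|); first by rewrite subr_gt0.
  move=> y xy; rewrite /small_ball /= -(subrK x y).
  rewrite (le_lt_trans (ler_normD _ _))// distrC -ltrBrDr //.
have FC x : D x -> @small_ball R V (F x) by move=> /op_logP[].
have KD X : @small_ball R V X -> D (K X) by move=> sX; rewrite /D /= hK; exists X.
have FK x : D x -> K (F x) = x.
  by move=> /op_logP[_ xE]; rewrite /K xE mulrA gh.1 mul1r.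
have KF X : @small_ball R V X -> F (K X) = X.
  by move=> sX; rewrite /F hK op_logK.
have flat x : D x -> (G x <-> range (bker_incl L) (F x)).
  move=> Dx; rewrite range_bker_incl -(GL_exp (FC x Dx)).
  have [_ ->] := op_logP Dx; split=> [Gx|Ghx]; first exact: GM.
  by have := GM _ _ Gg Ghx; rewrite mulrA gh.1 mul1r.
exists (@SubmanifoldChart R (bop V V) G (bker L) (bker_incl L) D (@small_ball R V) F K
  (@bker_incl_isometry _ _ _ L) sD sC FC KD FK KF flat).
rewrite /D /= gh.2; exists 0; last exact: exp0.
by rewrite /small_ball /= normr0 invr_gt0.
Qed.

Lemma smooth_ops : smooth_group_operations G.
Proof.
have [GsubGL G1 GM GV] := Ggrp; split=> [c1 c2|c].
  have [op1 s1] := param_smooth (c := c1) (fstB (model c1) (model c2)).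
  have [op2 s2] := param_smooth (c := c2) (sndB (model c1) (model c2)).
  apply: smooth_into_of_smooth => [|u [u1 u2]]; last by apply: GM; exact: param_in.
  split; first exact: openI op1 op2.
  move=> n; have -> : (fun u : model c1 * model c2 => param u.1 * param u.2) =
      (fun u : model c1 * model c2 => postB V V V (param u.1) (param u.2)).
    by apply/funext => u; exact: bop_ext.
  apply: cn_bil; first by apply: cn_sub (s1 n) => u [].
  by apply: cn_sub (s2 n) => u [].
have sp := param_smooth (c := c) (1 : bop (model c) (model c)).
apply: smooth_into_of_smooth => [|u cu]; last first.
  by have pu := param_in cu; exact: (GV _ _ pu (op_invP (GsubGL _ pu))).
apply: smooth_sub (smooth_comp sp (@op_inv_smooth R V)); first exact: sp.1.
by move=> u cu; split=> //; apply: GsubGL; exact: (param_in cu).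
Qed.

Lemma diff_derive (X : normedModType R) (f : R^o -> X) (D : bop R^o X) :
  is_diff (0 : R^o) f D -> is_derive (0 : R^o) 1 f (D 1).
Proof.
move=> [df dv]; split; first exact: diff_derivable.
by rewrite deriveE// dv.
Qed.

Lemma exp_line_diff H : is_diff (0 : R^o) (fun t : R^o => op_exp (t *: H)) (lineB H).
Proof.
apply/diff_eps => e e0; pose K := `|H| + 1; have K0 : 0 < K by rewrite ltr_wpDl.
have HK : `|H| <= K by rewrite lerDl.
exists (Num.min (2^-1 / K) (e / (2 * K ^+ 2))) => [|t].
  by rewrite lt_min !divr_gt0// mulr_gt0// exprn_gt0.
rewrite lt_min => /andP[t1 t2]; rewrite add0r scale0r exp0.
have nt : `|t *: H| <= `|t| * K by rewrite normrZ ler_wpM2l.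
have t1' : `|t| * K <= 2^-1 by rewrite -ler_pdivlMr// ltW.
have := exp_sub1_le (le_trans nt t1'); rewrite -[lineB H t]/(t *: H).
move=> h; rewrite (le_trans h)//.
rewrite (@le_trans _ _ (2 * (`|t| * K) * (`|t| * K)))//.
  by rewrite ler_pM// ?mulr_ge0// ler_wpM2l.
have -> : 2 * (`|t| * K) * (`|t| * K) = (`|t| * (2 * K ^+ 2)) * `|t| by ring.
by rewrite ler_wpM2r// -ler_pdivlMr ?mulr_gt0 ?exprn_gt0// ltW.
Qed.

(* Along a curve in [G] through 1 the logarithm takes its values in the kernel
   of [L], and [log Z] agrees with [Z - 1] to first order. *)
Lemma tangent_ker v : tangent_space G 1 v -> L v = 0.
Proof.
move=> [U [c [U0 [oU cU] cG c0 cv]]].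
have [dc [dcd _]] := cU 1%N.
have d0 := dcd 0 U0.
have vE : v = dc 0 1.
  have [_ <-] := cv; have [df <-] := d0; exact: deriveE.
have [d1 d10 h1] := diff_lip d0; move: (d0) => /diff_eps h2.
move/open_eps: oU => /(_ 0 U0)[d2 d20 hU].
pose K := `|dc 0| + 1; have K0 : 0 < K by rewrite ltr_wpDl.
have /open_eps oB := @local_image_open R (bop V V) (@op_exp R V) 4^-1 (@exp_near_id R V).
have [|d3 d30 hB] := oB 1.
  by exists 0; rewrite ?exp0//= normr0 invr_gt0.
pose N := `|L| + 1; have N0 : 0 < N by rewrite ltr_wpDl.
have LN x : `|L x| <= N * `|x|.
  by rewrite (le_trans (le_bop_norm _ _))// ler_wpM2r// lerDl.
suff H e : 0 < e -> `|L v| <= e.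
  apply/eqP; rewrite -normr_le0; apply/ler_addgt0Pr => e e0; rewrite add0r; exact: H.
move=> e0; have eN : 0 < e / 2 / N by rewrite !divr_gt0.
have [d4 d40 h4] := h2 _ eN.
(* The logarithm [x] of [z] has norm at most [2 K |t|], so [z - 1 - x] has norm at most [8 K^2 t^2];
   below [d5], its image under [L] is at most [e / 2] times [|t|]. *)
pose d5 := e / 2 / (N * 8 * K ^+ 2).
have d50 : 0 < d5 by rewrite !divr_gt0// !mulr_gt0// exprn_gt0.
pose m := Num.min (Num.min (Num.min d1 d2) (Num.min (d3 / K) d4)) d5.
have m0 : 0 < m by rewrite !lt_min d10 d20 d40 d50 divr_gt0.
pose t : R^o := m / 2.
have t0 : 0 < t by rewrite divr_gt0.
have tm : `|t| < m by rewrite gtr0_norm// /t ltr_pdivrMr// ltr_pMr// ltr1n.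
have nt : `|t| = t by rewrite gtr0_norm.
clearbody t.
move: tm; rewrite /m !lt_min => /andP[/andP[/andP[t1 t2] /andP[t3 t4]] t5].
have Ut : U t by apply: hU; rewrite sub0r normrN.
have Gt := cG t Ut; set z := c t in Gt.
have z1 : `|z - 1| <= K * `|t| by have := h1 t t1; rewrite add0r c0.
have z2 : `|z - 1 - t *: v| <= e / 2 / N * `|t|.
  have dt : dc 0 t = t *: v.
    by rewrite vE -bop_scale; congr (dc 0 _); rewrite /GRing.scale /= mulr1.
  by have := h4 t t4; rewrite add0r c0 dt.
have zb : exp_ball z.
  apply: hB; rewrite distrC (le_lt_trans z1)// mulrC -ltr_pdivlMr//.
have [xb xz] := op_logP zb; set x := op_log z in xb xz.
have Lx : L x = 0 by apply/(GL_exp xb); rewrite xz.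
have z0 : small_ball (0 : bop V V) by rewrite /small_ball /= normr0 invr_gt0.
have x1 : `|x| <= 2 * `|z - 1|.
  have := local_expand (@exp_near_id R V) xb z0.
  by rewrite subr0 exp0 xz.
have x2 : `|z - 1 - x| <= 2 * `|x| * `|x|.
  rewrite -{1}xz; apply: exp_sub1_le.
  rewrite (le_trans (ltW xb))// lef_pV2 ?posrE// ler_nat//.
have x3 : `|z - 1 - x| <= 8 * K ^+ 2 * `|t| * `|t|.
  rewrite (le_trans x2)//.
  have x4 : `|x| <= 2 * (K * `|t|) by rewrite (le_trans x1)// ler_wpM2l.
  rewrite (@le_trans _ _ (2 * (2 * (K * `|t|)) * (2 * (K * `|t|))))//.
    by rewrite ler_pM// ?mulr_ge0// ler_wpM2l.
  by rewrite le_eqVlt; apply/orP; left; apply/eqP; ring.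
have E1 : t *: L v = L (z - 1 - x) - L (z - 1 - t *: v).
  rewrite -bop_sub -bop_scale -[in RHS]addrA opprB.
  have -> : z - 1 + (- x + (t *: v - (z - 1))) = t *: v - x.
    by rewrite addrC -addrA subrK addrC.
  by rewrite bop_sub Lx subr0.
have : `|t *: L v| <= e * `|t|.
  rewrite E1 (le_trans (ler_normB _ _))//.
  have -> : e * `|t| = e / 2 * `|t| + N * (e / 2 / N * `|t|).
    by field; rewrite gt_eqF.
  apply: lerD; rewrite (le_trans (LN _))// ?ler_wpM2l// ?(ltW N0)//.
  rewrite (@le_trans _ _ (N * (8 * K ^+ 2 * `|t| * `|t|)))//.
    by rewrite ler_wpM2l// ltW.
  have -> : N * (8 * K ^+ 2 * `|t| * `|t|) = (N * 8 * K ^+ 2 * `|t|) * `|t| by ring.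
  rewrite ler_wpM2r// -ler_pdivlMl; first by rewrite mulrC ltW.
  by rewrite !mulr_gt0// exprn_gt0.
by rewrite normrZ mulrC nt ler_pM2r.
Qed.

Lemma tangent_Lie : Lie G = [set H | L H = 0] -> tangent_space G 1 = Lie G.
Proof.
move=> LieL; apply/seteqP; split=> v; first by rewrite LieL; exact: tangent_ker.
move=> hv; exists setT, (fun t : R^o => op_exp (t *: v)); split=> //.
- have sl : smooth_on setT (lineB v) by split; [exact: openT|move=> n; exact: cn_bop].
  apply: smooth_sub (smooth_comp sl (@exp_smooth R V)); first exact: openT.
  by move=> t _; split.
- by rewrite scale0r exp0.
- have := diff_derive (exp_line_diff v).
  by rewrite -[lineB v 1]/((1 : R) *: v) scale1r.
Qed.

Lemma embedded_subgroupP : closure G `&` GL V `<=` G ->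
  Lie G = [set H | L H = 0] -> embedded_Banach_Lie_subgroup G.
Proof.
move=> clG LieL; split=> //; first exact: chart_at.
- exact: smooth_ops.
- exact: tangent_Lie.
Qed.

End embedded_subgroup.

(** * The cubic equations as trilinear maps *)

Section cubic.
Context (R : realType) (V : completeNormedModType R).
Let A := bop V V.
Context (U : bop V (bop V A)) (e : V).
Implicit Types g h k : bop V V.

Definition cubic_at (x : V) : bop A (bop A A) :=
  bcomp (preB A V A (evB V V x)) (bcomp U (evB V V x)).

Lemma cubic_atE x g h : cubic_at x g h = U (g x) (h x).
Proof. by rewrite /cubic_at !(bcompE, preBE, evBE). Qed.

Definition cubic_left (x : V) : bop A (bop A (bop A A)) :=
  bcomp (preB A (bop A A) (bop A A) (cubic_at x))
    (bcomp (postB A A A) (postB V V V)).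

Lemma cubic_leftE x k g h : cubic_left x k g h = k * U (g x) (h x).
Proof.
rewrite /cubic_left (bcompE (preB A (bop A A) (bop A A) (cubic_at x)) _ k).
rewrite (preBE (cubic_at x)) (bcompE _ (cubic_at x) g) (bcompE (postB A A A) _ k).
rewrite (postBE (postB V V V k)) (bcompE _ (cubic_at x g) h) cubic_atE.
by rewrite postBE bcompM.
Qed.

Definition unit_cubic (x : V) : bop A (bop A (bop A A)) :=
  cubic_left x - bcomp (cubic_left e) (postB V V V (U x x)).

Lemma unit_cubicE x k g h :
  unit_cubic x k g h = k * U (g x) (h x) - U x x * k * U (g e) (h e).
Proof.
rewrite /unit_cubic (bopD (cubic_left x)) bopN (bcompE (cubic_left e) _ k) postBE bcompM.
rewrite (bopD (cubic_left x k)) bopN (bopD (cubic_left x k g)) bopN.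
by rewrite !cubic_leftE.
Qed.

(** Only the evaluation formula is passed on, so that the nested operator spaces stay opaque in the
    algebraicity proof. *)
Lemma unit_cubic_exists : exists C : V -> bop A (bop A (bop A A)),
  forall x k g h, C x k g h = k * U (g x) (h x) - U x x * k * U (g e) (h e).
Proof. by exists unit_cubic; exact: unit_cubicE. Qed.

End cubic.

(** * Algebraicity and relative closedness of the structure group *)

Section structure_group_is_algebraic.
Context (R : realType) (V : completeNormedModType R).
Context (jmul : V -> V -> V) (e : V).
Hypothesis jlin : forall x, linear (jmul x).
Hypothesis jcomm : commutative jmul.
Hypothesis junit : left_id e jmul.
Hypothesis jnorm : forall x y, `|jmul x y| <= `|x| * `|y|.
Let A := bop V V.
Context (M : bilinear_model V) (UB : M).
Hypothesis UB_spec : forall x y, bm_ev M x y UB = UB_curried jlin jcomm jnorm x y.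
Notation U x y := (bm_ev M x y UB).
Context (Str_cubic : V -> bop A (bop A (bop A A))).
Hypothesis Str_cubicE : forall x k g h,
  Str_cubic x k g h = k * U (g x) (h x) - U x x * k * U (g e) (h e).
Implicit Types (g h : bop V V).

Lemma Str_cubicP g h : op_inverse g h -> Str jmul g <->
  forall x, Str_cubic x h g g = 0 /\ Str_cubic x g h h = 0.
Proof.
move=> gh; have hg := op_inverse_sym gh; split=> [Sg x|eqs].
  have Sh : Str jmul h by exact: (StrV UB_spec Sg gh).
  rewrite !Str_cubicE (Str_eqn junit UB_spec _ Sg gh).
  by rewrite (Str_eqn junit UB_spec _ Sh hg) !subrr.
apply: (Str_of_eqns junit UB_spec gh) => x; have [e1 e2] := eqs x.
  by apply/eqP; rewrite -subr_eq0 -Str_cubicE e1.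
by apply/eqP; rewrite -subr_eq0 -Str_cubicE e2.
Qed.

Definition Str_poly (i : bool * V) (u : A * A) : A :=
  if i.1 then Str_cubic i.2 u.2 u.1 u.1 else Str_cubic i.2 u.1 u.2 u.2.

Lemma Str_poly_polynomial i : polynomial_map (Str_poly i).
Proof.
case: i => [[] x].
  exact: (cubic_polynomial (Str_cubic x) (sndB A A) (fstB A A)).
exact: (cubic_polynomial (Str_cubic x) (fstB A A) (sndB A A)).
Qed.

Lemma Str_poly_zero g h : op_inverse g h ->
  Str jmul g <-> forall i, Str_poly i (g, h) = 0.
Proof.
move=> gh; split=> [/(Str_cubicP gh) hx [[] x]|hx]; rewrite /Str_poly /=.
- exact: (hx x).1.
- exact: (hx x).2.
apply/(Str_cubicP gh) => x; split; first exact: (hx (true, x)).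
exact: (hx (false, x)).
Qed.

Lemma Str_algebraic : algebraic_subgroup (Str jmul).
Proof.
split; first exact: (Str_subgroup UB_spec).
exists (bool * V)%type, Str_poly; split; first exact: Str_poly_polynomial.
apply/seteqP; split=> [g Sg|g [h [gh hi]]]; last exact/(Str_poly_zero gh).
have [h gh] := Str_GL Sg; exists h; split=> //; exact/(Str_poly_zero gh).
Qed.

(** Inversion is continuous on [GL V], so each equation, with [h] the inverse of [g], is a
    continuous function of [g]; vanishing on [Str], it vanishes at limit points in [GL V]. *)
Lemma Str_closed : closure (Str jmul) `&` GL V `<=` Str jmul.
Proof.
move=> g [clg Gg]; have gh := op_invP Gg.
suff H (s : A -> A -> A) (F := fun k => s k (op_inv k)) :
    Cn 0 (GL V) F -> (forall k, Str jmul k -> F k = 0) -> F g = 0.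
  apply/(Str_cubicP gh) => x; split.
    apply: (H (fun k h => Str_cubic x h k k)) => [|k Sk]; last first.
      have kh := op_invP (Str_GL Sk).
      by have [] := iffLR (Str_cubicP kh) Sk x.
    apply: cn_app; last exact: (cn_bop _ _ (1 : bop A A)).
    apply: cn_app; last exact: (cn_bop _ _ (1 : bop A A)).
    by apply: cn_bop_comp; exact: op_inv_cn.
  apply: (H (fun k h => Str_cubic x k h h)) => [|k Sk]; last first.
    have kh := op_invP (Str_GL Sk).
    by have [] := iffLR (Str_cubicP kh) Sk x.
  apply: cn_app; last exact: op_inv_cn.
  apply: cn_app; last exact: op_inv_cn.
  exact: cn_bop.
move=> cF F0; apply/eqP; apply: contraT => Fg.
have nF : 0 < `|F g| by rewrite normr_gt0.
have [d d0 hd] := iffLR (cont_eps F g) (cF g Gg) _ nF.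
have [k [Sk gk]] : Str jmul `&` ball g d !=set0 by apply: clg; exact: nbhsx_ballx.
have : `|g - k| < d by move: gk; rewrite -ball_normE.
by move=> /hd; rewrite (F0 k Sk) subr0 ltxx.
Qed.

End structure_group_is_algebraic.

Unset Implicit Arguments.
Set Strict Implicit.

Theorem theorem3p14 (R : realType) (V : completeNormedModType R)
    (jmul : V -> V -> V) (e : V) (hV : is_JB_algebra jmul e) :
  [/\ algebraic_subgroup (Str jmul),
      embedded_Banach_Lie_subgroup (Str jmul),
      (let B := [set X : bop V V | `|X| < pi / 3] in
       [set op_exp X | X in B `&` Lie (Str jmul)] =
       [set op_exp X | X in B] `&` Str jmul) &
      Lie (Str jmul) = str jmul].
Proof.
case: hV => jlin jcomm junit _ jnorm _ _.
have [M hM] := bilinear_model_exists V.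
have [UB UB_spec] := hM (UB_curried jlin jcomm jnorm).
have [C hC] := unit_cubic_exists (UB_curried jlin jcomm jnorm) e.
have CE x k g h : C x k g h = k * bm_ev M (g x) (h x) UB -
    bm_ev M x x UB * k * bm_ev M (g e) (h e) UB by rewrite hC !UB_spec.
have LS := Lie_Str junit UB_spec.
split=> //; last exact: (exp_ball_Lie_Str junit UB_spec).
- exact: (Str_algebraic junit UB_spec CE).
- apply: (@embedded_subgroupP _ _ _ _ (strB e UB)).
  + exact: (Str_subgroup UB_spec).
  (* As [1/4 < pi / 3], both implications between [Str] for [op_exp X] and the kernel of [strB] for
     [X] hold on the ball where the logarithm is defined. *)
  + move=> X X4; split; last exact: (exp_of_strB UB_spec).
    apply: (strB_of_exp junit UB_spec).
    by rewrite (lt_trans X4)//; have := pi_ge2 R; lra.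
  + exact: (Str_closed junit UB_spec CE).
  + rewrite LS; apply/seteqP; split=> H hH.
      exact: (iffLR (str_strB junit UB_spec H)).
    exact: (iffRL (str_strB junit UB_spec H)).
Qed.
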